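(* Let $T$ be a continuous linear operator on $\mathrm{Hol}(\mathbb{D})$. (i) If $T=C_\varphi$ is a composition operator ($C_\varphi f=f\circ\varphi$, with $\varphi$ a holomorphic self-map of $\mathbb{D}$), then $T$ is similar to a linear isometry of $\mathrm{Hol}(\mathbb{D})$ if and only if $\varphi$ is bijective and elliptic (i.e. has a fixed point in $\mathbb{D}$). (ii) If $T=M_m$ is a multiplication operator ($M_m f=mf$, with $m\in\mathrm{Hol}(\mathbb{D})$), then $T$ is similar to a linear isometry of $\mathrm{Hol}(\mathbb{D})$ if and only if $m$ is constant and unimodular. (iii) If $T=W_{m,\varphi}$ is a weighted composition operator ($W_{m,\varphi}f=m\,(f\circ\varphi)$, with $m\in\mathrm{Hol}(\mathbb{D})$ and $\varphi$ a holomorphic self-map of $\mathbb{D}$), then $T$ is similar to a linear isometry of $\mathrm{Hol}(\mathbb{D})$ if and only if $\varphi$ is bijective and elliptic and $\sigma_p(W_{m,\varphi})\cap\mathbb{T}\neq\varnothing$.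
   Context: $\mathbb{D}$ is the open unit disc, $\mathbb{T}$ the unit circle, and $\mathrm{Hol}(\mathbb{D})$ the Fréchet space of holomorphic functions on $\mathbb{D}$ with seminorms $\|f\|_{\infty,1-1/p}=\sup_{|z|\le 1-1/p}|f(z)|$, $p\in\mathbb{N}$, and metric $d(f,g)=\sum_{p\ge1}2^{-p}\min(1,\|f-g\|_{\infty,1-1/p})$. A linear isometry of $\mathrm{Hol}(\mathbb{D})$ is a linear operator that is an isometry for $d$ (equivalently, preserves every seminorm $\|\cdot\|_{\infty,1-1/p}$). $\mathcal{L}(\mathrm{Hol}(\mathbb{D}))$ denotes the continuous linear operators on $\mathrm{Hol}(\mathbb{D})$; two operators $T,V\in\mathcal{L}(\mathrm{Hol}(\mathbb{D}))$ are similar if there is an invertible $U\in\mathcal{L}(\mathrm{Hol}(\mathbb{D}))$ with $U^{-1}TU=V$. $\sigma_p(W)$ is the point spectrum: the set of $\lambda\in\mathbb{C}$ such that $Wf=\lambda f$ for some nonzero $f\in\mathrm{Hol}(\mathbb{D})$. *)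

(* Defs.v *)
From Stdlib Require Import Reals.
From Coquelicot Require Import Coquelicot.
Open Scope R_scope.

Definition disc (z : C) : Prop := Cmod z < 1.

Definition cdiff (f : C -> C) (z : C) : Prop :=
  @ex_derive C_AbsRing C_NormedModule f z.

(* Hol(D): functions holomorphic on D, normalized to 0 off D so that an element
   is determined by its restriction to D. *)
Record Hol : Type := mkHol {
  hf :> C -> C ;
  hf_hol : forall z, disc z -> cdiff hf z ;
  hf_out : forall z, ~ disc z -> hf z = 0%C }.

Definition seminorm (p : nat) (f : C -> C) : R :=
  real (Lub_Rbar (fun x => exists z : C, Cmod z <= 1 - / INR p /\ x = Cmod (f z))).

Definition dist (f g : Hol) : R :=
  Series (fun n : nat => (/ 2) ^ (S n) *
     Rmin 1 (seminorm (S n) (fun z => Cminus (f z) (g z)))).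

Definition is_linear (T : Hol -> Hol) : Prop :=
  (forall f g h : Hol, (forall z, h z = Cplus (f z) (g z)) ->
      forall z, T h z = Cplus (T f z) (T g z)) /\
  (forall (a : C) (f h : Hol), (forall z, h z = Cmult a (f z)) ->
      forall z, T h z = Cmult a (T f z)).

Definition is_continuous (T : Hol -> Hol) : Prop :=
  forall (f : Hol) (eps : R), 0 < eps -> exists delta : R, 0 < delta /\
    forall g : Hol, dist f g < delta -> dist (T f) (T g) < eps.

Definition is_CLO (T : Hol -> Hol) : Prop := is_linear T /\ is_continuous T.

Definition is_lin_isometry (V : Hol -> Hol) : Prop :=
  is_linear V /\ forall f g : Hol, dist (V f) (V g) = dist f g.

Definition similar (T V : Hol -> Hol) : Prop :=
  exists U Uinv : Hol -> Hol, is_CLO U /\ is_CLO Uinv /\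
    (forall f : Hol, hf (U (Uinv f)) = hf f) /\
    (forall f : Hol, hf (Uinv (U f)) = hf f) /\
    (forall f : Hol, hf (Uinv (T (U f))) = hf (V f)).

Definition similar_to_isometry (T : Hol -> Hol) : Prop :=
  exists V : Hol -> Hol, is_CLO V /\ is_lin_isometry V /\ similar T V.

(* holomorphic self-maps of D (values off D are irrelevant) *)
Definition hol_selfmap (phi : C -> C) : Prop :=
  forall z, disc z -> cdiff phi z /\ disc (phi z).

Definition bijective_on_D (phi : C -> C) : Prop :=
  (forall z w, disc z -> disc w -> phi z = phi w -> z = w) /\
  (forall w, disc w -> exists z, disc z /\ phi z = w).

Definition elliptic (phi : C -> C) : Prop := exists z, disc z /\ phi z = z.

Definition is_wcomp_op (T : Hol -> Hol) (m : Hol) (phi : C -> C) : Prop :=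
  forall (f : Hol) z, disc z -> T f z = Cmult (m z) (f (phi z)).
Definition is_comp_op (T : Hol -> Hol) (phi : C -> C) : Prop :=
  forall (f : Hol) z, disc z -> T f z = f (phi z).
Definition is_mult_op (T : Hol -> Hol) (m : Hol) : Prop :=
  forall (f : Hol) z, disc z -> T f z = Cmult (m z) (f z).

Definition in_point_spectrum (W : Hol -> Hol) (lam : C) : Prop :=
  exists f : Hol, (exists z, f z <> 0%C) /\ forall z, W f z = Cmult lam (f z).

Definition const_unimodular (m : Hol) : Prop :=
  exists c : C, Cmod c = 1 /\ forall z, disc z -> m z = c.

(* Main.v *)
(** A linear isometry [V] preserves every seminorm, hence [V f z = al * f (be * z)] with
    [al], [be] unimodular: [V 1] and [V z] are determined by the strong maximum principle,
    and then, at a point of the circle [|z| = 1/2], [f |-> V f z / al] is a unital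
    contraction, hence positive, mapping [z] to a point of the same circle, so it is the
    evaluation at that point.

    If [U^-1 W U = V], then [U 1] is an eigenvector of [W] for [al].  Solving [W h = 1],
    [W h = z] and [W h = m / (phi - w)] shows that [phi] is bijective, hence a Moebius map,
    and equicontinuity of the powers of [W], tested on the monomials at 0, keeps the orbit
    of 0 in a compact disc, so [phi] has a fixed point.

    Conversely, [phi] is conjugate to a rotation [z |-> be * z], and the eigenvector
    equation [m z * f (be * z) = lam * f z] has to be solved with a zero-free [g] (and
    another unimodular constant) in place of [f]; multiplication by [g] then conjugates
    [W] to an isometry.  If [be] is not a root of unity, [g] is [f] divided by a power of
    [z].  If [be ^ N = 1], then [m] is zero-free and
    [g = exp (- 1/N * sum_(j < N) j L (be^j z))] where [L] is the logarithm of [m / m 0].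

    Complex analysis is built on the maximum principle instead of Cauchy's formula:
    Goursat's lemma provides primitives, which have Peano expansions of order 2 and so
    obey the maximum principle; applied to divided differences, it yields the removability
    of isolated singularities and the differentiability of derivatives. *)

Require Import Defs.
From Stdlib Require Import Reals Lra Lia Psatz List Classical ClassicalEpsilon FunctionalExtensionality.
From Coquelicot Require Import Coquelicot.
Import Defs.
Open Scope R_scope.

(** * Pointwise differentiability *)

(** Parts (i) and (ii) are the cases [m = 1] and [phi = id] of (iii). The eigenvector of (iii)
    cannot serve as it stands, because the similarity divides by it: it may vanish at the fixed
    point and, when [be ^ N = 1], elsewhere too, as [z ^ N - c] does for [m = 1]. No power of [z]
    removes such zeros, so in that case the solution is rebuilt from the logarithm of [m]. A single
    value of the metric mixes all the seminorms. They are separated by scaling: [dist (t f) 0] is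
    known for every [t > 0]. In the complex analysis, the maximum principle requires an expansion of
    order 2 at each point, whereas the hypothesis supplies only order 1. A primitive has order 2,
    its successive slopes inherit it by removability, and writing the function through these slopes
    transfers it back. *)

Definition ccont (f : C -> C) (z : C) : Prop :=
  forall eps, 0 < eps -> exists d, 0 < d /\
    forall w, Cmod (w - z) < d -> Cmod (f w - f z) < eps.

(* Caratheodory's form of n-fold (Peano) differentiability: the closure
   properties become algebraic. *)
Fixpoint Dn (n : nat) (f : C -> C) (z : C) : Prop :=
  match n with
  | O => ccont f z
  | S n => exists q, (forall w, f w = f z + (w - z) * q w)%C /\ Dn n q z
  end.

Lemma Cmod_sub_sym (x y : C) : Cmod (x - y) = Cmod (y - x).
Proof. rewrite <- (Cmod_opp (x - y)). f_equal. ring. Qed.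

Lemma Cmod_sub_self (x : C) : Cmod (x - x) = 0.
Proof. replace (x - x)%C with (RtoC 0) by ring. apply Cmod_0. Qed.

Lemma Cmod_rev_triangle (x y : C) : Cmod x - Cmod y <= Cmod (x - y).
Proof.
  assert (H := Cmod_triangle (x - y) y).
  replace (x - y + y)%C with x in H by ring. lra.
Qed.

Lemma Cmod_minus_le (x y : C) : Cmod (x - y) <= Cmod x + Cmod y.
Proof.
  assert (H := Cmod_triangle x (- y)). rewrite Cmod_opp in H. exact H.
Qed.

Lemma Cmod_sub_triangle (x y z : C) : Cmod (x - z) <= Cmod (x - y) + Cmod (y - z).
Proof.
  replace (x - z)%C with ((x - y) + (y - z))%C by ring. apply Cmod_triangle.
Qed.

Lemma Csub_neq_0 (x y : C) : x <> y -> (x - y)%C <> 0%C.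
Proof. apply Cminus_eq_contra. Qed.

Lemma Cmod_le_parts (z : C) : Cmod z <= Rabs (fst z) + Rabs (snd z).
Proof.
  destruct z as [x y]. simpl.
  replace (x, y) with (RtoC x + Ci * RtoC y)%C by (apply injective_projections; simpl; ring).
  eapply Rle_trans; [apply Cmod_triangle|]. rewrite Cmod_mult, Cmod_Ci, !Cmod_R. lra.
Qed.

Lemma ccont_const (c z : C) : ccont (fun _ => c) z.
Proof.
  intros e He. exists 1; split; [lra|]. intros. rewrite Cmod_sub_self. lra.
Qed.

Lemma ccont_id (z : C) : ccont (fun w => w) z.
Proof. intros e He. exists e; auto. Qed.

Lemma ccont_plus (f g : C -> C) z : ccont f z -> ccont g z -> ccont (fun w => f w + g w)%C z.
Proof.
  intros Hf Hg e He.
  destruct (Hf (e/2)) as [d [Hd H1]]; [lra|].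
  destruct (Hg (e/2)) as [d' [Hd' H2]]; [lra|].
  exists (Rmin d d'); split; [apply Rmin_glb_lt; auto|]. intros w Hw.
  assert (A := H1 w (Rlt_le_trans _ _ _ Hw (Rmin_l _ _))).
  assert (B := H2 w (Rlt_le_trans _ _ _ Hw (Rmin_r _ _))).
  replace (f w + g w - (f z + g z))%C with ((f w - f z) + (g w - g z))%C by ring.
  eapply Rle_lt_trans; [apply Cmod_triangle|]. lra.
Qed.

Lemma ccont_mult (f g : C -> C) z : ccont f z -> ccont g z -> ccont (fun w => f w * g w)%C z.
Proof.
  intros Hf Hg e He.
  assert (P := Cmod_ge_0 (f z)). assert (P' := Cmod_ge_0 (g z)).
  set (K := Cmod (f z) + Cmod (g z) + 1).
  assert (HK : 1 <= K) by (unfold K; lra).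
  set (h := Rmin 1 (e / (2 * K))).
  assert (He' : 0 < e / (2 * K)) by (apply Rdiv_lt_0_compat; lra).
  assert (Hh : 0 < h) by (apply Rmin_glb_lt; lra).
  assert (h1 : h <= 1) by apply Rmin_l.
  assert (h2 : h <= e / (2 * K)) by apply Rmin_r.
  assert (h3 : h * K <= e / 2).
  { apply Rle_trans with (e / (2 * K) * K); [apply Rmult_le_compat_r; lra|].
    right; field; lra. }
  destruct (Hf h Hh) as [d [Hd H1]].
  destruct (Hg h Hh) as [d' [Hd' H2]].
  exists (Rmin d d'); split; [apply Rmin_glb_lt; auto|]. intros w Hw.
  assert (A := H1 w (Rlt_le_trans _ _ _ Hw (Rmin_l _ _))).
  assert (B := H2 w (Rlt_le_trans _ _ _ Hw (Rmin_r _ _))).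
  replace (f w * g w - f z * g z)%C
    with ((f w - f z) * (g w - g z) + (f z * (g w - g z) + g z * (f w - f z)))%C by ring.
  eapply Rle_lt_trans; [apply Cmod_triangle|].
  eapply Rle_lt_trans; [apply Rplus_le_compat_l, Cmod_triangle|].
  rewrite !Cmod_mult.
  assert (Q2 := Cmod_ge_0 (g w - g z)).
  unfold K in *. nra.
Qed.

Lemma ccont_inv (f : C -> C) z : f z <> 0%C -> ccont f z -> ccont (fun w => / f w)%C z.
Proof.
  intros Hz Hf e He.
  assert (P : 0 < Cmod (f z)) by (apply Cmod_gt_0; auto).
  set (m := Cmod (f z)) in *.
  set (h := Rmin (m / 2) (e * m * m / 2)).
  assert (Hh : 0 < h) by (apply Rmin_glb_lt; [lra|]; apply Rdiv_lt_0_compat; [|lra]; repeat apply Rmult_lt_0_compat; lra).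
  destruct (Hf h Hh) as [d [Hd H1]].
  exists d; split; auto. intros w Hw. specialize (H1 w Hw).
  assert (h1 : h <= m / 2) by apply Rmin_l.
  assert (h2 : h <= e * m * m / 2) by apply Rmin_r.
  assert (L : m / 2 < Cmod (f w)).
  { assert (T := Cmod_rev_triangle (f z) (f w)). rewrite Cmod_sub_sym in T. fold m in T. lra. }
  assert (Hw0 : f w <> 0%C) by (apply Cmod_gt_0; lra).
  replace (/ f w - / f z)%C with ((f z - f w) / (f w * f z))%C by (field; auto).
  rewrite Cmod_div by (apply Cmult_neq_0; auto).
  rewrite Cmod_mult. fold m.
  apply Rmult_lt_reg_r with (Cmod (f w) * m); [nra|].
  unfold Rdiv. rewrite Rmult_assoc, Rinv_l by nra.
  rewrite Cmod_sub_sym. nra.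
Qed.

Lemma ccont_comp (f g : C -> C) z : ccont g z -> ccont f (g z) -> ccont (fun w => f (g w)) z.
Proof.
  intros Hg Hf e He. destruct (Hf e He) as [d [Hd H1]].
  destruct (Hg d Hd) as [d' [Hd' H2]]. exists d'; split; auto.
Qed.

Lemma Dn_ext (n : nat) (f g : C -> C) (z : C) : (forall w, f w = g w) -> Dn n f z -> Dn n g z.
Proof. intros H. replace g with f; auto. now apply functional_extensionality. Qed.

Lemma Dn_S_sub (n : nat) (f : C -> C) (z : C) : Dn (S n) f z -> Dn n f z.
Proof.
  revert f; induction n; intros f.
  - intros [q [Hq Cq]]. simpl in *.
    apply (Dn_ext 0 (fun w => f z + (w - z) * q w)%C); [intros; symmetry; apply Hq|].
    apply ccont_plus; [apply ccont_const|].
    apply ccont_mult; auto. apply (Dn_ext 0 (fun w => w + (- z))%C); [intros; ring|].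
    apply ccont_plus; [apply ccont_id|apply ccont_const].
  - intros [q [Hq Cq]]. exists q; split; auto.
Qed.

Lemma Dn_le (m n : nat) (f : C -> C) (z : C) : (m <= n)%nat -> Dn n f z -> Dn m f z.
Proof. induction 1; auto. intros H'. apply IHle. now apply Dn_S_sub. Qed.

Lemma Dn_const (n : nat) (c z : C) : Dn n (fun _ => c) z.
Proof.
  revert c; induction n; intros c; [apply ccont_const|].
  exists (fun _ => 0%C); split; [intros; ring|apply IHn].
Qed.

Lemma Dn_id n z : Dn n (fun w => w) z.
Proof.
  destruct n; [apply ccont_id|].
  exists (fun _ => 1%C); split; [intros; ring|apply Dn_const].
Qed.

Lemma Dn_plus (n : nat) (f g : C -> C) (z : C) : Dn n f z -> Dn n g z -> Dn n (fun w => f w + g w)%C z.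
Proof.
  revert f g; induction n; intros f g; [apply ccont_plus|].
  intros [p [Hp Cp]] [q [Hq Cq]].
  exists (fun w => p w + q w)%C; split; [|now apply IHn].
  intros w. rewrite (Hp w), (Hq w). ring.
Qed.

Lemma Dn_mult (n : nat) (f g : C -> C) (z : C) : Dn n f z -> Dn n g z -> Dn n (fun w => f w * g w)%C z.
Proof.
  revert f g; induction n; intros f g; [apply ccont_mult|].
  intros Hf Hg. assert (Hg' := Dn_S_sub _ _ _ Hg).
  destruct Hf as [p [Hp Cp]], Hg as [q [Hq Cq]].
  exists (fun w => p w * g w + f z * q w)%C; split.
  - intros w. rewrite (Hp w) at 1. rewrite (Hq w). ring.
  - apply Dn_plus; apply IHn; auto. apply Dn_const.
Qed.

Lemma Dn_opp (n : nat) (f : C -> C) (z : C) : Dn n f z -> Dn n (fun w => - f w)%C z.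
Proof.
  intros H. apply (Dn_ext n (fun w => (-1) * f w)%C); [intros; ring|].
  apply Dn_mult; auto. apply Dn_const.
Qed.

Lemma Dn_minus (n : nat) (f g : C -> C) (z : C) : Dn n f z -> Dn n g z -> Dn n (fun w => f w - g w)%C z.
Proof. intros. apply Dn_plus; auto. now apply Dn_opp. Qed.

(** The factorization in [Dn] is required for all [w], also far from [z]. The factor of [g] is
    therefore rebuilt as its own difference quotient, which agrees with that of [f] near [z]. *)
Lemma Dn_local (n : nat) (f g : C -> C) (z : C) (d : R) : 0 < d -> (forall w, Cmod (w - z) < d -> f w = g w) ->
  Dn n f z -> Dn n g z.
Proof.
  intros Hd H. revert f g H; induction n; intros f g H.
  - intros Hf e He. destruct (Hf e He) as [d' [Hd' H1]].
    exists (Rmin d d'); split; [apply Rmin_glb_lt; auto|]. intros w Hw.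
    rewrite <- !H; [apply H1| |].
    + eapply Rlt_le_trans; [exact Hw|apply Rmin_r].
    + rewrite Cmod_sub_self; auto.
    + eapply Rlt_le_trans; [exact Hw|apply Rmin_l].
  - intros [q [Hq Cq]].
    assert (Ez : f z = g z) by (apply H; rewrite Cmod_sub_self; auto).
    exists (fun w => if excluded_middle_informative (w = z) then q z
                     else (g w - g z) / (w - z))%C; split.
    + intros w. destruct (excluded_middle_informative _) as [->|E]; [ring|].
      field. now apply Csub_neq_0.
    + apply (IHn q); auto. intros w Hw.
      destruct (excluded_middle_informative _) as [->|E]; auto.
      rewrite <- (H w Hw), <- Ez, (Hq w). field. now apply Csub_neq_0.
Qed.

Lemma Dn_inv (n : nat) (f : C -> C) (z : C) : f z <> 0%C -> Dn n f z -> Dn n (fun w => / f w)%C z.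
Proof.
  intros Hz; revert f Hz; induction n; intros f Hz; [now apply ccont_inv|].
  intros Hf. assert (Hf' := Dn_S_sub _ _ _ Hf).
  assert (C0 : ccont f z) by (apply (Dn_le 0 (S n)); auto; lia).
  destruct Hf as [q [Hq Cq]].
  assert (P : 0 < Cmod (f z)) by (apply Cmod_gt_0; auto).
  destruct (C0 _ P) as [d [Hd H1]].
  assert (N : forall w, Cmod (w - z) < d -> f w <> 0%C).
  { intros w Hw E. specialize (H1 w Hw). rewrite E in H1.
    replace (0 - f z)%C with (- f z)%C in H1 by ring. rewrite Cmod_opp in H1. lra. }
  (* The factorization of [1 / f] holds only where [f] has no zero; [k] is its right-hand side taken
     everywhere, and coincides with [1 / f] near [z]. *)
  set (k := fun w => (/ f z + (w - z) * (- (q w * / (f z * f w))))%C).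
  apply (Dn_local (S n) k _ z d Hd).
  - intros w Hw. unfold k.
    replace (q w * / (f z * f w))%C with (q w / (f z * f w))%C by reflexivity.
    assert (E := Hq w).
    transitivity (/ f z - (f w - f z) / (f z * f w))%C; [|field; auto].
    rewrite E at 2. field. auto.
  - exists (fun w => (- (q w * / (f z * f w))))%C; split.
    + intros w. unfold k. ring.
    + apply Dn_opp, Dn_mult; auto. apply IHn; [now apply Cmult_neq_0|].
      apply Dn_mult; auto. apply Dn_const.
Qed.

Lemma Dn_div (n : nat) (f g : C -> C) (z : C) : g z <> 0%C -> Dn n f z -> Dn n g z -> Dn n (fun w => f w / g w)%C z.
Proof. intros. apply Dn_mult; auto. now apply Dn_inv. Qed.

Lemma Dn_comp (n : nat) (f g : C -> C) (z : C) : Dn n g z -> Dn n f (g z) -> Dn n (fun w => f (g w)) z.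
Proof.
  revert f g; induction n; intros f g; [apply ccont_comp|].
  intros Hg Hf. assert (Hg' := Dn_S_sub _ _ _ Hg).
  destruct Hg as [p [Hp Cp]], Hf as [q [Hq Cq]].
  exists (fun w => p w * q (g w))%C; split.
  - intros w. rewrite (Hq (g w)). rewrite (Hp w) at 1. ring.
  - apply Dn_mult; auto.
Qed.

Lemma Dn_pow (n : nat) (f : C -> C) (k : nat) (z : C) : Dn n f z -> Dn n (fun w => f w ^ k)%C z.
Proof.
  intros H; induction k; simpl; [apply Dn_const|].
  apply Dn_mult; auto.
Qed.

Lemma Dn_quot_away (n : nat) (f : C -> C) (a z : C) : z <> a -> Dn n f z -> Dn n (fun w => (f w - f a) / (w - a))%C z.
Proof.
  intros H Hf. apply Dn_div.
  - now apply Csub_neq_0.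
  - apply Dn_minus; auto. apply Dn_const.
  - apply Dn_minus; [apply Dn_id|apply Dn_const].
Qed.

Lemma cdiff_Dn1 (f : C -> C) (z : C) : cdiff f z <-> Dn 1 f z.
Proof.
  split.
  - intros [l [_ H]]. specialize (H z (fun P HP => HP)).
    exists (fun w => if excluded_middle_informative (w = z) then l else (f w - f z) / (w - z))%C.
    split.
    { intros w. destruct (excluded_middle_informative _) as [->|E]; [ring|].
      field. now apply Csub_neq_0. }
    intros e He. assert (He2 : 0 < e / 2) by lra.
    specialize (H (mkposreal _ He2)). destruct H as [d H].
    exists d; split; [apply cond_pos|]. intros w Hw.
    destruct (excluded_middle_informative (z = z)) as [_|]; [|congruence].
    destruct (excluded_middle_informative (w = z)) as [->|E].
    { rewrite Cmod_sub_self; auto. }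
    specialize (H w Hw). simpl in H.
    change (Cmod (f w - f z - (w - z) * l) <= e / 2 * Cmod (w - z)) in H.
    assert (N := Csub_neq_0 _ _ E).
    assert (P : 0 < Cmod (w - z)) by (apply Cmod_gt_0; auto).
    replace ((f w - f z) / (w - z) - l)%C with ((f w - f z - (w - z) * l) / (w - z))%C
      by (field; auto).
    rewrite Cmod_div by auto.
    apply Rle_lt_trans with (e / 2); [|lra].
    apply Rmult_le_reg_r with (Cmod (w - z)); auto.
    unfold Rdiv at 1. rewrite Rmult_assoc, Rinv_l by lra. lra.
  - intros [q [Hq Cq]]. exists (q z). split; [apply Derive.is_linear_scal_l|].
    intros x Hx. assert (E : z = x).
    { apply (is_filter_lim_locally_unique (K := C_AbsRing) (V := AbsRing_NormedModule C_AbsRing)). exact Hx. }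
    subst x. intros [e He].
    destruct (Cq e He) as [d [Hd H1]].
    exists (mkposreal d Hd). intros w Hw. specialize (H1 w Hw). simpl.
    change (Cmod (f w - f z - (w - z) * q z) <= e * Cmod (w - z)).
    rewrite (Hq w). replace (f z + (w - z) * q w - f z - (w - z) * q z)%C with ((w - z) * (q w - q z))%C by ring.
    rewrite Cmod_mult. assert (P := Cmod_ge_0 (w - z)). nra.
Qed.

(** * Integrals along segments *)

(** If [r < x], then [(r / x) ^ n] falls below the fixed ratio [a / (K + 1)]. Every argument that
    lets an exponent tend to infinity ends here. *)
Lemma pow_dominated (a K x r : R) : 0 < a -> 0 <= K -> 0 <= r ->
  (forall n, a * x ^ n <= K * r ^ n) -> x <= r.
Proof.
  intros Ha HK Hr H. apply Rnot_lt_le. intros L. set (q := r / x).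
  assert (Hq : 0 <= q < 1).
  { unfold q. split; [apply Rmult_le_pos; auto; left; apply Rinv_0_lt_compat; lra|].
    apply Rmult_lt_reg_r with x; [lra|]. unfold Rdiv. rewrite Rmult_assoc, Rinv_l; lra. }
  destruct (pow_lt_1_zero q ltac:(rewrite Rabs_right; lra) (a / (K + 1))) as [n Hn];
    [apply Rdiv_lt_0_compat; lra|].
  specialize (Hn n ltac:(lia)). specialize (H n).
  assert (Qn : 0 <= q ^ n) by (apply pow_le; lra). rewrite Rabs_right in Hn by lra.
  assert (E : r ^ n = q ^ n * x ^ n).
  { rewrite <- Rpow_mult_distr. f_equal. unfold q. field. lra. }
  rewrite E, <- Rmult_assoc in H. apply Rmult_le_reg_r in H; [|apply pow_lt; lra].
  apply (Rmult_lt_compat_r (K + 1)) in Hn; [|lra].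
  unfold Rdiv in Hn. rewrite Rmult_assoc, Rinv_l, Rmult_1_r in Hn; lra.
Qed.

Lemma C_complete (u : nat -> C) (b : nat -> R) :
  (forall eps, 0 < eps -> exists N, forall n, (N <= n)%nat -> b n < eps) ->
  (forall n m, (n <= m)%nat -> Cmod (u n - u m) <= b n) ->
  exists l, forall n, Cmod (u n - l) <= b n.
Proof.
  intros Hb Hu.
  assert (Q : forall eps, 0 < eps -> exists N, forall n m, (N <= n)%nat -> (N <= m)%nat -> Cmod (u n - u m) < eps).
  { intros e He. destruct (Hb e He) as [N HN]. exists N. intros n m Hn Hm.
    destruct (Nat.le_ge_cases n m) as [L|L].
    - eapply Rle_lt_trans; [apply Hu; auto|auto].
    - rewrite Cmod_sub_sym. eapply Rle_lt_trans; [apply Hu; auto|auto]. }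
  assert (C1 : Cauchy_crit (fun n => fst (u n))).
  { intros e He. destruct (Q e He) as [N HN]. exists N. intros n m Hn Hm.
    eapply Rle_lt_trans; [|apply (HN n m); auto].
    unfold R_dist. apply (re_le_Cmod (u n - u m)). }
  assert (C2 : Cauchy_crit (fun n => snd (u n))).
  { intros e He. destruct (Q e He) as [N HN]. exists N. intros n m Hn Hm.
    eapply Rle_lt_trans; [|apply (HN n m); auto].
    eapply Rle_trans; [|apply Rmax_Cmod]. unfold R_dist. apply Rmax_r. }
  destruct (Rcomplete.R_complete _ C1) as [x Hx]. destruct (Rcomplete.R_complete _ C2) as [y Hy].
  exists (x, y). intros n. apply le_epsilon. intros e He.
  destruct (Hx (e / 2)) as [N1 H1]; [lra|]. destruct (Hy (e / 2)) as [N2 H2]; [lra|].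
  set (m := (n + N1 + N2)%nat).
  specialize (H1 m ltac:(unfold m; lia)). specialize (H2 m ltac:(unfold m; lia)).
  eapply Rle_trans; [apply (Cmod_sub_triangle _ (u m))|].
  apply Rplus_le_compat; [apply Hu; unfold m; lia|].
  assert (E : Cmod (u m - (x, y)) <= Rabs (fst (u m) - x) + Rabs (snd (u m) - y)).
  { exact (Cmod_le_parts (u m - (x, y))). }
  unfold R_dist in *. lra.
Qed.

Lemma half_pow_small (K eps : R) : 0 < eps -> exists N, forall n, (N <= n)%nat -> K * (/ 2) ^ n < eps.
Proof.
  intros He. assert (P : 0 < Rabs K + 1) by (assert (Q := Rabs_pos K); lra).
  destruct (pow_lt_1_zero (/ 2) ltac:(rewrite Rabs_right; lra) (eps / (Rabs K + 1))) as [N HN];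
    [apply Rdiv_lt_0_compat; auto|].
  exists N. intros n Hn. specialize (HN n Hn).
  assert (Q : 0 < (/ 2) ^ n) by (apply pow_lt; lra).
  rewrite Rabs_right in HN by lra.
  apply Rle_lt_trans with ((Rabs K + 1) * (/ 2) ^ n).
  - assert (T := Rle_abs K). nra.
  - apply Rmult_lt_reg_r with (/ (Rabs K + 1)); [now apply Rinv_0_lt_compat|].
    replace ((Rabs K + 1) * (/ 2) ^ n * / (Rabs K + 1)) with ((/ 2) ^ n) by (field; lra). exact HN.
Qed.

(** Runs both bisections: of triangles for Goursat's lemma, and of squares for compactness. *)
Lemma dependent_choice (A : Type) (inv : nat -> A -> Prop) (rel : nat -> A -> A -> Prop) (a : A) :
  inv O a -> (forall n t, inv n t -> exists t', inv (S n) t' /\ rel n t t') ->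
  exists u : nat -> A, u O = a /\ forall n, inv n (u n) /\ rel n (u n) (u (S n)).
Proof.
  intros Ha H.
  assert (H' : forall n t, exists t', inv n t -> inv (S n) t' /\ rel n t t').
  { intros n t. destruct (classic (inv n t)) as [I|N]; [|exists t; tauto].
    destruct (H n t I) as [t' Ht]. now exists t'. }
  set (nx := fun n t => proj1_sig (constructive_indefinite_description _ (H' n t))).
  assert (Hnx : forall n t, inv n t -> inv (S n) (nx n t) /\ rel n t (nx n t)).
  { intros n t. unfold nx. destruct (constructive_indefinite_description _ (H' n t)); auto. }
  exists (fix u n := match n with O => a | S n => nx n (u n) end). split; auto.
  assert (I : forall n, inv n ((fix u n := match n with O => a | S n => nx n (u n) end) n)).
  { induction n; auto. now apply Hnx. }
  intros n. split; [apply I|]. now apply Hnx.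
Qed.

Lemma geometric_limit (u : nat -> C) (K : R) :
  (forall n, Cmod (u n - u (S n)) <= K * (/ 2) ^ n) ->
  exists l, forall n, Cmod (u n - l) <= 2 * K * (/ 2) ^ n.
Proof.
  intros H. assert (HK : 0 <= K).
  { specialize (H O). simpl in H. assert (Q := Cmod_ge_0 (u O - u 1%nat)). lra. }
  apply C_complete.
  - intros e He. now apply half_pow_small.
  - intros n m Hnm.
    assert (A : Cmod (u n - u m) <= 2 * K * ((/ 2) ^ n - (/ 2) ^ m)).
    { induction Hnm; [rewrite Cmod_sub_self; lra|].
      eapply Rle_trans; [apply (Cmod_sub_triangle _ (u m))|].
      specialize (H m). simpl. lra. }
    assert (0 < (/ 2) ^ m) by (apply pow_lt; lra). nra.
Qed.

Definition isCI (g : R -> C) (l : C) : Prop :=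
  is_RInt (fun t => fst (g t)) 0 1 (fst l) /\ is_RInt (fun t => snd (g t)) 0 1 (snd l).

Definition CI (g : R -> C) : C :=
  (RInt (fun t => fst (g t)) 0 1, RInt (fun t => snd (g t)) 0 1).

(** [s] is not confined to the interval, so that two-sided continuity holds at the endpoints as
    well, as the integration lemmas require. *)
Definition pcont (g : R -> C) : Prop :=
  forall t, 0 <= t <= 1 -> forall eps, 0 < eps -> exists d, 0 < d /\
    forall s, Rabs (s - t) < d -> Cmod (g s - g t) < eps.

Lemma pcont_fst g t : pcont g -> 0 <= t <= 1 -> continuous (fun t => fst (g t)) t.
Proof.
  intros H Ht. apply filterlim_locally. intros [e He].
  destruct (H t Ht e He) as [d [Hd H1]]. exists (mkposreal d Hd). intros s Hs.
  eapply Rle_lt_trans; [|apply (H1 s Hs)]. apply (re_le_Cmod (g s - g t)).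
Qed.

Lemma pcont_snd g t : pcont g -> 0 <= t <= 1 -> continuous (fun t => snd (g t)) t.
Proof.
  intros H Ht. apply filterlim_locally. intros [e He].
  destruct (H t Ht e He) as [d [Hd H1]]. exists (mkposreal d Hd). intros s Hs.
  eapply Rle_lt_trans; [|apply (H1 s Hs)].
  eapply Rle_trans; [|apply Rmax_Cmod]. apply Rmax_r.
Qed.

Lemma isCI_CI g : pcont g -> isCI g (CI g).
Proof.
  intros H. split.
  - refine (RInt_correct (V := R_CompleteNormedModule) _ 0 1 (ex_RInt_continuous _ 0 1 _)).
    intros t Ht; rewrite Rmin_left, Rmax_right in Ht by lra. now apply pcont_fst.
  - refine (RInt_correct (V := R_CompleteNormedModule) _ 0 1 (ex_RInt_continuous _ 0 1 _)).
    intros t Ht; rewrite Rmin_left, Rmax_right in Ht by lra. now apply pcont_snd.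
Qed.

Lemma CI_unique (g : R -> C) (l : C) : isCI g l -> CI g = l.
Proof.
  intros [H1 H2]. unfold CI. rewrite (is_RInt_unique _ _ _ _ H1), (is_RInt_unique _ _ _ _ H2).
  now destruct l.
Qed.

Lemma isCI_plus (g h : R -> C) (a b : C) : isCI g a -> isCI h b -> isCI (fun t => g t + h t)%C (a + b)%C.
Proof. intros [A B] [A' B']. split; [apply (is_RInt_plus _ _ _ _ _ _ A A')|apply (is_RInt_plus _ _ _ _ _ _ B B')]. Qed.

Lemma isCI_scal (c : C) (g : R -> C) (a : C) : isCI g a -> isCI (fun t => c * g t)%C (c * a)%C.
Proof.
  intros [A B]. split.
  - apply (is_RInt_minus _ _ _ _ _ _ (is_RInt_scal _ _ _ (fst c) _ A) (is_RInt_scal _ _ _ (snd c) _ B)).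
  - apply (is_RInt_plus _ _ _ _ _ _ (is_RInt_scal _ _ _ (fst c) _ B) (is_RInt_scal _ _ _ (snd c) _ A)).
Qed.

Lemma is_RInt_const01 (x : R) : is_RInt (fun _ => x) 0 1 x.
Proof.
  refine (eq_ind _ (is_RInt (V := R_NormedModule) (fun _ => x) 0 1) (is_RInt_const 0 1 x) _ _).
  unfold scal; simpl; unfold mult; simpl; ring.
Qed.

Lemma isCI_const (c : C) : isCI (fun _ => c) c.
Proof. split; apply is_RInt_const01. Qed.

Lemma isCI_id : isCI (fun t => RtoC t) (/ 2)%C.
Proof.
  rewrite <- RtoC_inv by lra. split; [|apply is_RInt_const01].
  refine (eq_ind _ (is_RInt (V := R_NormedModule) (fun t => t) 0 1)
    (is_RInt_derive (fun t : R => t * t / 2) (fun t : R => t) 0 1 _ _) _ _).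
  - intros x _. auto_derive; auto. field.
  - intros x _. apply continuous_id.
  - unfold minus, plus, opp; simpl; field.
Qed.

(** The factor 2 comes from estimating the real and imaginary parts separately; no application needs
    the sharp constant. *)
Lemma isCI_bound (g : R -> C) (l : C) (M : R) : isCI g l -> (forall t, 0 <= t <= 1 -> Cmod (g t) <= M) -> Cmod l <= 2 * M.
Proof.
  intros [A B] H.
  assert (A1 : Rabs (fst l) <= (1 - 0) * M).
  { apply (norm_RInt_le_const (V := R_NormedModule) _ 0 1 _ M ltac:(lra)) with (2 := A).
    intros t Ht. eapply Rle_trans; [|apply (H t Ht)]. apply (re_le_Cmod (g t)). }
  assert (B1 : Rabs (snd l) <= (1 - 0) * M).
  { apply (norm_RInt_le_const (V := R_NormedModule) _ 0 1 _ M ltac:(lra)) with (2 := B).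
    intros t Ht. eapply Rle_trans; [|apply (H t Ht)]. eapply Rle_trans; [|apply Rmax_Cmod]. apply Rmax_r. }
  eapply Rle_trans; [apply Cmod_le_parts|]. lra.
Qed.

Lemma RInt_affine01 (h : R -> R) (u v : R) : (forall t, 0 <= t <= 1 -> continuous h t) ->
  0 <= v <= 1 -> 0 <= u + v <= 1 ->
  u * RInt (fun t => h (u * t + v)) 0 1 = RInt h v (u + v).
Proof.
  intros H Hv Huv.
  assert (S : RInt (fun t => scal u (h (u * t + v))) 0 1 = u * RInt (fun t => h (u * t + v)) 0 1).
  { apply (RInt_scal (V := R_CompleteNormedModule)).
    apply (ex_RInt_continuous (V := R_CompleteNormedModule)).
    intros t Ht. rewrite Rmin_left, Rmax_right in Ht by lra.
    apply (continuous_comp (fun t => u * t + v) h); [|apply H; nra].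
    apply (continuous_plus (fun t => u * t) (fun _ => v)); [|apply continuous_const].
    apply (continuous_mult (fun _ => u) (fun t => t)); [apply continuous_const|apply continuous_id]. }
  rewrite <- S. transitivity (RInt h (u * 0 + v) (u * 1 + v)); [|f_equal; ring].
  apply (RInt_comp_lin (V := R_CompleteNormedModule)).
  apply (ex_RInt_continuous (V := R_CompleteNormedModule)). intros t Ht. apply H.
  assert (A := Rmin_glb (u * 0 + v) (u * 1 + v) 0). assert (B := Rmax_lub (u * 0 + v) (u * 1 + v) 1). lra.
Qed.

Lemma RInt_half (h : R -> R) : (forall t, 0 <= t <= 1 -> continuous h t) ->
  RInt h 0 1 = / 2 * RInt (fun t => h (/ 2 * t + 0)) 0 1 + / 2 * RInt (fun t => h (/ 2 * t + / 2)) 0 1.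
Proof.
  intros H. rewrite !RInt_affine01 by (auto; lra).
  replace (/ 2 + / 2) with 1 by field. rewrite Rplus_0_r. symmetry.
  apply (RInt_Chasles (V := R_CompleteNormedModule));
    apply (ex_RInt_continuous (V := R_CompleteNormedModule)); intros t Ht; apply H;
    rewrite Rmin_left, Rmax_right in Ht; lra.
Qed.

Lemma CI_half g : pcont g ->
  CI g = (/ 2 * CI (fun t => g (/ 2 * t + 0)%R) + / 2 * CI (fun t => g (/ 2 * t + / 2)%R))%C.
Proof.
  intros H. rewrite <- RtoC_inv by lra. unfold CI.
  rewrite (RInt_half (fun t => fst (g t))), (RInt_half (fun t => snd (g t))).
  - apply injective_projections; simpl; ring.
  - intros; now apply pcont_snd.
  - intros; now apply pcont_fst.
Qed.

Lemma RInt_rev01 (h : R -> R) : (forall t, 0 <= t <= 1 -> continuous h t) ->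
  RInt (fun t => h (-1 * t + 1)) 0 1 = RInt h 0 1.
Proof.
  intros H. assert (E := RInt_affine01 h (-1) 1 H ltac:(lra) ltac:(lra)).
  replace (-1 + 1) with 0 in E by ring.
  assert (F : - RInt h 1 0 = RInt h 0 1).
  { apply (opp_RInt_swap (V := R_CompleteNormedModule)), (ex_RInt_continuous (V := R_CompleteNormedModule)).
    intros t Ht. apply H. rewrite Rmin_right, Rmax_left in Ht; lra. }
  lra.
Qed.

Lemma CI_rev g : pcont g -> CI (fun t => g (-1 * t + 1)) = CI g.
Proof.
  intros H. unfold CI.
  rewrite (RInt_rev01 (fun t => fst (g t))), (RInt_rev01 (fun t => snd (g t))); auto.
  - intros; now apply pcont_snd.
  - intros; now apply pcont_fst.
Qed.

Definition seg (p q : C) (t : R) : C := (p + t * (q - p))%C.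

Definition segint (f : C -> C) (p q : C) : C := ((q - p) * CI (fun t => f (seg p q t)))%C.

Lemma Cmod_seg (p q : C) (t M : R) : Cmod p <= M -> Cmod q <= M -> 0 <= t <= 1 -> Cmod (seg p q t) <= M.
Proof.
  intros Hp Hq Ht. unfold seg.
  replace (p + t * (q - p))%C with ((1 - t)%R * p + t * q)%C by (rewrite RtoC_minus; ring).
  eapply Rle_trans; [apply Cmod_triangle|]. rewrite !Cmod_mult, !Cmod_R, !Rabs_right by lra. nra.
Qed.

Lemma disc_seg (p q : C) (t : R) : disc p -> disc q -> 0 <= t <= 1 -> disc (seg p q t).
Proof.
  unfold disc. intros Hp Hq Ht.
  eapply Rle_lt_trans; [apply (Cmod_seg p q t (Rmax (Cmod p) (Cmod q)))|]; auto using Rmax_l, Rmax_r.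
  now apply Rmax_lub_lt.
Qed.

Lemma seg_dist (p q : C) (t : R) (a : C) (M : R) : Cmod (p - a) <= M -> Cmod (q - a) <= M -> 0 <= t <= 1 -> Cmod (seg p q t - a) <= M.
Proof.
  intros Hp Hq Ht. replace (seg p q t - a)%C with (seg (p - a) (q - a) t) by (unfold seg; ring).
  now apply Cmod_seg.
Qed.

Lemma seg_pcont (f : C -> C) (p q : C) : (forall t, 0 <= t <= 1 -> ccont f (seg p q t)) ->
  pcont (fun t => f (seg p q t)).
Proof.
  intros H t Ht e He. destruct (H t Ht e He) as [d [Hd H1]].
  assert (P : 0 < Cmod (q - p) + 1) by (assert (Q := Cmod_ge_0 (q - p)); lra).
  exists (d / (Cmod (q - p) + 1)); split; [apply Rdiv_lt_0_compat; auto|].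
  intros s Hs. apply H1. unfold seg.
  replace (p + s * (q - p) - (p + t * (q - p)))%C with ((s - t)%R * (q - p))%C by (rewrite RtoC_minus; ring).
  rewrite Cmod_mult, Cmod_R. assert (Q' := Rabs_pos (s - t)).
  apply Rle_lt_trans with (Rabs (s - t) * (Cmod (q - p) + 1)); [nra|].
  apply Rmult_lt_reg_r with (/ (Cmod (q - p) + 1)); [now apply Rinv_0_lt_compat|].
  rewrite Rmult_assoc, Rinv_r, Rmult_1_r by lra. exact Hs.
Qed.

Lemma segint_half (f : C -> C) (p q : C) : (forall t, 0 <= t <= 1 -> ccont f (seg p q t)) ->
  segint f p q = (segint f p ((p + q) / 2) + segint f ((p + q) / 2) q)%C.
Proof.
  intros H. unfold segint. rewrite (CI_half _ (seg_pcont f p q H)).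
  replace (fun t => f (seg p ((p + q) / 2) t)) with (fun t : R => f (seg p q (/ 2 * t + 0))).
  replace (fun t => f (seg ((p + q) / 2) q t)) with (fun t : R => f (seg p q (/ 2 * t + / 2))).
  - field.
  - apply functional_extensionality. intros t. f_equal. unfold seg.
    rewrite RtoC_plus, RtoC_mult, RtoC_inv by lra. field.
  - apply functional_extensionality. intros t. f_equal. unfold seg.
    rewrite RtoC_plus, RtoC_mult, RtoC_inv by lra. field.
Qed.

Lemma segint_rev (f : C -> C) (p q : C) : (forall t, 0 <= t <= 1 -> ccont f (seg p q t)) ->
  segint f q p = (- segint f p q)%C.
Proof.
  intros H. unfold segint. rewrite <- (CI_rev _ (seg_pcont f p q H)).
  replace (fun t => f (seg q p t)) with (fun t : R => f (seg p q (-1 * t + 1))).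
  - ring.
  - apply functional_extensionality. intros t. f_equal. unfold seg.
    rewrite RtoC_plus, RtoC_mult. replace (RtoC (-1)) with (- (1))%C by (rewrite <- RtoC_opp; f_equal; ring). ring.
Qed.

Lemma segint_plus_scal (f g : C -> C) (c p q : C) : pcont (fun t => f (seg p q t)) -> pcont (fun t => g (seg p q t)) ->
  segint (fun w => f w + c * g w)%C p q = (segint f p q + c * segint g p q)%C.
Proof.
  intros Hf Hg. unfold segint.
  rewrite (CI_unique (fun t => f (seg p q t) + c * g (seg p q t))%C
    (CI (fun t => f (seg p q t)) + c * CI (fun t => g (seg p q t)))%C).
  - ring.
  - apply isCI_plus; [now apply isCI_CI|]. apply isCI_scal. now apply isCI_CI.
Qed.

Lemma segint_affine (a b p q : C) : segint (fun w => a + b * w)%C p q = ((q - p) * (a + b * ((p + q) / 2)))%C.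
Proof.
  unfold segint. f_equal. apply CI_unique.
  replace (a + b * ((p + q) / 2))%C with ((a + b * p) + b * (q - p) * / 2)%C by field.
  replace (fun t => a + b * seg p q t)%C with (fun t : R => (a + b * p) + b * (q - p) * t)%C
    by (apply functional_extensionality; intros; unfold seg; ring).
  apply isCI_plus; [apply isCI_const|]. apply isCI_scal, isCI_id.
Qed.

Lemma segint_bound (f : C -> C) (p q : C) (M : R) : pcont (fun t => f (seg p q t)) ->
  (forall t, 0 <= t <= 1 -> Cmod (f (seg p q t)) <= M) -> Cmod (segint f p q) <= Cmod (q - p) * (2 * M).
Proof.
  intros Hf H. unfold segint. rewrite Cmod_mult. apply Rmult_le_compat_l; [apply Cmod_ge_0|].
  apply (isCI_bound _ _ _ (isCI_CI _ Hf) H).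
Qed.

(** * Goursat's lemma and primitives *)

Definition tri (f : C -> C) (p q r : C) : C := (segint f p q + segint f q r + segint f r p)%C.

Definition perim (p q r : C) : R := Cmod (p - q) + Cmod (q - r) + Cmod (r - p).

Lemma Cmod_half (z : C) : Cmod (z / 2) = Cmod z / 2.
Proof. rewrite Cmod_div, Cmod_R, Rabs_right; lra || (intros H; apply RtoC_inj in H; lra). Qed.

Section Goursat.
Variable f : C -> C.
Hypothesis Hf : forall z, disc z -> Dn 1 f z.

Lemma hol_ccont z : disc z -> ccont f z.
Proof. intros Hz. apply (Dn_le 0 1); auto. Qed.

Lemma hol_seg p q : disc p -> disc q -> forall t, 0 <= t <= 1 -> ccont f (seg p q t).
Proof. intros. apply hol_ccont. now apply disc_seg. Qed.

Lemma disc_mid p q : disc p -> disc q -> disc ((p + q) / 2).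
Proof.
  intros Hp Hq. replace ((p + q) / 2)%C with (seg p q (/ 2)).
  - apply disc_seg; auto; lra.
  - unfold seg. rewrite RtoC_inv by lra. field.
Qed.

(** Cutting at the midpoints: each side of the inner triangle is traversed twice in opposite
    directions. *)
Lemma tri_split p q r : disc p -> disc q -> disc r ->
  tri f p q r = (tri f p ((p + q) / 2) ((r + p) / 2) + tri f ((p + q) / 2) q ((q + r) / 2)
    + tri f ((r + p) / 2) ((q + r) / 2) r + tri f ((p + q) / 2) ((q + r) / 2) ((r + p) / 2))%C.
Proof.
  intros Hp Hq Hr.
  assert (A := disc_mid p q Hp Hq). assert (B := disc_mid q r Hq Hr). assert (D := disc_mid r p Hr Hp).
  unfold tri.
  rewrite (segint_half f p q), (segint_half f q r), (segint_half f r p) by (apply hol_seg; auto).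
  rewrite (segint_rev f ((p + q) / 2) ((q + r) / 2)), (segint_rev f ((q + r) / 2) ((r + p) / 2)),
    (segint_rev f ((r + p) / 2) ((p + q) / 2)) by (apply hol_seg; auto).
  ring.
Qed.

Definition T3 : Type := (C * C * C)%type.
(** The square of the perimeter makes badness hereditary: the four allowances of the half-size
    triangles add up to that of the whole, so one of the four must be bad. *)
Definition bad (eps : R) (t : T3) : Prop :=
  let '(p, q, r) := t in eps * perim p q r ^ 2 < Cmod (tri f p q r).
(** What a bisection step must preserve: staying in any centred disc that contained the vertices,
    halving the perimeter, and moving the first vertex little enough for it to converge. *)
Definition subtri (t t' : T3) : Prop :=
  let '(p, q, r) := t in let '(p', q', r') := t' in
  (forall M, Cmod p <= M -> Cmod q <= M -> Cmod r <= M -> Cmod p' <= M /\ Cmod q' <= M /\ Cmod r' <= M) /\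
  perim p' q' r' = perim p q r / 2 /\ Cmod (p' - p) <= perim p q r.

Lemma Cmod_mid (p q : C) M : Cmod p <= M -> Cmod q <= M -> Cmod ((p + q) / 2) <= M.
Proof.
  intros. rewrite Cmod_half. assert (T := Cmod_triangle p q). lra.
Qed.

Lemma bad_step eps t : (let '(p, q, r) := t in disc p /\ disc q /\ disc r) -> bad eps t ->
  exists t', subtri t t' /\ bad eps t'.
Proof.
  destruct t as [[p q] r]. intros [Hp [Hq Hr]] B. unfold bad in B.
  rewrite tri_split in B by auto.
  set (a := ((p + q) / 2)%C) in *. set (b := ((q + r) / 2)%C) in *. set (c := ((r + p) / 2)%C) in *.
  assert (S : forall M, Cmod p <= M -> Cmod q <= M -> Cmod r <= M -> Cmod a <= M /\ Cmod b <= M /\ Cmod c <= M).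
  { intros M; unfold a, b, c; auto using Cmod_mid. }
  assert (H1 : Cmod (p - a) = Cmod (p - q) / 2) by (rewrite <- Cmod_half; f_equal; unfold a; field).
  assert (H2 : Cmod (a - q) = Cmod (p - q) / 2) by (rewrite <- Cmod_half; f_equal; unfold a; field).
  assert (H3 : Cmod (q - b) = Cmod (q - r) / 2) by (rewrite <- Cmod_half; f_equal; unfold b; field).
  assert (H4 : Cmod (b - r) = Cmod (q - r) / 2) by (rewrite <- Cmod_half; f_equal; unfold b; field).
  assert (H5 : Cmod (r - c) = Cmod (r - p) / 2) by (rewrite <- Cmod_half; f_equal; unfold c; field).
  assert (H6 : Cmod (c - p) = Cmod (r - p) / 2) by (rewrite <- Cmod_half; f_equal; unfold c; field).
  assert (H7 : Cmod (a - c) = Cmod (q - r) / 2) by (rewrite <- Cmod_half; f_equal; unfold a, c; field).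
  assert (H8 : Cmod (b - a) = Cmod (r - p) / 2) by (rewrite <- Cmod_half; f_equal; unfold a, b; field).
  assert (H9 : Cmod (c - b) = Cmod (p - q) / 2) by (rewrite <- Cmod_half; f_equal; unfold b, c; field).
  assert (G1 := Cmod_ge_0 (p - q)). assert (G2 := Cmod_ge_0 (q - r)). assert (G3 := Cmod_ge_0 (r - p)).
  set (P := perim p q r) in *.
  assert (P1 : perim p a c = P / 2) by (unfold P, perim; lra).
  assert (P2 : perim a q b = P / 2) by (unfold P, perim; rewrite (Cmod_sub_sym b a) in H8; rewrite (Cmod_sub_sym b a); lra).
  assert (P3 : perim c b r = P / 2) by (unfold P, perim; lra).
  assert (P4 : perim a b c = P / 2).
  { unfold P, perim. rewrite (Cmod_sub_sym a b), (Cmod_sub_sym b c), (Cmod_sub_sym c a). lra. }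
  assert (N1 : Cmod (a - p) <= P) by (rewrite Cmod_sub_sym; unfold P, perim; lra).
  assert (N3 : Cmod (c - p) <= P) by (unfold P, perim; lra).
  assert (N0 : Cmod (p - p) <= P) by (rewrite Cmod_sub_self; unfold P, perim; lra).
  destruct (classic (bad eps (p, a, c))) as [?|B1].
  { exists (p, a, c). split; auto. split; [|split; auto]. intros; destruct (S M); tauto. }
  destruct (classic (bad eps (a, q, b))) as [?|B2].
  { exists (a, q, b). split; auto. split; [|split; auto]. intros; destruct (S M); tauto. }
  destruct (classic (bad eps (c, b, r))) as [?|B3].
  { exists (c, b, r). split; auto. split; [|split; auto]. intros; destruct (S M); tauto. }
  destruct (classic (bad eps (a, b, c))) as [?|B4].
  { exists (a, b, c). split; auto. split; [|split; auto]. intros; destruct (S M); tauto. }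
  exfalso. unfold bad in *. apply Rnot_lt_le in B1, B2, B3, B4.
  rewrite P1 in B1. rewrite P2 in B2. rewrite P3 in B3. rewrite P4 in B4.
  assert (T1 := Cmod_triangle (tri f p a c + tri f a q b + tri f c b r) (tri f a b c)).
  assert (T2 := Cmod_triangle (tri f p a c + tri f a q b) (tri f c b r)).
  assert (T3 := Cmod_triangle (tri f p a c) (tri f a q b)).
  assert (E : eps * (P / 2) ^ 2 = eps * P ^ 2 / 4) by field. lra.
Qed.

Lemma tri_small eps p q r : 0 < eps -> disc p -> disc q -> disc r ->
  Cmod (tri f p q r) <= eps * perim p q r ^ 2.
Proof.
  intros He Hp Hq Hr. apply Rnot_lt_le. intros B0.
  (* All nested triangles stay in [|z| <= M] with [M < 1], so their limit point is in the open disc,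
     where [f] is differentiable. *)
  set (M := Rmax (Cmod p) (Rmax (Cmod q) (Cmod r))).
  assert (HM : M < 1) by (repeat apply Rmax_lub_lt; auto).
  destruct (dependent_choice T3
    (fun _ t => (let '(p, q, r) := t in Cmod p <= M /\ Cmod q <= M /\ Cmod r <= M) /\ bad eps t)
    (fun _ => subtri) (p, q, r)) as [u [U0 Hu]].
  { split; [|exact B0]. unfold M. repeat split.
    - apply Rmax_l.
    - eapply Rle_trans; [|apply Rmax_r]. apply Rmax_l.
    - eapply Rle_trans; [|apply Rmax_r]. apply Rmax_r. }
  { intros _ t [I B]. destruct (bad_step eps t) as [t' [S B']]; auto.
    - destruct t as [[a b] c]. unfold disc. lra.
    - exists t'. split; auto. split; auto.
      destruct t as [[a b] c], t' as [[a' b'] c']. destruct S as [S _]. apply S; tauto. }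
  assert (St : forall n, subtri (u n) (u (S n))) by (intros n; apply Hu).
  set (P0 := perim p q r).
  set (pt := fun n => fst (fst (u n))).
  set (per := fun n => let '(a, b, c) := u n in perim a b c).
  assert (Hper : forall n, per n = P0 * (/ 2) ^ n).
  { induction n; [unfold per; rewrite U0; simpl; fold P0; ring|].
    specialize (St n). unfold per in *. unfold subtri in St.
    destruct (u n) as [[a b] c], (u (S n)) as [[a' b'] c'].
    destruct St as [_ [-> _]]. rewrite IHn. simpl. field. }
  assert (Hpt : forall n, Cmod (pt n - pt (S n)) <= P0 * (/ 2) ^ n).
  { intros n. rewrite <- Hper. specialize (St n). unfold per, pt, subtri in *.
    destruct (u n) as [[a b] c], (u (S n)) as [[a' b'] c']. simpl.
    rewrite Cmod_sub_sym. tauto. }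
  assert (HP0 : 0 <= P0).
  { unfold P0, perim. assert (G1 := Cmod_ge_0 (p - q)). assert (G2 := Cmod_ge_0 (q - r)). assert (G3 := Cmod_ge_0 (r - p)). lra. }
  destruct (geometric_limit pt P0 Hpt) as [z Hz].
  assert (Dz : disc z).
  { unfold disc. apply Rle_lt_trans with M; auto. apply le_epsilon. intros e He'.
    destruct (half_pow_small (2 * P0) e He') as [N HN]. specialize (HN N ltac:(lia)). specialize (Hz N).
    assert (Cmod (pt N) <= M).
    { destruct (Hu N) as [[I _] _]. unfold pt. destruct (u N) as [[a b] c]. simpl. tauto. }
    assert (T := Cmod_rev_triangle z (pt N)). rewrite Cmod_sub_sym in T. lra. }
  destruct (Hf z Dz) as [k [Hk Ck]].
  (* 6 is the factor 2 of [segint_bound] times 3, since the vertices of the triangle of perimeter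
     [D] lie within [3 * D] of [z]. *)
  destruct (Ck (eps / 6) ltac:(lra)) as [d [Hd Hd1]].
  destruct (half_pow_small (3 * P0) d Hd) as [N HN]. specialize (HN N ltac:(lia)).
  destruct (Hu N) as [[IN BN] _]. assert (PN := Hper N). specialize (Hz N). unfold pt, per in *.
  destruct (u N) as [[a b] c]. unfold bad in BN. simpl in *.
  set (D := P0 * (/ 2) ^ N) in *.
  assert (G1 := Cmod_ge_0 (a - b)). assert (G2 := Cmod_ge_0 (b - c)). assert (G3 := Cmod_ge_0 (c - a)).
  replace (2 * P0 * (/ 2) ^ N) with (2 * D) in Hz by (unfold D; ring).
  replace (3 * P0 * (/ 2) ^ N) with (3 * D) in HN by (unfold D; ring).
  assert (Za : Cmod (a - z) <= 3 * D) by (unfold perim in PN; lra).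
  assert (Zb : Cmod (b - z) <= 3 * D).
  { eapply Rle_trans; [apply (Cmod_sub_triangle _ a)|]. rewrite (Cmod_sub_sym b a). unfold perim in PN. lra. }
  assert (Zc : Cmod (c - z) <= 3 * D).
  { eapply Rle_trans; [apply (Cmod_sub_triangle _ a)|]. unfold perim in PN. lra. }
  assert (Ha : disc a) by (unfold disc; lra). assert (Hb : disc b) by (unfold disc; lra).
  assert (Hc : disc c) by (unfold disc; lra).
  (* The affine part of [f] at [z] integrates to 0 around the triangle; what remains is
     [(w - z) * (k w - k z)]. *)
  set (aff := fun w => ((f z - z * k z) + k z * w)%C).
  set (g := fun w => (f w + (-1) * aff w)%C).
  assert (Gc : forall w, disc w -> ccont g w).
  { intros w Hw. apply (Dn_plus 0); [now apply hol_ccont|].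
    apply (Dn_mult 0); [apply Dn_const|]. apply (Dn_plus 0); [apply Dn_const|].
    apply (Dn_mult 0); [apply Dn_const|apply Dn_id]. }
  assert (Ac : forall w, ccont aff w).
  { intros w. apply (Dn_plus 0); [apply Dn_const|].
    apply (Dn_mult 0); [apply Dn_const|apply Dn_id]. }
  assert (Et : tri f a b c = tri g a b c).
  { unfold tri, g. rewrite !(segint_plus_scal f aff) by (apply seg_pcont; auto; intros; apply hol_ccont; now apply disc_seg).
    unfold aff. rewrite !segint_affine. field. }
  assert (Bg : forall x y, disc x -> disc y -> Cmod (x - z) <= 3 * D -> Cmod (y - z) <= 3 * D ->
     Cmod (segint g x y) <= Cmod (x - y) * (2 * (3 * D * (eps / 6)))).
  { intros x y Dx Dy Hx Hy. rewrite (Cmod_sub_sym x y). apply segint_bound.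
    - apply seg_pcont. intros. apply Gc. now apply disc_seg.
    - intros t Ht. assert (Q := seg_dist x y t z _ Hx Hy Ht).
      set (w := seg x y t) in *.
      replace (g w) with ((w - z) * (k w - k z))%C by (unfold g, aff; rewrite (Hk w); ring).
      rewrite Cmod_mult. apply Rmult_le_compat; auto using Cmod_ge_0.
      left. apply Hd1. lra. }
  assert (B1 := Bg a b Ha Hb Za Zb). assert (B2 := Bg b c Hb Hc Zb Zc). assert (B3 := Bg c a Hc Ha Zc Za).
  rewrite Et, PN in BN. unfold tri in BN.
  assert (T1 := Cmod_triangle (segint g a b + segint g b c) (segint g c a)).
  assert (T2 := Cmod_triangle (segint g a b) (segint g b c)).
  assert (E : (Cmod (a - b) + Cmod (b - c) + Cmod (c - a)) * (2 * (3 * D * (eps / 6))) = eps * D ^ 2).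
  { change (perim a b c * (2 * (3 * D * (eps / 6))) = eps * D ^ 2). rewrite PN. field. }
  rewrite !Rmult_plus_distr_r in E. lra.
Qed.

Lemma goursat p q r : disc p -> disc q -> disc r -> tri f p q r = 0%C.
Proof.
  intros Hp Hq Hr. apply Cmod_eq_0. apply Rle_antisym; [|apply Cmod_ge_0].
  apply le_epsilon. intros e He. rewrite Rplus_0_l.
  assert (Q : 0 < perim p q r ^ 2 + 1) by (assert (T := pow2_ge_0 (perim p q r)); lra).
  eapply Rle_trans; [apply (tri_small (e / (perim p q r ^ 2 + 1))); auto; now apply Rdiv_lt_0_compat|].
  apply Rle_trans with (e / (perim p q r ^ 2 + 1) * (perim p q r ^ 2 + 1)).
  - apply Rmult_le_compat_l; [|lra]. left. now apply Rdiv_lt_0_compat.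
  - right. field. lra.
Qed.

Lemma disc_open (z : C) : disc z -> exists d, 0 < d /\ forall w, Cmod (w - z) < d -> disc w.
Proof.
  unfold disc. intros Hz. exists (1 - Cmod z); split; [lra|]. intros w Hw.
  assert (T := Cmod_rev_triangle w z). lra.
Qed.

Lemma disc_0 : disc 0.
Proof. unfold disc. rewrite Cmod_0. lra. Qed.

Lemma seg_self_0 z t : seg z z t = z.
Proof. unfold seg. ring. Qed.

(* The factor [q] of the primitive is the mean of [f] over the segment [[z, w]],
   which inherits one degree of differentiability from [f]. *)
Lemma hol_primitive : exists F : C -> C, forall z, disc z ->
  exists q, (forall w, disc w -> F w = F z + (w - z) * q w)%C /\ Dn 1 q z /\ q z = f z.
Proof.
  exists (fun z => segint f 0 z). intros z Hz.
  exists (fun w => CI (fun t => f (seg z w t))).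
  assert (Hz0 : CI (fun t => f (seg z z t)) = f z).
  { replace (fun t => f (seg z z t)) with (fun t : R => f z)
      by (apply functional_extensionality; intros; now rewrite seg_self_0).
    apply CI_unique, isCI_const. }
  split; [|split; auto].
  { intros w Hw. assert (G := goursat 0 z w disc_0 Hz Hw). unfold tri in G.
    rewrite (segint_rev f 0 w) in G by (apply hol_seg; auto using disc_0).
    change ((w - z) * CI (fun t => f (seg z w t)))%C with (segint f z w).
    transitivity (segint f 0 z + segint f z w - (segint f 0 z + segint f z w + - segint f 0 w))%C; [ring|].
    rewrite G. ring. }
  destruct (Hf z Hz) as [p [Hp Cp]].
  destruct (disc_open z Hz) as [d [Hd Hd1]].
  (* Away from [z], [p] is an ordinary difference quotient. *)
  assert (Pc : forall w, disc w -> ccont p w).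
  { intros w Hw. destruct (classic (w = z)) as [->|N]; auto.
    assert (P : 0 < Cmod (w - z)) by (apply Cmod_gt_0; now apply Csub_neq_0).
    apply (Dn_local 0 (fun v => (f v - f z) / (v - z))%C _ _ (Cmod (w - z)) P).
    - intros v Hv. rewrite (Hp v). field. apply Csub_neq_0. intros ->.
      rewrite Cmod_sub_sym in Hv. lra.
    - apply (Dn_quot_away 0); auto. now apply hol_ccont. }
  (* Averaging [f v = f z + (v - z) * p v] at [v = z + t (w - z)] gives [f z + (w - z) * r w]: so
     [r] is the factor of the mean, and its continuity at [z] is all that is left to prove. *)
  set (r := fun w => CI (fun t => t * p (seg z w t))%C).
  assert (Pp : forall w, disc w -> pcont (fun t => t * p (seg z w t))%C).
  { intros w Hw t Ht e He.
    assert (X : ccont (fun u => u * p (z + u * (w - z)))%C (RtoC t)).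
    { apply (Dn_mult 0); [apply Dn_id|]. apply (Dn_comp 0 p).
      - apply (Dn_plus 0); [apply Dn_const|]. apply (Dn_mult 0); [apply Dn_id|apply Dn_const].
      - apply Pc. now apply (disc_seg z w t). }
    destruct (X e He) as [d' [Hd' H1]]. exists d'; split; auto.
    intros s Hs. apply H1. rewrite <- RtoC_minus, Cmod_R. exact Hs. }
  apply (Dn_local 1 (fun w => f z + (w - z) * r w)%C _ _ d Hd).
  - intros w Hw. specialize (Hd1 w Hw). symmetry. apply CI_unique.
    replace (fun t => f (seg z w t)) with (fun t : R => (f z + (w - z) * (t * p (seg z w t)))%C).
    + apply isCI_plus; [apply isCI_const|]. apply isCI_scal, isCI_CI, Pp, Hd1.
    + apply functional_extensionality. intros t. rewrite (Hp (seg z w t)). unfold seg. ring.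
  - exists r. split; [intros; ring|]. intros e He.
    destruct (Cp (e / 3)) as [d' [Hd' H1]]; [lra|].
    exists (Rmin d d'); split; [apply Rmin_glb_lt; auto|]. intros w Hw.
    assert (W1 := Rlt_le_trans _ _ _ Hw (Rmin_l _ _)).
    assert (W2 := Rlt_le_trans _ _ _ Hw (Rmin_r _ _)).
    assert (Q : isCI (fun t => t * p (seg z w t) + (-1) * (t * p (seg z z t)))%C (r w + (-1) * r z)%C).
    { apply isCI_plus; [apply isCI_CI, Pp; auto|]. apply isCI_scal, isCI_CI, Pp; auto. }
    replace (r w - r z)%C with (r w + (-1) * r z)%C by ring.
    apply Rle_lt_trans with (2 * (e / 3)); [|lra].
    apply (isCI_bound _ _ _ Q). intros t Ht. rewrite seg_self_0.
    replace (t * p (seg z w t) + -1 * (t * p z))%C with (t * (p (seg z w t) - p z))%C by ring.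
    rewrite Cmod_mult, Cmod_R, Rabs_right by lra.
    assert (B : Cmod (p (seg z w t) - p z) < e / 3).
    { apply H1. eapply Rle_lt_trans; [|exact W2]. apply (seg_dist z w t z); auto; [|lra].
      rewrite Cmod_sub_self. apply Cmod_ge_0. }
    nra.
Qed.
End Goursat.

(** * Compactness and the maximum principle *)

Definition square (x y s : R) (z : C) : Prop := x <= fst z <= x + s /\ y <= snd z <= y + s.

(* Compactness of bounded plane sets, in the form that bisection proves. *)
Lemma concentration (P : (C -> Prop) -> Prop) (K : C -> Prop) (r : R) :
  (forall A B : C -> Prop, (forall z, A z -> B z) -> P A -> P B) ->
  (forall A B : C -> Prop, P (fun z => A z \/ B z) -> P A \/ P B) ->
  0 <= r -> (forall z, K z -> Cmod z <= r) -> P K ->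
  exists z, forall eps, 0 < eps -> P (fun w => K w /\ Cmod (w - z) < eps).
Proof.
  intros Mono Split Hr0 Hr HK.
  assert (St : forall s x y, P (fun z => K z /\ square x y s z) -> exists x' y',
     P (fun z => K z /\ square x' y' (s / 2) z) /\ (x' = x \/ x' = x + s / 2) /\ (y' = y \/ y' = y + s / 2)).
  { intros s x y H.
    assert (H1 : P (fun z => ((K z /\ square x y (s / 2) z) \/ (K z /\ square x (y + s / 2) (s / 2) z)) \/
                  ((K z /\ square (x + s / 2) y (s / 2) z) \/ (K z /\ square (x + s / 2) (y + s / 2) (s / 2) z)))).
    { refine (Mono _ _ _ H). intros z [Hz [X Y]]. unfold square.
      destruct (Rle_dec (fst z) (x + s / 2)); destruct (Rle_dec (snd z) (y + s / 2)).
      - left; left; repeat split; auto; lra.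
      - left; right; repeat split; auto; lra.
      - right; left; repeat split; auto; lra.
      - right; right; repeat split; auto; lra. }
    apply Split in H1. destruct H1 as [H1|H1]; apply Split in H1; destruct H1 as [H1|H1];
      do 2 eexists; (split; [exact H1|]); auto. }
  set (s := fun n => 2 * r * (/ 2) ^ n).
  set (inv := fun n (t : R * R) => P (fun z => K z /\ square (fst t) (snd t) (s n) z)).
  assert (Hs : forall n, s (S n) = s n / 2) by (intros; unfold s; simpl; field).
  destruct (dependent_choice (R * R) inv (fun n t t' => (fst t' = fst t \/ fst t' = fst t + s n / 2) /\
    (snd t' = snd t \/ snd t' = snd t + s n / 2)) (- r, - r)) as [u [_ Hu]].
  { refine (Mono _ _ _ HK). intros z Hz. split; auto. specialize (Hr z Hz).
    assert (A := Rmax_Cmod z). assert (B := Rmax_l (Rabs (fst z)) (Rabs (snd z))).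
    assert (D := Rmax_r (Rabs (fst z)) (Rabs (snd z))).
    assert (E1 : Rabs (fst z) <= r) by lra. assert (E2 : Rabs (snd z) <= r) by lra.
    apply Rabs_le_between in E1, E2. unfold square, s; simpl. lra. }
  { intros n t I. destruct (St _ _ _ I) as [x' [y' [A B]]]. exists (x', y'). split; auto.
    unfold inv. rewrite Hs. exact A. }
  assert (Sp : forall n, 0 <= s n).
  { intros n. unfold s. assert (0 < (/ 2) ^ n) by (apply pow_lt; lra). nra. }
  destruct (geometric_limit (fun n => (u n : C)) (2 * r)) as [z Hz].
  { intros n. destruct (Hu n) as [_ [A B]]. fold (s n). specialize (Sp n).
    destruct (u (S n)) as [a' b'], (u n) as [a b].
    eapply Rle_trans; [apply Cmod_le_parts|]. simpl in *.
    assert (A1 : Rabs (a + - a') <= s n / 2).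
    { destruct A as [A|A]; rewrite A; apply Rabs_le_between; lra. }
    assert (B1 : Rabs (b + - b') <= s n / 2).
    { destruct B as [B|B]; rewrite B; apply Rabs_le_between; lra. }
    lra. }
  exists z. intros e He. destruct (half_pow_small (8 * r) e He) as [N HN].
  specialize (HN N ltac:(lia)). refine (Mono _ _ _ (proj1 (Hu N))). intros w [Hw [X Y]]. split; auto.
  eapply Rle_lt_trans; [apply (Cmod_sub_triangle _ (u N))|].
  specialize (Hz N). specialize (Sp N).
  assert (Cmod (w - u N) <= 2 * s N).
  { eapply Rle_trans; [apply Cmod_le_parts|]. simpl.
    rewrite !Rabs_right by lra. lra. }
  unfold s in *. lra.
Qed.

Lemma max_attained_on (K : C -> Prop) (S : C -> R) (r : R) : 0 <= r -> (forall z, K z -> Cmod z <= r) ->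
  (forall z, (forall eps, 0 < eps -> exists y, K y /\ Cmod (y - z) < eps) -> K z) -> (exists z, K z) ->
  (forall z, K z -> forall eps, 0 < eps -> exists d, 0 < d /\
     forall w, Cmod (w - z) < d -> Rabs (S w - S z) < eps) ->
  exists z, K z /\ forall w, K w -> S w <= S z.
Proof.
  intros Hr Kr Kc [k0 Hk0] HS.
  (* The property says that the part of [K] in [A] carries the supremum of [S]. If a union has it,
     one of the two sets has it, since witnesses against both combine into one at the larger
     value. *)
  destruct (concentration (fun A => forall x, K x -> exists y, A y /\ K y /\ S x <= S y) K r) as [z Hz]; auto.
  - intros A B AB H x Hx. destruct (H x Hx) as [y [Hy H']]. exists y; auto.
  - intros A B H. apply NNPP. intros N. apply not_or_and in N. destruct N as [NA NB].
    apply not_all_ex_not in NA, NB. destruct NA as [a NA], NB as [b NB].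
    apply imply_to_and in NA, NB. destruct NA as [Ha NA], NB as [Hb NB].
    assert (Y : exists c, K c /\ S a <= S c /\ S b <= S c).
    { destruct (Rle_dec (S a) (S b)); [exists b|exists a]; repeat split; auto; lra. }
    destruct Y as [c [Hc [Hac Hbc]]]. destruct (H c Hc) as [y [[Hy|Hy] [Hy1 Hy2]]].
    + apply NA. exists y. repeat split; auto; lra.
    + apply NB. exists y. repeat split; auto; lra.
  - intros x Hx. exists x. repeat split; auto; lra.
  - assert (Cz : K z).
    { apply Kc. intros e He. destruct (Hz e He k0 Hk0) as [y [Hy _]]. now exists y. }
    exists z. split; auto. intros w Hw. apply le_epsilon. intros e He.
    destruct (HS z Cz e He) as [d [Hd H1]].
    destruct (Hz d Hd w Hw) as [y [[Hy1 Hy2] [_ Hy3]]].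
    specialize (H1 y Hy2). apply Rabs_lt_between in H1. lra.
Qed.

Lemma Cmod_le_closed (z : C) (r : R) : (forall eps, 0 < eps -> exists y, Cmod y <= r /\ Cmod (y - z) < eps) ->
  Cmod z <= r.
Proof.
  intros H. apply le_epsilon. intros e He. destruct (H e He) as [y [Hy1 Hy2]].
  rewrite Cmod_sub_sym in Hy2. assert (T := Cmod_rev_triangle z y). lra.
Qed.

Lemma max_attained (S : C -> R) (r : R) : 0 <= r ->
  (forall z, Cmod z <= r -> forall eps, 0 < eps -> exists d, 0 < d /\
     forall w, Cmod (w - z) < d -> Rabs (S w - S z) < eps) ->
  exists z, Cmod z <= r /\ forall w, Cmod w <= r -> S w <= S z.
Proof.
  intros Hr HS. apply (max_attained_on (fun z => Cmod z <= r) S r); auto.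
  - intros z. apply Cmod_le_closed.
  - exists 0%C. now rewrite Cmod_0.
Qed.

Lemma Rabs_Cmod_sub (x y : C) : Rabs (Cmod x - Cmod y) <= Cmod (x - y).
Proof.
  apply Rabs_le_between. assert (A := Cmod_rev_triangle x y). assert (B := Cmod_rev_triangle y x).
  rewrite Cmod_sub_sym in B. lra.
Qed.

Lemma ccont_Cmod (f : C -> C) z : ccont f z -> forall eps, 0 < eps -> exists d, 0 < d /\
  forall w, Cmod (w - z) < d -> Rabs (Cmod (f w) - Cmod (f z)) < eps.
Proof.
  intros H e He. destruct (H e He) as [d [Hd H1]]. exists d; split; auto.
  intros w Hw. eapply Rle_lt_trans; [apply Rabs_Cmod_sub|auto].
Qed.

Lemma Cmod_max_attained (f : C -> C) (r : R) : 0 <= r -> (forall z, Cmod z <= r -> ccont f z) ->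
  exists z, Cmod z <= r /\ forall w, Cmod w <= r -> Cmod (f w) <= Cmod (f z).
Proof. intros Hr H. apply (max_attained (fun z => Cmod (f z))); auto. intros. now apply ccont_Cmod; auto. Qed.

Lemma Cmod_sqr_add (z k : C) : Cmod (z + k) ^ 2 = Cmod z ^ 2 + Cmod k ^ 2 + 2 * (fst z * fst k + snd z * snd k).
Proof. rewrite !Cmod2_alt. unfold Re, Im. destruct z, k; simpl. ring. Qed.

(* Averaging over the four points [z + rho i^j] kills the linear and quadratic terms of [H]
   but not that of [eps |z|^2], so [|H| + eps |z|^2] has no maximum where [H] is [Dn 2]. *)
Lemma no_interior_max (H : C -> C) (z : C) (eps d : R) : 0 < eps -> 0 < d -> Dn 2 H z ->
  exists w, Cmod (w - z) < d /\ Cmod (H z) + eps * Cmod z ^ 2 < Cmod (H w) + eps * Cmod w ^ 2.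
Proof.
  intros He Hd [q [Hq [p [Hp Cp]]]].
  (* With [eps / 2], the four errors add up to less than [2 * eps * rho ^ 2], below the gain
     [4 * eps * rho ^ 2] of the term [eps * |z| ^ 2]. *)
  destruct (Cp (eps / 2)) as [d' [Hd' H1]]; [lra|].
  set (rho := Rmin d d' / 2).
  assert (M : 0 < Rmin d d') by (apply Rmin_glb_lt; auto).
  assert (M1 := Rmin_l d d'). assert (M2 := Rmin_r d d').
  assert (R0 : 0 < rho) by (unfold rho; lra).
  apply NNPP. intros N.
  assert (N' : forall k, Cmod k = rho -> Cmod (H (z + k)%C) + eps * Cmod (z + k) ^ 2 <= Cmod (H z) + eps * Cmod z ^ 2).
  { intros k Hk. apply Rnot_lt_le. intros L. apply N. exists (z + k)%C. split; auto.
    replace (z + k - z)%C with k by ring. rewrite Hk. unfold rho. lra. }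
  assert (E : forall k, H (z + k)%C = (H z + k * q z + k * k * p (z + k))%C).
  { intros k. rewrite (Hq (z + k)%C), (Hp (z + k)%C) at 1. ring. }
  assert (B : forall k, Cmod k = rho -> Cmod (p (z + k)%C - p z) < eps / 2).
  { intros k Hk. apply H1. replace (z + k - z)%C with k by ring. rewrite Hk. unfold rho. lra. }
  set (k1 := RtoC rho). set (k2 := (Ci * rho)%C). set (k3 := (- k1)%C). set (k4 := (- k2)%C).
  assert (K1 : Cmod k1 = rho) by (unfold k1; rewrite Cmod_R; apply Rabs_right; lra).
  assert (K2 : Cmod k2 = rho) by (unfold k2; rewrite Cmod_mult, Cmod_Ci, Cmod_R, Rabs_right; lra).
  assert (K3 : Cmod k3 = rho) by (unfold k3; now rewrite Cmod_opp).
  assert (K4 : Cmod k4 = rho) by (unfold k4; now rewrite Cmod_opp).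
  assert (A1 := N' _ K1). assert (A2 := N' _ K2). assert (A3 := N' _ K3). assert (A4 := N' _ K4).
  assert (B1 := B _ K1). assert (B2 := B _ K2). assert (B3 := B _ K3). assert (B4 := B _ K4).
  rewrite Cmod_sqr_add, K1 in A1. rewrite Cmod_sqr_add, K2 in A2.
  rewrite Cmod_sqr_add, K3 in A3. rewrite Cmod_sqr_add, K4 in A4.
  set (e1 := (p (z + k1) - p z)%C) in *. set (e2 := (p (z + k2) - p z)%C) in *.
  set (e3 := (p (z + k3) - p z)%C) in *. set (e4 := (p (z + k4) - p z)%C) in *.
  (* The four increments sum to 0, and so do their squares, whose signs alternate; only the
     variation of [p] around [p z] survives. *)
  assert (Sum : (4 * H z = H (z + k1) + H (z + k2) + H (z + k3) + H (z + k4)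
      - rho * rho * (e1 - e2 + e3 - e4))%C).
  { rewrite !E. unfold e1, e2, e3, e4, k3, k4, k2, k1.
    assert (J : (Ci * Ci = - (1))%C) by (apply injective_projections; simpl; ring).
    transitivity (4 * H z + rho * rho * (1 + Ci * Ci) * (p (z + Ci * rho) + p (z + - (Ci * rho)))
      - rho * rho * (1 + 1 + - (1) + - (1)) * p z)%C; [rewrite J; ring|ring]. }
  assert (L : 4 * Cmod (H z) <= Cmod (H (z + k1)%C) + Cmod (H (z + k2)%C) + Cmod (H (z + k3)%C) + Cmod (H (z + k4)%C)
      + rho * rho * (Cmod e1 + Cmod e2 + Cmod e3 + Cmod e4)).
  { replace (4 * Cmod (H z)) with (Cmod (4 * H z)%C) by (rewrite Cmod_mult, Cmod_R, Rabs_right; lra).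
    rewrite Sum. eapply Rle_trans; [apply Cmod_minus_le|]. apply Rplus_le_compat.
    - eapply Rle_trans; [apply Cmod_triangle|]. apply Rplus_le_compat_r.
      eapply Rle_trans; [apply Cmod_triangle|]. apply Rplus_le_compat_r. apply Cmod_triangle.
    - rewrite !Cmod_mult, !Cmod_R, !Rabs_right by lra. apply Rmult_le_compat_l; [nra|].
      eapply Rle_trans; [apply Cmod_minus_le|]. apply Rplus_le_compat_r.
      eapply Rle_trans; [apply Cmod_triangle|]. apply Rplus_le_compat_r. apply Cmod_minus_le. }
  assert (C1 : fst z * fst k1 + snd z * snd k1 + (fst z * fst k3 + snd z * snd k3) = 0)
    by (unfold k3, k1; simpl; ring).
  assert (C2 : fst z * fst k2 + snd z * snd k2 + (fst z * fst k4 + snd z * snd k4) = 0)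
    by (unfold k4, k2; simpl; ring).
  assert (X : 0 < rho * rho) by nra. assert (X2 : rho ^ 2 = rho * rho) by ring. rewrite X2 in *.
  assert (Q : rho * rho * (Cmod e1 + Cmod e2 + Cmod e3 + Cmod e4) < rho * rho * (2 * eps))
    by (apply Rmult_lt_compat_l; lra).
  nra.
Qed.

(** [|H| + eps |z| ^ 2] attains its maximum on the closed disc, and by [no_interior_max] only on the
    circle or at a point of the second alternative, where [H] vanishes; then [eps] tends to 0. That
    alternative lets a factor with prescribed zeros neutralize exceptional points. *)
Lemma max_principle_weak (H : C -> C) (r M : R) : 0 <= r ->
  (forall z, Cmod z <= r -> ccont H z) ->
  (forall z, Cmod z < r -> Dn 2 H z \/ H z = 0%C) ->
  (forall z, Cmod z = r -> Cmod (H z) <= M) ->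
  forall z, Cmod z <= r -> Cmod (H z) <= M.
Proof.
  intros Hr Cc HD HM z Hz.
  assert (M0 : 0 <= M).
  { apply Rle_trans with (Cmod (H r)); [apply Cmod_ge_0|]. apply HM. rewrite Cmod_R, Rabs_right; lra. }
  apply le_epsilon. intros e He. set (eps := e / (r ^ 2 + 1)).
  assert (P : 0 < r ^ 2 + 1) by nra.
  assert (Heps : 0 < eps) by (now apply Rdiv_lt_0_compat).
  assert (Hre : eps * r ^ 2 <= e).
  { apply Rle_trans with (eps * (r ^ 2 + 1)); [nra|]. unfold eps. right. field. lra. }
  destruct (max_attained (fun z => Cmod (H z) + eps * Cmod z ^ 2) r) as [w [Hw Mw]]; auto.
  { intros x Hx e' He'. destruct (ccont_Cmod _ _ (Cc x Hx) (e' / 2)) as [d [Hd H1]]; [lra|].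
    destruct (ccont_Cmod _ _ (ccont_mult _ _ x (ccont_id x) (ccont_id x)) (e' / 2 / eps)) as [d' [Hd' H2]].
    { apply Rdiv_lt_0_compat; lra. }
    exists (Rmin d d'); split; [apply Rmin_glb_lt; auto|]. intros y Hy.
    specialize (H1 y (Rlt_le_trans _ _ _ Hy (Rmin_l _ _))).
    specialize (H2 y (Rlt_le_trans _ _ _ Hy (Rmin_r _ _))).
    rewrite !Cmod_mult in H2.
    replace (Cmod (H y) + eps * Cmod y ^ 2 - (Cmod (H x) + eps * Cmod x ^ 2)) with
      ((Cmod (H y) - Cmod (H x)) + eps * (Cmod y * Cmod y - Cmod x * Cmod x)) by ring.
    eapply Rle_lt_trans; [apply Rabs_triang|]. rewrite Rabs_mult, (Rabs_right eps) by lra.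
    assert (eps * Rabs (Cmod y * Cmod y - Cmod x * Cmod x) < e' / 2).
    { apply Rmult_lt_reg_l with (/ eps); [now apply Rinv_0_lt_compat|].
      rewrite <- Rmult_assoc, Rinv_l, Rmult_1_l by lra. unfold Rdiv in *. lra. }
    lra. }
  assert (Mz := Mw z Hz). simpl in Mz.
  assert (G : 0 <= eps * (Cmod z * (Cmod z * 1))) by (assert (Q := Cmod_ge_0 z); apply Rmult_le_pos; nra).
  assert (Gw : eps * (Cmod w * (Cmod w * 1)) <= eps * r ^ 2).
  { assert (Q := Cmod_ge_0 w). apply Rmult_le_compat_l; nra. }
  assert (W : Cmod (H w) <= M).
  { destruct (Rle_lt_or_eq_dec _ _ Hw) as [L|E]; [|now apply HM].
    destruct (HD w L) as [D|Z]; [|rewrite Z, Cmod_0; auto].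
    exfalso. destruct (no_interior_max H w eps (r - Cmod w) Heps ltac:(lra) D) as [v [Hv1 Hv2]].
    assert (Hv : Cmod v <= r) by (assert (T := Cmod_rev_triangle v w); lra).
    assert (Q : Cmod (H v) + eps * Cmod v ^ 2 <= Cmod (H w) + eps * Cmod w ^ 2).
    { exact (Mw v Hv). }
    lra. }
  lra.
Qed.

(** Ordinary points accumulate at every exceptional one, so a bound off the list extends to it by
    continuity. *)
Lemma avoid_list (E : list C) (e : C) (d : R) : 0 < d ->
  exists t, 0 < t /\ forall s, 0 < s < t -> s < d /\ ~ In (e + s)%C E.
Proof.
  intros Hd. induction E as [|x E [t [Ht IH]]].
  - exists d. split; auto. intros s Hs. split; [lra|intros []].
  - destruct (classic (x = e)) as [->|N].
    + exists t. split; auto. intros s Hs. split; [apply (IH s Hs)|]. intros [Q|Q].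
      * assert (RtoC s = 0)%C by (transitivity (e + s - e)%C; [ring|rewrite <- Q; ring]).
        apply RtoC_inj in H. lra.
      * now apply (IH s Hs).
    + assert (P : 0 < Cmod (x - e)) by (apply Cmod_gt_0; now apply Csub_neq_0).
      exists (Rmin t (Cmod (x - e))). split; [apply Rmin_glb_lt; auto|]. intros s [Hs Hs'].
      assert (A := Rmin_l t (Cmod (x - e))). assert (B := Rmin_r t (Cmod (x - e))).
      split; [apply IH; lra|]. intros [Q|Q].
      * rewrite Q in B. replace (e + s - e)%C with (RtoC s) in B by ring.
        rewrite Cmod_R, Rabs_right in B by lra. rewrite Q in Hs'.
        replace (e + s - e)%C with (RtoC s) in Hs' by ring. rewrite Cmod_R, Rabs_right in Hs' by lra. lra.
      * apply (IH s); auto. lra.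
Qed.

Definition zeros (E : list C) (z : C) : C := fold_right (fun e w => (z - e) * w)%C 1%C E.

Lemma zeros_in E z : In z E -> zeros E z = 0%C.
Proof.
  induction E as [|x E IH]; simpl; [tauto|]. intros [->|H]; [ring|]. rewrite IH; auto. ring.
Qed.

Lemma zeros_notin E z : ~ In z E -> zeros E z <> 0%C.
Proof.
  induction E as [|x E IH]; simpl; intros H; [intros Q; apply RtoC_inj in Q; lra|].
  apply Cmult_neq_0; [apply Csub_neq_0; intros ->|apply IH]; tauto.
Qed.

Lemma zeros_Dn n E z : Dn n (zeros E) z.
Proof.
  induction E as [|x E IH]; [apply (Dn_const n 1)|].
  apply (Dn_mult n (fun z => z - x)%C); auto. apply Dn_minus; [apply Dn_id|apply Dn_const].
Qed.

Lemma zeros_bound E r : 0 <= r -> exists B, 0 <= B /\ forall z, Cmod z <= r -> Cmod (zeros E z) <= B.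
Proof.
  intros Hr. induction E as [|x E [B [HB IH]]].
  - exists 1. split; [lra|]. intros z _. simpl. rewrite Cmod_1. lra.
  - assert (Q := Cmod_ge_0 x). exists ((r + Cmod x) * B). split; [nra|]. intros z Hz. simpl.
    rewrite Cmod_mult. apply Rmult_le_compat; auto using Cmod_ge_0.
    eapply Rle_trans; [apply Cmod_minus_le|]. lra.
Qed.

(* The finitely many exceptional points are handled by applying the weak form to
   [zeros E * h ^ n], which vanishes there, and letting [n] tend to infinity. *)
Lemma max_principle (E : list C) (h : C -> C) (r M : R) : 0 < r ->
  (forall z, Cmod z <= r -> ccont h z) ->
  (forall z, Cmod z < r -> ~ In z E -> Dn 2 h z) ->
  (forall z, Cmod z = r -> Cmod (h z) <= M) ->
  forall z, Cmod z < r -> Cmod (h z) <= M.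
Proof.
  intros Hr Cc HD HM.
  assert (M0 : 0 <= M).
  { apply Rle_trans with (Cmod (h r)); [apply Cmod_ge_0|]. apply HM. rewrite Cmod_R, Rabs_right; lra. }
  assert (A : forall z, Cmod z < r -> ~ In z E -> Cmod (h z) <= M).
  { intros z Hz Nz. apply Rnot_lt_le. intros L.
    destruct (zeros_bound E r ltac:(lra)) as [B [HB HB1]].
    assert (Z : 0 < Cmod (zeros E z)) by (apply Cmod_gt_0; now apply zeros_notin).
    assert (N : forall n, Cmod (zeros E z * h z ^ n) <= B * M ^ n).
    { intros n. apply (max_principle_weak (fun z => zeros E z * h z ^ n)%C r); try lra.
      - intros w Hw. apply (Dn_mult 0); [apply zeros_Dn|]. apply (Dn_pow 0); auto. now apply Cc.
      - intros w Hw. destruct (classic (In w E)) as [I|I].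
        + right. rewrite zeros_in by auto. ring.
        + left. apply (Dn_mult 2); [apply zeros_Dn|]. apply (Dn_pow 2); auto.
      - intros w Hw. rewrite Cmod_mult, Cmod_pow. apply Rmult_le_compat; auto using Cmod_ge_0.
        + apply pow_le, Cmod_ge_0.
        + apply HB1. lra.
        + apply pow_incr. split; [apply Cmod_ge_0|auto]. }
    enough (Cmod (h z) <= M) by lra. apply (pow_dominated (Cmod (zeros E z)) B); auto.
    intros n. rewrite <- Cmod_pow, <- Cmod_mult. apply N. }
  intros z Hz. apply le_epsilon. intros e He.
  destruct (Cc z ltac:(lra) e He) as [d [Hd H1]].
  destruct (avoid_list E z (Rmin d (r - Cmod z)) ltac:(apply Rmin_glb_lt; lra)) as [t [Ht H2]].
  destruct (H2 (t / 2) ltac:(lra)) as [H3 H4].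
  assert (B1 := Rmin_l d (r - Cmod z)). assert (B2 := Rmin_r d (r - Cmod z)).
  set (w := (z + (t / 2)%R)%C) in *.
  assert (Ew : Cmod (w - z) = t / 2).
  { replace (w - z)%C with (RtoC (t / 2)) by (unfold w; ring). rewrite Cmod_R, Rabs_right; lra. }
  assert (Hw : Cmod w < r) by (assert (T := Cmod_rev_triangle w z); lra).
  assert (X := A w Hw H4). specialize (H1 w ltac:(lra)).
  assert (T := Cmod_rev_triangle (h z) (h w)). rewrite Cmod_sub_sym in T. lra.
Qed.

(** * Removable singularities *)

(** [q] is the difference quotient of [h] at [u], completed at [u] by the derivative. *)
Definition slope (h : C -> C) (u : C) (q : C -> C) : Prop :=
  (forall w, h w = h u + (w - u) * q w)%C /\ ccont q u.

(** The complex derivative of [f] at [z] is [l]. *)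
Definition isd (f : C -> C) (z l : C) : Prop := exists q, slope f z q /\ q z = l.

Lemma punctured_ball_point (z : C) (d : R) : 0 < d -> exists w, w <> z /\ Cmod (w - z) < d.
Proof.
  intros Hd. exists (z + (d / 2)%R)%C.
  assert (E : Cmod (z + (d / 2)%R - z) = d / 2).
  { replace (z + (d / 2)%R - z)%C with (RtoC (d / 2)) by ring. rewrite Cmod_R, Rabs_right; lra. }
  split; [|lra]. intros X. rewrite X, Cmod_sub_self in E. lra.
Qed.

Lemma ccont_eq_at (f g : C -> C) (z : C) (d : R) : 0 < d -> ccont f z -> ccont g z ->
  (forall w, w <> z -> Cmod (w - z) < d -> f w = g w) -> f z = g z.
Proof.
  intros Hd Hf Hg H. apply NNPP. intros N.
  assert (P : 0 < Cmod (f z - g z)) by (apply Cmod_gt_0; now apply Csub_neq_0).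
  destruct (ccont_plus _ _ z Hf (ccont_mult _ _ z (ccont_const (-1) z) Hg) _ P) as [d1 [Hd1 H1]].
  destruct (punctured_ball_point z (Rmin d d1)) as [w [Nw Hw]]; [now apply Rmin_glb_lt|].
  specialize (H1 w (Rlt_le_trans _ _ _ Hw (Rmin_r _ _))). cbv beta in H1.
  rewrite (H w Nw (Rlt_le_trans _ _ _ Hw (Rmin_l _ _))) in H1.
  replace (g w + -1 * g w - (f z + -1 * g z))%C with (- (f z - g z))%C in H1 by ring.
  rewrite Cmod_opp in H1. lra.
Qed.

Lemma slope_unique h u q q' : slope h u q -> slope h u q' -> q u = q' u.
Proof.
  intros [H1 C1] [H2 C2]. apply (ccont_eq_at q q' u 1); auto; [lra|]. intros w Hw _.
  assert (E := H1 w). rewrite (H2 w) in E.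
  assert (N := Csub_neq_0 _ _ Hw).
  assert (q' w = (h u + (w - u) * q' w - h u) / (w - u))%C by (field; auto).
  rewrite H, E. field. auto.
Qed.

Lemma slope_away h u q w : slope h u q -> w <> u -> q w = ((h w - h u) / (w - u))%C.
Proof. intros [H _] N. rewrite (H w). field. now apply Csub_neq_0. Qed.

Lemma slope_Dn n h u q w : slope h u q -> w <> u -> Dn n h w -> Dn n q w.
Proof.
  intros H N Hw. assert (P : 0 < Cmod (w - u)) by (apply Cmod_gt_0; now apply Csub_neq_0).
  apply (Dn_local n (fun v => (h v - h u) / (v - u))%C _ _ (Cmod (w - u)) P).
  - intros v Hv. symmetry. apply slope_away; auto. intros ->. rewrite Cmod_sub_sym in Hv. lra.
  - now apply Dn_quot_away.
Qed.

Lemma Dn_slope n h u : Dn (S n) h u -> exists q, slope h u q /\ Dn n q u.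
Proof.
  intros [q [Hq Dq]]. exists q. split; auto. split; auto. apply (Dn_le 0 n); auto; lia.
Qed.

Lemma isd_unique f z l l' : isd f z l -> isd f z l' -> l = l'.
Proof. intros [q [S <-]] [q' [S' <-]]. now apply (slope_unique f z). Qed.

Lemma isd_Dn1 f z l : isd f z l -> Dn 1 f z.
Proof. intros [q [[S Cq] _]]. now exists q. Qed.

Lemma Dn1_isd f z : Dn 1 f z -> exists l, isd f z l.
Proof. intros H. destruct (Dn_slope 0 f z H) as [q [S _]]. now exists (q z), q. Qed.

Lemma isd_const (c z : C) : isd (fun _ => c) z 0%C.
Proof. exists (fun _ => 0%C). split; auto. split; [intros; ring|apply ccont_const]. Qed.

Lemma isd_id (z : C) : isd (fun w => w) z 1%C.
Proof. exists (fun _ => 1%C). split; auto. split; [intros; ring|apply ccont_const]. Qed.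

Lemma isd_plus f g z a b : isd f z a -> isd g z b -> isd (fun w => f w + g w)%C z (a + b)%C.
Proof.
  intros [p [[Hp Cp] <-]] [q [[Hq Cq] <-]]. exists (fun w => p w + q w)%C. split; auto.
  split; [intros w; rewrite (Hp w), (Hq w); ring|now apply ccont_plus].
Qed.

Lemma isd_mult f g z a b : isd f z a -> isd g z b -> isd (fun w => f w * g w)%C z (a * g z + f z * b)%C.
Proof.
  intros [p [[Hp Cp] <-]] [q [[Hq Cq] <-]].
  assert (Cg : ccont g z) by (apply (Dn_le 0 1); auto; now exists q).
  exists (fun w => p w * g w + f z * q w)%C. split; auto. split.
  - intros w. rewrite (Hp w) at 1. rewrite (Hq w). ring.
  - apply ccont_plus; apply ccont_mult; auto. apply ccont_const.
Qed.

Lemma isd_comp f g z a b : isd g z a -> isd f (g z) b -> isd (fun w => f (g w)) z (a * b)%C.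
Proof.
  intros [p [[Hp Cp] <-]] [q [[Hq Cq] <-]].
  assert (Cg : ccont g z) by (apply (Dn_le 0 1); auto; now exists p).
  exists (fun w => p w * q (g w))%C. split; auto. split.
  - intros w. rewrite (Hq (g w)). rewrite (Hp w) at 1. ring.
  - apply ccont_mult; auto. now apply ccont_comp.
Qed.

Lemma isd_local f g z l d : 0 < d -> (forall w, Cmod (w - z) < d -> f w = g w) -> isd f z l -> isd g z l.
Proof.
  intros Hd H [q [[Hq Cq] <-]].
  assert (Ez : f z = g z) by (apply H; now rewrite Cmod_sub_self).
  exists (fun w => if excluded_middle_informative (w = z) then q z else ((g w - g z) / (w - z))%C).
  split; [|now destruct (excluded_middle_informative (z = z))]. split.
  - intros w. destruct (excluded_middle_informative _) as [->|N]; [ring|]. field. now apply Csub_neq_0.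
  - apply (Dn_local 0 q _ _ d Hd); auto. intros w Hw.
    destruct (excluded_middle_informative _) as [->|N]; auto.
    rewrite <- (H w Hw), <- Ez, (Hq w). field. now apply Csub_neq_0.
Qed.

Lemma ccont_bounded (h : C -> C) (r : R) : 0 <= r -> (forall z, Cmod z <= r -> ccont h z) ->
  exists M, 0 <= M /\ forall z, Cmod z <= r -> Cmod (h z) <= M.
Proof.
  intros Hr H. destruct (Cmod_max_attained h r Hr H) as [w [_ Hw]].
  exists (Cmod (h w)). split; auto using Cmod_ge_0.
Qed.

Section Removable.
Variable h : C -> C.
Variable e : C.
Variable rho r : R.
Hypothesis Hrho : 0 <= rho < r.
Hypothesis Hr : r < 1.
Hypothesis Hc : forall z, disc z -> ccont h z.
Hypothesis Hd : forall z, disc z -> z <> e -> Dn 2 h z.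

Lemma slope_ccont u q : disc u -> slope h u q -> forall z, disc z -> ccont q z.
Proof.
  intros Hu S z Hz. destruct (classic (z = u)) as [->|N]; [apply S|].
  apply (slope_Dn 0 h u); auto. now apply Hc.
Qed.

(** The maximum principle for the slope of [h] at [u], with exceptional points [e] and [u]. On the
    circle of radius [r] its numerator is at most [2 * M] and its denominator at least [r - rho]. If
    [u = e], the roles of [u] and [v] are exchanged. *)
Lemma lipschitz_inside : exists K, 0 <= K /\
  forall u v, Cmod u <= rho -> Cmod v <= rho -> Cmod (h u - h v) <= K * Cmod (u - v).
Proof.
  destruct (ccont_bounded h r) as [M [HM HM1]]; [lra|intros; apply Hc; unfold disc; lra|].
  set (K := 2 * M / (r - rho)).
  assert (HK : 0 <= K) by (apply Rmult_le_pos; [lra|left; apply Rinv_0_lt_compat; lra]).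
  exists K. split; auto.
  assert (A : forall u v, Cmod u <= rho -> Cmod v <= rho -> u <> e -> Cmod (h u - h v) <= K * Cmod (u - v)).
  { intros u v Hu Hv N. assert (Du : disc u) by (unfold disc; lra).
    destruct (Dn_slope 1 h u (Hd u Du N)) as [q [S _]].
    assert (B : Cmod (q v) <= K).
    { apply (max_principle (e :: u :: nil) q r K); try lra.
      - intros z Hz. apply (slope_ccont u q Du S). unfold disc; lra.
      - intros z Hz I. assert (z <> e /\ z <> u) by (split; intros ->; apply I; simpl; auto).
        apply (slope_Dn 2 h u q z S); [tauto|]. apply Hd; [unfold disc; lra|tauto].
      - intros z Hz. assert (Nz : z <> u) by (intros ->; lra).
        rewrite (slope_away h u q z S Nz), Cmod_div by (now apply Csub_neq_0).
        assert (T1 := Cmod_rev_triangle z u). assert (T2 := Cmod_minus_le (h z) (h u)).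
        assert (M1 := HM1 z ltac:(lra)). assert (M2 := HM1 u ltac:(lra)).
        unfold K, Rdiv. apply Rmult_le_compat; [apply Cmod_ge_0|left; apply Rinv_0_lt_compat; lra|lra|].
        apply Rinv_le_contravar; lra. }
    destruct S as [S _]. rewrite (S v), Cmod_sub_sym.
    replace (h u + (v - u) * q v - h u)%C with ((v - u) * q v)%C by ring.
    rewrite Cmod_mult, (Cmod_sub_sym u v). assert (Q := Cmod_ge_0 (v - u)). nra. }
  intros u v Hu Hv. destruct (classic (u = e)) as [Eu|N]; [|now apply A].
  destruct (classic (v = e)) as [Ev|N].
  - subst u v. rewrite !Cmod_sub_self. lra.
  - rewrite (Cmod_sub_sym (h u)), (Cmod_sub_sym u). now apply A.
Qed.

(** The maximum principle for [q - q']. On the circle of radius [r], over a common denominator, both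
    terms of the numerator contain a factor controlled by [|u - u'|]: one literally, the other
    through [lipschitz_inside]. *)
Lemma slope_lipschitz : exists K, 0 <= K /\ forall u u' q q' z,
  Cmod u <= rho -> Cmod u' <= rho -> u <> e -> u' <> e -> slope h u q -> slope h u' q' -> Cmod z < r ->
  Cmod (q z - q' z) <= K * Cmod (u - u').
Proof.
  destruct (ccont_bounded h r) as [M [HM HM1]]; [lra|intros; apply Hc; unfold disc; lra|].
  destruct lipschitz_inside as [L [HL HL1]].
  set (K := (2 * M + 2 * L) / ((r - rho) * (r - rho))).
  assert (P : 0 < (r - rho) * (r - rho)) by nra.
  assert (HK : 0 <= K) by (apply Rmult_le_pos; [lra|left; now apply Rinv_0_lt_compat]).
  exists K. split; auto. intros u u' q q' z Hu Hu' N N' S S' Hz.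
  assert (Du : disc u) by (unfold disc; lra). assert (Du' : disc u') by (unfold disc; lra).
  apply (max_principle (e :: u :: u' :: nil) (fun z => q z - q' z)%C r); auto; [lra| | |].
  - intros w Hw. assert (disc w) by (unfold disc; lra).
    apply (Dn_minus 0); [now apply (slope_ccont u)|now apply (slope_ccont u')].
  - intros w Hw I. assert (X : w <> e /\ w <> u /\ w <> u') by (repeat split; intros ->; apply I; simpl; auto).
    assert (Dw : disc w) by (unfold disc; lra). destruct X as [X1 [X2 X3]].
    apply (Dn_minus 2); [apply (slope_Dn 2 h u)|apply (slope_Dn 2 h u')]; auto.
  - intros w Hw. assert (Nu : w <> u) by (intros ->; lra). assert (Nu' : w <> u') by (intros ->; lra).
    rewrite (slope_away h u q w S Nu), (slope_away h u' q' w S' Nu').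
    assert (Z := Csub_neq_0 _ _ Nu). assert (Z' := Csub_neq_0 _ _ Nu').
    replace ((h w - h u) / (w - u) - (h w - h u') / (w - u'))%C with
      (((h w - h u') * (u - u') - (h u - h u') * (w - u')) / ((w - u) * (w - u')))%C by (field; auto).
    rewrite Cmod_div by (now apply Cmult_neq_0). rewrite Cmod_mult.
    assert (T1 := Cmod_rev_triangle w u). assert (T1' := Cmod_rev_triangle w u').
    assert (B : Cmod ((h w - h u') * (u - u') - (h u - h u') * (w - u')) <= (2 * M + 2 * L) * Cmod (u - u')).
    { eapply Rle_trans; [apply Cmod_minus_le|]. rewrite !Cmod_mult.
      assert (T2 := Cmod_minus_le (h w) (h u')). assert (T3 := Cmod_minus_le w u').
      assert (M1 := HM1 w ltac:(lra)). assert (M2 := HM1 u' ltac:(lra)).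
      assert (L1 := HL1 u u' Hu Hu'). assert (G1 := Cmod_ge_0 (u - u')).
      assert (G3 := Cmod_ge_0 (h u - h u')).
      assert (Cmod (h u - h u') * Cmod (w - u') <= L * Cmod (u - u') * 2) by (apply Rmult_le_compat; lra).
      assert (Cmod (h w - h u') * Cmod (u - u') <= 2 * M * Cmod (u - u')) by (apply Rmult_le_compat_r; lra).
      lra. }
    unfold K. replace ((2 * M + 2 * L) / ((r - rho) * (r - rho)) * Cmod (u - u')) with
       ((2 * M + 2 * L) * Cmod (u - u') / ((r - rho) * (r - rho))) by (field; lra).
    unfold Rdiv. apply Rmult_le_compat; [apply Cmod_ge_0|left; apply Rinv_0_lt_compat; nra|exact B|].
    apply Rinv_le_contravar; auto. nra.
Qed.
End Removable.

Lemma radii (z : C) : disc z -> exists rho r, Cmod z < rho < r /\ 0 <= rho /\ r < 1.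
Proof.
  unfold disc. intros H. assert (Q := Cmod_ge_0 z).
  exists ((2 * Cmod z + 1) / 3), ((Cmod z + 2) / 3). lra.
Qed.

(* The difference quotients of [h] at [e] are the values at [e] of the slopes at nearby
   points, and these depend on the point in a Lipschitz way. *)
Lemma removable (h : C -> C) (e : C) : disc e -> (forall z, disc z -> ccont h z) ->
  (forall z, disc z -> z <> e -> Dn 2 h z) -> Dn 1 h e.
Proof.
  intros De Hc Hd. destruct (radii e De) as [rho [r [Hr1 [Hr2 Hr3]]]].
  destruct (slope_lipschitz h e rho r ltac:(lra) Hr3 Hc Hd) as [K [HK HK1]].
  set (d := rho - Cmod e). assert (Pd : 0 < d) by (unfold d; lra).
  set (l := fun u => ((h u - h e) / (u - e))%C).
  assert (L : forall u u', u <> e -> u' <> e -> Cmod (u - e) <= d -> Cmod (u' - e) <= d ->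
     Cmod (l u - l u') <= K * Cmod (u - u')).
  { intros u u' N N' Hu Hu'.
    assert (A : Cmod u <= rho) by (assert (T := Cmod_rev_triangle u e); unfold d in Hu; lra).
    assert (A' : Cmod u' <= rho) by (assert (T := Cmod_rev_triangle u' e); unfold d in Hu'; lra).
    destruct (Dn_slope 1 h u (Hd u ltac:(unfold disc; lra) N)) as [q [S _]].
    destruct (Dn_slope 1 h u' (Hd u' ltac:(unfold disc; lra) N')) as [q' [S' _]].
    (* Difference quotients are symmetric: the quotient at [e] towards [u] is the slope at the
       regular point [u], evaluated at [e]. *)
    replace (l u) with (q e). replace (l u') with (q' e). apply HK1; auto; lra.
    - rewrite (slope_away h u' q' e S'); auto. unfold l. field. split; apply Csub_neq_0; auto.
    - rewrite (slope_away h u q e S); auto. unfold l. field. split; apply Csub_neq_0; auto. }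
  set (u := fun n => (e + (d * (/ 2) ^ n)%R)%C).
  assert (Pn : forall n, 0 < d * (/ 2) ^ n) by (intros; apply Rmult_lt_0_compat; auto; apply pow_lt; lra).
  assert (Eu : forall n, Cmod (u n - e) = d * (/ 2) ^ n).
  { intros n. unfold u. replace (e + (d * (/ 2) ^ n)%R - e)%C with (RtoC (d * (/ 2) ^ n)) by ring.
    rewrite Cmod_R, Rabs_right; auto. specialize (Pn n). lra. }
  assert (Nu : forall n, u n <> e).
  { intros n X. specialize (Eu n). rewrite X, Cmod_sub_self in Eu. specialize (Pn n). lra. }
  assert (Lu : forall n, Cmod (u n - e) <= d).
  { intros n. rewrite Eu. assert ((/ 2) ^ n <= 1) by (rewrite <- (pow1 n); apply pow_incr; lra). nra. }
  destruct (geometric_limit (fun n => l (u n)) (K * d)) as [m Hm].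
  { intros n. eapply Rle_trans; [apply L; auto|]. rewrite Rmult_assoc. apply Rmult_le_compat_l; auto.
    unfold u. replace (e + (d * (/ 2) ^ n)%R - (e + (d * (/ 2) ^ S n)%R))%C with (RtoC (d * (/ 2) ^ n * / 2)).
    - rewrite Cmod_R, Rabs_right; specialize (Pn n); lra.
    - rewrite !RtoC_mult. simpl. rewrite !RtoC_mult, RtoC_inv by lra. field. }
  assert (Lm : forall w, w <> e -> Cmod (w - e) <= d -> Cmod (l w - m) <= K * Cmod (w - e)).
  { intros w Nw Hw. apply le_epsilon. intros x Hx.
    destruct (half_pow_small (3 * K * d) x Hx) as [n Hn]. specialize (Hn n ltac:(lia)).
    eapply Rle_trans; [apply (Cmod_sub_triangle _ (l (u n)))|].
    assert (A := L w (u n) Nw (Nu n) Hw (Lu n)). specialize (Hm n). simpl in Hm.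
    assert (B : Cmod (w - u n) <= Cmod (w - e) + d * (/ 2) ^ n).
    { rewrite <- Eu. rewrite (Cmod_sub_sym (u n)). apply Cmod_sub_triangle. }
    assert (K * Cmod (w - u n) <= K * Cmod (w - e) + K * (d * (/ 2) ^ n)) by nra.
    nra. }
  exists (fun w => if excluded_middle_informative (w = e) then m else l w). split.
  - intros w. destruct (excluded_middle_informative _) as [->|N]; [ring|]. unfold l. field. now apply Csub_neq_0.
  - intros x Hx. assert (Q : 0 < x / (K + 1)) by (apply Rdiv_lt_0_compat; lra).
    exists (Rmin d (x / (K + 1))). split; [apply Rmin_glb_lt; auto|]. intros w Hw.
    assert (A1 := Rmin_l d (x / (K + 1))). assert (A2 := Rmin_r d (x / (K + 1))).
    destruct (excluded_middle_informative (e = e)) as [_|]; [|congruence].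
    destruct (excluded_middle_informative (w = e)) as [->|N]; [now rewrite Cmod_sub_self|].
    eapply Rle_lt_trans; [apply Lm; auto; lra|].
    assert (B : (K + 1) * Cmod (w - e) < x).
    { apply Rmult_lt_reg_l with (/ (K + 1)); [apply Rinv_0_lt_compat; lra|].
      rewrite <- Rmult_assoc, Rinv_l, Rmult_1_l by lra. unfold Rdiv in *. lra. }
    assert (G := Cmod_ge_0 (w - e)). lra.
Qed.

(** * Regularity of slopes and derivatives *)

Definition holo (n : nat) (f : C -> C) : Prop := forall z, disc z -> Dn n f z.

Lemma holo_le m n f : (m <= n)%nat -> holo n f -> holo m f.
Proof. intros L H z Hz. apply (Dn_le m n); auto. Qed.

(** Only the point [e] is in question. Removability applied to [q] yields its slope [p] at [e], and
    applied again to [p] it makes [p] differentiable there, which is order 2 for [q]. *)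
Lemma holo2_slope h e q : disc e -> holo 2 h -> slope h e q -> holo 2 q.
Proof.
  intros De Hh S.
  assert (Cq : forall z, disc z -> ccont q z).
  { apply (slope_ccont h) with (u := e); auto. apply (holo_le 0 2); auto. }
  assert (Dq : forall z, disc z -> z <> e -> Dn 2 q z) by (intros; apply (slope_Dn 2 h e); auto).
  destruct (Dn_slope 0 q e (removable q e De Cq Dq)) as [p [Sp _]].
  assert (Dp : Dn 1 p e).
  { apply removable; auto.
    - apply (slope_ccont q) with (u := e); auto.
    - intros z Hz N. apply (slope_Dn 2 q e); auto. }
  intros z Hz. destruct (classic (z = e)) as [->|N]; auto.
  exists p. split; auto. apply Sp.
Qed.

(** [p' v] is the value at [v] of the slope based at [v]. It is compared with the value at [v] of
    the slope based at [w], which is uniformly close by [slope_lipschitz] and continuous at [w]. *)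
Lemma holo2_deriv_ccont p p' : holo 2 p -> (forall z, disc z -> isd p z (p' z)) ->
  forall z, disc z -> ccont p' z.
Proof.
  intros Hp Hp' w Dw. destruct (radii w Dw) as [rho [r [Hr1 [Hr2 Hr3]]]].
  assert (N2 : forall z, Cmod z <= rho -> z <> 2%C).
  (* The exceptional point is set to 2, outside the disc, because [p] has no singularity. *)
  { intros z Hz ->. rewrite Cmod_R, Rabs_right in Hz; lra. }
  destruct (slope_lipschitz p 2 rho r ltac:(lra) Hr3 (holo_le 0 2 p ltac:(lia) Hp) (fun z Dz _ => Hp z Dz)) as [K [HK HK1]].
  destruct (Hp' w Dw) as [q [S E]].
  intros x Hx. destruct S as [S Cq]. destruct (Cq (x / 2) ltac:(lra)) as [d [Hd H1]].
  assert (Q : 0 < x / 2 / (K + 1)) by (repeat apply Rdiv_lt_0_compat; lra).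
  exists (Rmin d (Rmin (rho - Cmod w) (x / 2 / (K + 1)))). split; [repeat apply Rmin_glb_lt; lra|].
  intros v Hv.
  assert (A1 := Rmin_l d (Rmin (rho - Cmod w) (x / 2 / (K + 1)))).
  assert (A2 := Rmin_r d (Rmin (rho - Cmod w) (x / 2 / (K + 1)))).
  assert (A3 := Rmin_l (rho - Cmod w) (x / 2 / (K + 1))).
  assert (A4 := Rmin_r (rho - Cmod w) (x / 2 / (K + 1))).
  assert (Hv' : Cmod v <= rho) by (assert (T := Cmod_rev_triangle v w); lra).
  destruct (Hp' v ltac:(unfold disc; lra)) as [qv [Sv Ev]].
  rewrite <- E, <- Ev.
  eapply Rle_lt_trans; [apply (Cmod_sub_triangle _ (q v))|].
  assert (B1 := H1 v ltac:(lra)).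
  assert (B2 := HK1 v w qv q v Hv' ltac:(lra) (N2 v Hv') (N2 w ltac:(lra)) Sv (conj S Cq) ltac:(lra)).
  assert (B : (K + 1) * Cmod (v - w) < x / 2).
  { apply Rmult_lt_reg_l with (/ (K + 1)); [apply Rinv_0_lt_compat; lra|].
    rewrite <- Rmult_assoc, Rinv_l, Rmult_1_l by lra. unfold Rdiv in *. lra. }
  assert (G := Cmod_ge_0 (v - w)). lra.
Qed.

Lemma deriv_exists f : holo 1 f -> exists f', forall z, disc z -> isd f z (f' z).
Proof.
  intros H. assert (X : forall z, exists l, disc z -> isd f z l).
  { intros z. destruct (classic (disc z)) as [D|N]; [|exists 0%C; tauto].
    destruct (Dn1_isd f z (H z D)) as [l Hl]. now exists l. }
  exists (fun z => proj1_sig (constructive_indefinite_description _ (X z))).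
  intros z. destruct (constructive_indefinite_description _ (X z)); auto.
Qed.

Lemma slope_deriv f w q l z q' : slope f w q -> isd f z l -> isd q z q' -> l = (q z + (z - w) * q')%C.
Proof.
  intros [S _] Hl Hq. apply (isd_unique f z); auto.
  assert (Y : isd (fun z => f w + (z + - w) * q z)%C z (0 + ((1 + 0) * q z + (z + - w) * q'))%C).
  { apply isd_plus; [apply isd_const|]. apply (isd_mult (fun z => z + - w)%C); auto.
    apply isd_plus; [apply isd_id|apply isd_const]. }
  replace (0 + ((1 + 0) * q z + (z + - w) * q'))%C with (q z + (z - w) * q')%C in Y by ring.
  refine (isd_local _ f z _ 1 ltac:(lra) _ Y). intros v _. rewrite (S v). ring.
Qed.

(* If [F] is a primitive of [f] with slope [q] at [w], and [p] is the slope of [q] at [w], then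
   [f z = q z + (z - w) p z + (z - w)^2 p' z] with [p'] continuous at [w]. *)
Lemma holo1_holo2 f : holo 1 f -> holo 2 f.
Proof.
  intros Hf. destruct (hol_primitive f Hf) as [F HF].
  assert (X : forall z, disc z -> Dn 2 F z /\ isd F z (f z)).
  { intros z Hz. destruct (HF z Hz) as [q [Hq [Dq Eq]]]. destruct (disc_open z Hz) as [d [Hd Hd1]].
    set (k := fun w => (F z + (w - z) * q w)%C).
    assert (Ez : k z = F z) by (unfold k; ring).
    assert (Ek : forall w, k w = (k z + (w - z) * q w)%C) by (intros; rewrite Ez; auto).
    assert (Loc : forall w, Cmod (w - z) < d -> k w = F w) by (intros; unfold k; symmetry; auto).
    split.
    - apply (Dn_local 2 k _ _ d Hd Loc). now exists q.
    - apply (isd_local k _ _ _ d Hd Loc). exists q. split; auto. split; auto. apply (Dn_le 0 1); auto. }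
  assert (PF : holo 2 F) by (intros z Hz; now apply X).
  intros w Dw.
  destruct (Dn_slope 1 F w (PF w Dw)) as [q [Sq _]].
  assert (Pq := holo2_slope F w q Dw PF Sq).
  destruct (Dn_slope 1 q w (Pq w Dw)) as [p [Sp _]].
  assert (Pp := holo2_slope q w p Dw Pq Sp).
  destruct (deriv_exists p (holo_le 1 2 p ltac:(lia) Pp)) as [p' Hp'].
  destruct (deriv_exists q (holo_le 1 2 q ltac:(lia) Pq)) as [q' Hq'].
  assert (Cp' := holo2_deriv_ccont p p' Pp Hp' w Dw).
  destruct (disc_open w Dw) as [d [Hd Hd1]].
  apply (Dn_local 2 (fun z => q z + (z - w) * p z + (z - w) * ((z - w) * p' z))%C _ _ d Hd).
  - intros z Hz. specialize (Hd1 z Hz).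
    rewrite (slope_deriv F w q (f z) z (q' z) Sq (proj2 (X z Hd1)) (Hq' z Hd1)).
    rewrite (slope_deriv q w p (q' z) z (p' z) Sp (Hq' z Hd1) (Hp' z Hd1)). ring.
  - assert (Dm : Dn 2 (fun z => z - w)%C w) by (apply Dn_minus; [apply Dn_id|apply Dn_const]).
    apply Dn_plus; [apply Dn_plus; [now apply Pq|apply Dn_mult; auto; now apply Pp]|].
    exists (fun z => (z - w) * p' z)%C. split; [intros; ring|].
    exists p'. split; [intros; ring|auto].
Qed.

Lemma holo_div f e : disc e -> holo 1 f -> exists q, slope f e q /\ holo 1 q.
Proof.
  intros De Hf. destruct (Dn_slope 0 f e (Hf e De)) as [q [S _]]. exists q. split; auto.
  apply (holo_le 1 2); auto. apply (holo2_slope f e); auto. now apply holo1_holo2.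
Qed.

(** If [q] is the slope at [w], then [f' z = q z + (z - w) * q' z]; here [q] is differentiable and
    continuity of [q'] at [w] suffices for the other term. *)
Lemma holo_deriv f : holo 1 f -> exists f', (forall z, disc z -> isd f z (f' z)) /\ holo 1 f'.
Proof.
  intros Hf. destruct (deriv_exists f Hf) as [f' Hf']. exists f'. split; auto.
  intros w Dw. destruct (holo_div f w Dw Hf) as [q [S Hq]].
  destruct (deriv_exists q Hq) as [q' Hq'].
  destruct (disc_open w Dw) as [d [Hd Hd1]].
  apply (Dn_local 1 (fun z => q z + (z - w) * q' z)%C _ _ d Hd).
  - intros z Hz. specialize (Hd1 z Hz). symmetry. apply (slope_deriv f w q); auto.
  - apply Dn_plus; [now apply Hq|]. exists q'. split; [intros; ring|].
    apply (holo2_deriv_ccont q); auto. now apply holo1_holo2.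
Qed.

(** * Schwarz's lemma and the identity theorem *)

Lemma holo_comp n f g : holo n f -> (forall z, disc z -> Dn n g z /\ disc (g z)) -> holo n (fun z => f (g z)).
Proof. intros Hf Hg z Hz. destruct (Hg z Hz). apply Dn_comp; auto. Qed.

Lemma holo_mult n f g : holo n f -> holo n g -> holo n (fun z => f z * g z)%C.
Proof. intros Hf Hg z Hz. apply Dn_mult; auto. Qed.

Lemma holo_const n (c : C) : holo n (fun _ => c).
Proof. intros z _. apply Dn_const. Qed.

Lemma holo_id n : holo n (fun z => z).
Proof. intros z _. apply Dn_id. Qed.

Lemma max_principle_holo f r M : holo 1 f -> 0 < r < 1 -> (forall z, Cmod z = r -> Cmod (f z) <= M) ->
  forall z, Cmod z <= r -> Cmod (f z) <= M.
Proof.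
  intros Hf Hr HM z Hz. destruct (Rle_lt_or_eq_dec _ _ Hz) as [L|E]; [|now apply HM].
  apply (max_principle nil f r M); auto; [lra| |].
  - intros w Hw. apply (Dn_le 0 1); auto. apply Hf. unfold disc; lra.
  - intros w Hw _. apply holo1_holo2; auto. unfold disc; lra.
Qed.

Lemma holo_div_0 f : holo 1 f -> f 0%C = 0%C -> exists g, holo 1 g /\ forall z, f z = (z * g z)%C.
Proof.
  intros Hf H0. destruct (holo_div f 0 disc_0 Hf) as [g [[S _] Hg]]. exists g. split; auto.
  intros z. rewrite (S z), H0. ring.
Qed.

Lemma le_of_lt_limit (a b c : R) : c < 1 -> (forall r, c < r < 1 -> a * r <= b) -> 0 <= a -> a <= b.
Proof.
  intros Hc H Ha. apply le_epsilon. intros e He.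
  set (s := Rmin ((1 - c) / 2) (e / (a + 1))).
  assert (Q : 0 < e / (a + 1)) by (apply Rdiv_lt_0_compat; lra).
  assert (S0 : 0 < s) by (apply Rmin_glb_lt; lra).
  assert (S1 : s <= (1 - c) / 2) by apply Rmin_l. assert (S2 : s <= e / (a + 1)) by apply Rmin_r.
  specialize (H (1 - s) ltac:(lra)).
  assert ((a + 1) * s <= e).
  { apply Rle_trans with ((a + 1) * (e / (a + 1))); [apply Rmult_le_compat_l; lra|right; field; lra]. }
  nra.
Qed.

(* Maximum principle for [f / z], in the limit [r -> 1]. *)
Lemma schwarz_step f g M : holo 1 g -> (forall z, disc z -> f z = z * g z)%C ->
  (forall z, disc z -> Cmod (f z) <= M) -> forall z, disc z -> Cmod (g z) <= M.
Proof.
  intros Hg E HM z Hz. apply (le_of_lt_limit _ M (Cmod z)); auto using Cmod_ge_0.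
  intros r Hr. assert (Qz := Cmod_ge_0 z).
  assert (B : Cmod (g z) <= M / r); [|apply (Rmult_le_compat_r r) in B; [|lra]; unfold Rdiv in B; rewrite Rmult_assoc, Rinv_l in B; lra].
  apply (max_principle_holo g r); auto; try lra. intros w Hw.
  assert (Dw : disc w) by (unfold disc; lra).
  apply Rmult_le_reg_l with r; [lra|]. rewrite <- Hw at 1. rewrite <- Cmod_mult, <- E by auto.
  replace (r * (M / r)) with M by (field; lra). now apply HM.
Qed.

Lemma schwarz_order n f g M : holo 1 g -> (forall z, disc z -> f z = z ^ n * g z)%C ->
  (forall z, disc z -> Cmod (f z) <= M) -> forall z, disc z -> Cmod (g z) <= M.
Proof.
  intros Hg. revert f. induction n as [|n IH]; intros f E HM.
  - intros z Hz. specialize (HM z Hz). rewrite E in HM by auto. simpl in HM. now rewrite Cmult_1_l in HM.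
  - apply (IH (fun z => z ^ n * g z)%C); auto.
    apply (schwarz_step f); auto.
    + apply holo_mult; auto. intros z _. apply (Dn_pow 1 (fun z => z)), Dn_id.
    + intros z Hz. rewrite E by auto. simpl. ring.
Qed.

Lemma schwarz f : holo 1 f -> f 0%C = 0%C -> (forall z, disc z -> Cmod (f z) <= 1) ->
  forall z, disc z -> Cmod (f z) <= Cmod z.
Proof.
  intros Hf H0 H1 z Hz. destruct (holo_div_0 f Hf H0) as [g [Hg E]].
  assert (B := schwarz_order 1 f g 1 Hg ltac:(intros; rewrite E; simpl; ring) H1 z Hz).
  rewrite E, Cmod_mult. assert (Q := Cmod_ge_0 z). nra.
Qed.

(** * Involutive automorphisms of the disc *)

Lemma pseudo_hyperbolic (a z : C) :
  (Cmod (1 - Cconj a * z) ^ 2 - Cmod (a - z) ^ 2 = (1 - Cmod a ^ 2) * (1 - Cmod z ^ 2))%R.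
Proof. rewrite !Cmod2_alt. unfold Re, Im. destruct a, z; simpl. ring. Qed.

Lemma tau_den_lt (a z : C) : disc a -> disc z -> Cmod (a - z) < Cmod (1 - Cconj a * z).
Proof.
  unfold disc. intros Ha Hz. assert (E := pseudo_hyperbolic a z).
  assert (Q1 := Cmod_ge_0 a). assert (Q2 := Cmod_ge_0 z).
  assert (Q4 := Cmod_ge_0 (1 - Cconj a * z)).
  assert (A : Cmod a ^ 2 < 1) by nra. assert (B : Cmod z ^ 2 < 1) by nra.
  nra.
Qed.

(** The automorphism exchanging 0 and [a]. Being its own inverse, it transports statements from the
    origin to [a] and back. *)
Definition tau (a z : C) : C := ((a - z) / (1 - Cconj a * z))%C.

(** The closed disc is allowed for the sake of fixed points on the circle. *)
Lemma tau_den_closed (a z : C) : disc a -> Cmod z <= 1 -> (1 - Cconj a * z)%C <> 0%C.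
Proof.
  unfold disc. intros Ha Hz E. assert (T := Cmod_rev_triangle 1 (Cconj a * z)).
  rewrite E, Cmod_0, Cmod_1, Cmod_mult, Cmod_conj in T.
  assert (Q1 := Cmod_ge_0 a). nra.
Qed.

Lemma tau_den (a z : C) : disc a -> disc z -> (1 - Cconj a * z)%C <> 0%C.
Proof. intros Ha Hz. apply tau_den_closed; auto. unfold disc in Hz; lra. Qed.

Lemma tau_disc a z : disc a -> disc z -> disc (tau a z).
Proof.
  intros Ha Hz. assert (N := tau_den a z Ha Hz). unfold disc, tau. rewrite Cmod_div by auto.
  assert (L := tau_den_lt a z Ha Hz). assert (P : 0 < Cmod (1 - Cconj a * z)) by (now apply Cmod_gt_0).
  apply Rmult_lt_reg_r with (Cmod (1 - Cconj a * z)); auto. unfold Rdiv.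
  rewrite Rmult_assoc, Rinv_l; lra.
Qed.

Lemma Cmod2_disc_neq a : disc a -> (1 - Cconj a * a)%C <> 0%C.
Proof. intros Ha. now apply tau_den. Qed.

Lemma tau_invol a z : disc a -> disc z -> tau a (tau a z) = z.
Proof.
  intros Ha Hz. assert (N := tau_den a z Ha Hz).
  assert (N3 := Cmod2_disc_neq a Ha). unfold tau in *. field. split; auto.
  intros X. apply N3. rewrite <- X. ring.
Qed.

Lemma tau_0 a : tau a 0 = a.
Proof.
  unfold tau. replace (1 - Cconj a * 0)%C with (RtoC 1) by ring. field.
Qed.

Lemma tau_self a : tau a a = 0%C.
Proof. unfold tau. replace (a - a)%C with (RtoC 0) by ring. unfold Cdiv. ring. Qed.

Lemma tau_Dn n a z : disc a -> disc z -> Dn n (tau a) z.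
Proof.
  intros Ha Hz. unfold tau. apply Dn_div.
  - now apply tau_den.
  - apply Dn_minus; [apply Dn_const|apply Dn_id].
  - apply Dn_minus; [apply Dn_const|]. apply Dn_mult; [apply Dn_const|apply Dn_id].
Qed.

Lemma holo_tau n f a : disc a -> holo n f -> holo n (fun z => f (tau a z)).
Proof. intros Ha Hf. apply holo_comp; auto. intros z Hz. split; [now apply tau_Dn|now apply tau_disc]. Qed.

(** * Zeros of holomorphic functions *)

Lemma holo_bounded f : holo 1 f -> forall r, 0 <= r < 1 -> exists M, 0 <= M /\ forall z, Cmod z <= r -> Cmod (f z) <= M.
Proof.
  intros Hf r Hr. apply ccont_bounded; [lra|]. intros z Hz. apply (Dn_le 0 1); auto. apply Hf. unfold disc; lra.
Qed.

(** If [z] could be divided out indefinitely, the maximum principle on a circle of radius [r > |z|]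
    would give [|f z| <= M * (|z| / r) ^ n] for all [n], hence [f z = 0]. *)
Lemma holo_order f : holo 1 f -> (exists z, disc z /\ f z <> 0%C) ->
  exists n g, holo 1 g /\ g 0%C <> 0%C /\ forall z, f z = (z ^ n * g z)%C.
Proof.
  intros Hf [z [Hz Nz]]. apply NNPP. intros N.
  assert (X : forall n, exists g, holo 1 g /\ forall z, f z = (z ^ n * g z)%C).
  { induction n as [|n [g [Hg E]]].
    - exists f. split; auto. intros; simpl; ring.
    - destruct (holo_div_0 g Hg) as [q [Hq E']].
      + apply NNPP. intros N0. apply N. exists n, g. auto.
      + exists q. split; auto. intros w. rewrite (E w), (E' w). simpl. ring. }
  assert (Qz := Cmod_ge_0 z). unfold disc in Hz. set (r := (1 + Cmod z) / 2).
  destruct (holo_bounded f Hf r ltac:(unfold r; lra)) as [M [HM HM1]].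
  enough (r <= Cmod z) by (unfold r in *; lra).
  apply (pow_dominated (Cmod (f z)) M); auto; [now apply Cmod_gt_0|].
  intros n. destruct (X n) as [g [Hg E]].
  assert (Pn : 0 < r ^ n) by (apply pow_lt; unfold r; lra).
  assert (Bg : Cmod (g z) <= M / r ^ n).
  { apply (max_principle_holo g r); auto; [unfold r; lra| |unfold r; lra].
    intros w Hw. apply Rmult_le_reg_l with (r ^ n); auto. rewrite <- Hw at 1.
    rewrite <- Cmod_pow, <- Cmod_mult, <- E. replace (r ^ n * (M / r ^ n)) with M by (field; lra).
    apply HM1. lra. }
  assert (Pz : 0 <= Cmod z ^ n) by (now apply pow_le).
  assert (X1 : Cmod z ^ n * Cmod (g z) * r ^ n <= Cmod z ^ n * (M / r ^ n) * r ^ n)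
    by (apply Rmult_le_compat_r; [lra|now apply Rmult_le_compat_l]).
  rewrite E, Cmod_mult, Cmod_pow. eapply Rle_trans; [exact X1|]. right. field. lra.
Qed.

Lemma ccont_neq_0 f z : ccont f z -> f z <> 0%C -> exists d, 0 < d /\ forall w, Cmod (w - z) < d -> f w <> 0%C.
Proof.
  intros Hf N. assert (P : 0 < Cmod (f z)) by (now apply Cmod_gt_0).
  destruct (Hf _ P) as [d [Hd H]]. exists d. split; auto. intros w Hw E. specialize (H w Hw).
  rewrite E in H. replace (0 - f z)%C with (- f z)%C in H by ring. rewrite Cmod_opp in H. lra.
Qed.

(** After [w] is moved to 0, a nonzero [f] becomes [z ^ n * g z] with [g 0 <> 0], whose zero at 0 is
    isolated. *)
Lemma identity_theorem f w : holo 1 f -> disc w ->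
  (forall eps, 0 < eps -> exists z, disc z /\ z <> w /\ Cmod (z - w) < eps /\ f z = 0%C) ->
  forall z, disc z -> f z = 0%C.
Proof.
  intros Hf Dw Acc z Hz. apply NNPP. intros N.
  assert (Hh := holo_tau 1 f w Dw Hf).
  destruct (holo_order _ Hh) as [n [g [Hg [G0 E]]]].
  { exists (tau w z). split; [now apply tau_disc|]. now rewrite tau_invol. }
  destruct (ccont_neq_0 g 0 (Dn_le 0 1 g 0 ltac:(lia) (Hg _ disc_0)) G0) as [d [Hd Hd1]].
  destruct (Dn_le 0 1 (tau w) w ltac:(lia) (tau_Dn 1 w w Dw Dw) d Hd) as [d' [Hd' Hd1']].
  destruct (Acc d' Hd') as [v [Dv [Nv [Hv Fv]]]].
  specialize (Hd1' v Hv). rewrite tau_self in Hd1'.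
  specialize (E (tau w v)). rewrite tau_invol, Fv in E by auto.
  assert (Y : (tau w v ^ n * g (tau w v))%C <> 0%C).
  { apply Cmult_neq_0; [|now apply Hd1]. apply Cpow_nz. intros Z. apply Nv.
    rewrite <- (tau_invol w v), Z by auto. apply tau_0. }
  congruence.
Qed.

Lemma holo_zero_nbhd f w d : 0 < d -> holo 1 f -> disc w -> (forall z, Cmod (z - w) < d -> f z = 0%C) ->
  forall z, disc z -> f z = 0%C.
Proof.
  intros Hd Hf Dw E. apply (identity_theorem f w); auto. intros e He.
  destruct (disc_open w Dw) as [d' [Hd' H']].
  destruct (punctured_ball_point w (Rmin (Rmin d d') e)) as [z [Nz Hz]].
  { apply Rmin_glb_lt; auto. now apply Rmin_glb_lt. }
  assert (A1 := Rmin_l (Rmin d d') e). assert (A2 := Rmin_r (Rmin d d') e).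
  assert (A3 := Rmin_l d d'). assert (A4 := Rmin_r d d').
  exists z. split; [apply H'; lra|]. split; auto. split; [lra|apply E; lra].
Qed.

Lemma holo_eq_nbhd f g d : 0 < d -> holo 1 f -> holo 1 g -> (forall z, Cmod z < d -> f z = g z) ->
  forall z, disc z -> f z = g z.
Proof.
  intros Hd Hf Hg E z Hz.
  assert (H : (f z - g z)%C = 0%C).
  { apply (holo_zero_nbhd (fun z => f z - g z)%C 0 d); auto using disc_0.
    - intros w Hw. apply Dn_minus; auto.
    - intros w Hw. rewrite E; [ring|]. now replace w with (w - 0)%C by ring. }
  replace (f z) with (f z - g z + g z)%C by ring. rewrite H. ring.
Qed.

(* If [h] attains the bound 1 at the origin, apply Schwarz's lemma to
   [t (h - h 0) / (1 - t^2 h / h 0)] and let [t -> 1]. *)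
Lemma strong_max_0 h : holo 1 h -> (forall z, disc z -> Cmod (h z) <= 1) -> Cmod (h 0%C) = 1 ->
  forall z, disc z -> h z = h 0%C.
Proof.
  intros Hh H1 H0.
  assert (N0 : h 0%C <> 0%C) by (intros E; rewrite E, Cmod_0 in H0; lra).
  set (k := fun z => (h z / h 0)%C).
  assert (Hk : holo 1 k) by (intros z Hz; apply Dn_div; auto; apply Dn_const).
  assert (K1 : forall z, disc z -> Cmod (k z) <= 1).
  { intros z Hz. unfold k. rewrite Cmod_div, H0 by auto. specialize (H1 z Hz). lra. }
  assert (K0 : k 0%C = 1%C) by (unfold k; field; auto).
  assert (X : forall z, disc z -> k z = 1%C).
  { intros z Hz. apply NNPP. intros N.
    set (d := Cmod (k z - 1)). assert (Pd : 0 < d) by (apply Cmod_gt_0; now apply Csub_neq_0).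
    (* Schwarz's lemma yields [t d <= |z| (d + 1 - t^2)]. For [t] close to 1 this is impossible when
       [d > 0], because [|z| < 1]. *)
    assert (T : forall t, 0 < t < 1 -> (t - Cmod z) * d <= 2 * (1 - t)).
    { intros t Ht.
      assert (Dt : disc t) by (unfold disc; rewrite Cmod_R, Rabs_right; lra).
      assert (Dk : forall w, disc w -> disc (t * k w)).
      { intros w Hw. unfold disc. rewrite Cmod_mult, Cmod_R, Rabs_right by lra. specialize (K1 w Hw). nra. }
      assert (S : Cmod (tau t (t * k z)) <= Cmod z).
      { apply (schwarz (fun w => tau t (t * k w))); auto.
        - apply (holo_comp 1 (tau t)); [intros w Hw; now apply tau_Dn|].
          intros w Hw. split; auto. apply Dn_mult; [apply Dn_const|now apply Hk].
        - rewrite K0. replace (t * 1)%C with (RtoC t) by ring. apply tau_self.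
        - intros w Hw. left. now apply tau_disc; auto. }
      assert (Nd := tau_den t (t * k z) Dt (Dk z Hz)).
      unfold tau in S. rewrite Cmod_div in S by auto.
      assert (P : 0 < Cmod (1 - Cconj t * (t * k z))) by (now apply Cmod_gt_0).
      assert (S' : Cmod (t - t * k z) <= Cmod z * Cmod (1 - Cconj t * (t * k z))).
      { apply Rmult_le_reg_r with (/ Cmod (1 - Cconj t * (t * k z))); [now apply Rinv_0_lt_compat|].
        rewrite Rmult_assoc, Rinv_r, Rmult_1_r by lra. exact S. }
      replace (t - t * k z)%C with (t * - (k z - 1))%C in S' by ring.
      rewrite Cmod_mult, Cmod_opp, Cmod_R, Rabs_right in S' by lra. fold d in S'.
      assert (B : Cmod (1 - Cconj t * (t * k z)) <= d + (1 - t * t)).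
      { replace (1 - Cconj t * (t * k z))%C with (- (k z - 1) + (1 - t * t)%R * k z)%C.
        - eapply Rle_trans; [apply Cmod_triangle|]. rewrite Cmod_opp. fold d.
          rewrite Cmod_mult, Cmod_R, Rabs_right by nra. specialize (K1 z Hz).
          assert (0 <= 1 - t * t) by nra. nra.
        - replace (Cconj t) with (RtoC t) by (apply injective_projections; simpl; ring).
          rewrite RtoC_minus, RtoC_mult. ring. }
      assert (Qz := Cmod_ge_0 z). unfold disc in Hz.
      assert (Cmod z * Cmod (1 - Cconj t * (t * k z)) <= Cmod z * (d + (1 - t * t))) by (apply Rmult_le_compat_l; lra).
      assert (Cmod z * (1 - t * t) <= 1 * (1 - t * t)) by (apply Rmult_le_compat_r; nra).
      assert (1 - t * t <= 2 * (1 - t)) by nra. lra. }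
    unfold disc in Hz. assert (Qz := Cmod_ge_0 z).
    (* Half of the threshold for [1 - t] below which [T] fails. *)
    set (s := (1 - Cmod z) * d / (2 * (2 + d))).
    assert (E : s * (2 * (2 + d)) = (1 - Cmod z) * d) by (unfold s; field; lra).
    assert (P : 0 < s) by (unfold s; apply Rdiv_lt_0_compat; [nra|lra]).
    assert (L : s < 1) by nra.
    specialize (T (1 - s) ltac:(lra)). nra. }
  intros z Hz. specialize (X z Hz). unfold k in X.
  replace (h z) with (h z / h 0 * h 0)%C by (field; auto). rewrite X. ring.
Qed.

Lemma strong_max h w : holo 1 h -> (forall z, disc z -> Cmod (h z) <= 1) -> disc w -> 1 <= Cmod (h w) ->
  forall z, disc z -> h z = h w.
Proof.
  intros Hh H1 Dw Hw z Hz.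
  assert (E := strong_max_0 (fun z => h (tau w z)) (holo_tau 1 h w Dw Hh)).
  rewrite <- (tau_invol w z) by auto. simpl in E. rewrite tau_0 in E. apply E.
  - intros v Hv. apply H1. now apply tau_disc.
  - specialize (H1 w Dw). lra.
  - now apply tau_disc.
Qed.

(** * The exponential and logarithms *)

Definition cexp (z : C) : C := (exp (fst z) * cos (snd z), exp (fst z) * sin (snd z)).

Lemma cexp_plus a b : cexp (a + b) = (cexp a * cexp b)%C.
Proof.
  unfold cexp. simpl. rewrite exp_plus, cos_plus, sin_plus. apply injective_projections; simpl; ring.
Qed.

Lemma cexp_0 : cexp 0 = 1%C.
Proof. unfold cexp. simpl. rewrite exp_0, cos_0, sin_0. apply injective_projections; simpl; ring. Qed.

Lemma cexp_neq_0 z : cexp z <> 0%C.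
Proof.
  intros E. assert (H := cexp_plus z (- z)). replace (z + - z)%C with (RtoC 0) in H by ring.
  rewrite E, cexp_0 in H. rewrite Cmult_0_l in H. apply RtoC_inj in H. lra.
Qed.

Lemma cexp_pow z n : (cexp z ^ n)%C = cexp (INR n * z).
Proof.
  induction n.
  - simpl. replace (0 * z)%C with (RtoC 0) by ring. now rewrite cexp_0.
  - rewrite Cpow_S, IHn, <- cexp_plus, S_INR, RtoC_plus. f_equal. ring.
Qed.

Lemma derivable_at_0 f l : derivable_pt_lim f 0 l -> forall eps, 0 < eps ->
  exists d, 0 < d /\ forall x, Rabs x < d -> Rabs (f x - f 0 - l * x) <= eps * Rabs x.
Proof.
  intros H e He. destruct (H e He) as [[d Hd] H1]. exists d. split; auto. intros x Hx. simpl in H1.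
  destruct (Req_dec x 0) as [->|N].
  - replace (f 0 - f 0 - l * 0) with 0 by ring. rewrite Rabs_R0. lra.
  - specialize (H1 x N Hx). rewrite Rplus_0_l in H1.
    replace (f x - f 0 - l * x) with (((f x - f 0) / x - l) * x) by (field; auto).
    rewrite Rabs_mult. apply Rmult_le_compat_r; [apply Rabs_pos|lra].
Qed.

Lemma cexp_near_0 eps : 0 < eps -> exists d, 0 < d /\ forall z, Cmod z < d ->
  Cmod (cexp z - 1 - z) <= eps * Cmod z.
Proof.
  (* The real part of the remainder will be at most [3 * e * |z|] and the imaginary part at most
     [5 * e * |z|]; [e <= 1] bounds factors such as [1 + x] by 2. *)
  intros He. set (e := Rmin (eps / 9) 1).
  assert (E0 : 0 < e) by (apply Rmin_glb_lt; lra).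
  assert (E1 : e <= eps / 9) by apply Rmin_l. assert (E2 : e <= 1) by apply Rmin_r.
  destruct (derivable_at_0 exp 1) with (eps := e) as [d1 [Hd1 H1]]; auto.
  { assert (H := derivable_pt_lim_exp 0). now rewrite exp_0 in H. }
  destruct (derivable_at_0 sin 1) with (eps := e) as [d2 [Hd2 H2]]; auto.
  { assert (H := derivable_pt_lim_sin 0). now rewrite cos_0 in H. }
  destruct (derivable_at_0 cos 0) with (eps := e) as [d3 [Hd3 H3]]; auto.
  { assert (H := derivable_pt_lim_cos 0). now rewrite sin_0, Ropp_0 in H. }
  set (d := Rmin (Rmin d1 d2) (Rmin d3 e)).
  exists d. split; [apply Rmin_glb_lt; apply Rmin_glb_lt; auto|]. intros z Hz.
  assert (D1 := Rmin_l (Rmin d1 d2) (Rmin d3 e)). assert (D2 := Rmin_r (Rmin d1 d2) (Rmin d3 e)).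
  assert (D3 := Rmin_l d1 d2). assert (D4 := Rmin_r d1 d2). assert (D5 := Rmin_l d3 e). assert (D6 := Rmin_r d3 e).
  fold d in D1, D2.
  assert (M := Rmax_Cmod z). assert (M1 := Rmax_l (Rabs (fst z)) (Rabs (snd z))).
  assert (M2 := Rmax_r (Rabs (fst z)) (Rabs (snd z))).
  destruct z as [x y]. simpl fst in *. simpl snd in *. set (m := Cmod (x, y)) in *.
  specialize (H1 x ltac:(lra)). specialize (H2 y ltac:(lra)). specialize (H3 y ltac:(lra)).
  rewrite exp_0, Rmult_1_l in H1. rewrite sin_0, Rmult_1_l, Rminus_0_r in H2.
  rewrite cos_0, Rmult_0_l, Rminus_0_r in H3.
  assert (Px := Rabs_pos x). assert (Py := Rabs_pos y).
  eapply Rle_trans; [apply Cmod_le_parts|]. unfold cexp. simpl.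
  replace (exp x * cos y + - (1) + - x) with ((exp x - 1 - x) * cos y + (1 + x) * (cos y - 1)) by ring.
  replace (exp x * sin y + - 0 + - y) with ((exp x - 1 - x + x) * ((sin y - y) + y) + (sin y - y)) by ring.
  assert (Cy : Rabs (cos y) <= 1) by (apply Rabs_le_between; apply COS_bound).
  assert (X1 : Rabs (1 + x) <= 2).
  { eapply Rle_trans; [apply Rabs_triang|]. rewrite Rabs_R1. lra. }
  assert (A : Rabs ((exp x - 1 - x) * cos y + (1 + x) * (cos y - 1)) <= 3 * e * m).
  { eapply Rle_trans; [apply Rabs_triang|]. rewrite !Rabs_mult.
    assert (Rabs (exp x - 1 - x) * Rabs (cos y) <= e * Rabs x * 1) by (apply Rmult_le_compat; auto using Rabs_pos).
    assert (Rabs (1 + x) * Rabs (cos y - 1) <= 2 * (e * Rabs y)) by (apply Rmult_le_compat; auto using Rabs_pos).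
    assert (e * Rabs x <= e * m) by (apply Rmult_le_compat_l; lra).
    assert (e * Rabs y <= e * m) by (apply Rmult_le_compat_l; lra). lra. }
  assert (B : Rabs ((exp x - 1 - x + x) * ((sin y - y) + y) + (sin y - y)) <= 5 * e * m).
  { eapply Rle_trans; [apply Rabs_triang|]. rewrite !Rabs_mult.
    assert (B1 : Rabs (exp x - 1 - x + x) <= 2 * Rabs x).
    { eapply Rle_trans; [apply Rabs_triang|]. nra. }
    assert (B2 : Rabs (sin y - y + y) <= 2 * Rabs y).
    { eapply Rle_trans; [apply Rabs_triang|]. nra. }
    assert (Rabs (exp x - 1 - x + x) * Rabs (sin y - y + y) <= (2 * Rabs x) * (2 * Rabs y))
      by (apply Rmult_le_compat; auto using Rabs_pos).
    assert (Rabs x * Rabs y <= e * m) by (apply Rmult_le_compat; lra).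
    assert (e * Rabs y <= e * m) by (apply Rmult_le_compat_l; lra). lra. }
  assert (0 <= m) by lra.
  assert (8 * e * m <= eps * m) by (apply Rmult_le_compat_r; lra). lra.
Qed.

(** The functional equation reduces the derivative to the one at 0. *)
Lemma isd_cexp z : isd cexp z (cexp z).
Proof.
  assert (H0 : isd cexp 0 1%C).
  { exists (fun w : C => if excluded_middle_informative (w = 0%C) then RtoC 1 else ((cexp w - 1) / w)%C).
    split; [|now destruct (excluded_middle_informative (RtoC 0 = RtoC 0))]. split.
    - intros w. rewrite cexp_0. destruct (excluded_middle_informative _) as [->|N]; [rewrite cexp_0; ring|field; auto].
    - intros e He. destruct (cexp_near_0 (e / 2)) as [d [Hd H]]; [lra|]. exists d. split; auto.
      intros w Hw. replace (w - 0)%C with w in Hw by ring.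
      destruct (excluded_middle_informative (RtoC 0 = RtoC 0)) as [_|]; [|congruence].
      destruct (excluded_middle_informative _) as [->|N]; [now rewrite Cmod_sub_self|].
      assert (P : 0 < Cmod w) by (now apply Cmod_gt_0). specialize (H w Hw).
      replace ((cexp w - 1) / w - 1)%C with ((cexp w - 1 - w) / w)%C by (field; auto).
      rewrite Cmod_div by auto. apply Rle_lt_trans with (e / 2); [|lra].
      apply Rmult_le_reg_r with (Cmod w); auto. unfold Rdiv at 1. rewrite Rmult_assoc, Rinv_l; lra. }
  assert (Y : isd (fun w => cexp z * cexp (w + - z))%C z (0 * cexp (z + - z) + cexp z * ((1 + 0) * 1))%C).
  { apply (isd_mult (fun _ => cexp z) (fun w => cexp (w + - z)) z 0%C ((1 + 0) * 1)%C); [apply isd_const|].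
    apply (isd_comp cexp (fun w => w + - z)%C z (1 + 0)%C 1%C).
    - apply isd_plus; [apply isd_id|apply isd_const].
    - replace (z + - z)%C with (RtoC 0) by ring. exact H0. }
  replace (0 * cexp (z + - z) + cexp z * ((1 + 0) * 1))%C with (cexp z) in Y by ring.
  refine (isd_local _ cexp z _ 1 ltac:(lra) _ Y). intros w _. rewrite <- cexp_plus. f_equal. ring.
Qed.

Lemma Dn_cexp z : Dn 1 cexp z.
Proof. apply (isd_Dn1 cexp z (cexp z)), isd_cexp. Qed.

(** Real and imaginary parts have zero derivative along the segment from 0 to [z]. In [X], [pr]
    stands for either projection, of which only the Lipschitz bound is used. *)
Lemma isd_zero_const (f : C -> C) : (forall z, disc z -> isd f z 0%C) -> forall z, disc z -> f z = f 0%C.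
Proof.
  intros H z Hz.
  assert (X : forall pr : C -> R, (forall x y, Rabs (pr x - pr y) <= Cmod (x - y)) -> pr (f 0%C) = pr (f z)).
  { intros pr Hpr.
    replace (f 0%C) with (f (seg 0 z 0)) by (f_equal; unfold seg; ring).
    replace (f z) with (f (seg 0 z 1)) by (f_equal; unfold seg; ring).
    apply (eq_is_derive (V := R_NormedModule) (fun t => pr (f (seg 0 z t))) 0 1); [|lra].
    intros t Ht. apply is_derive_Reals. intros e He.
    destruct (H (seg 0 z t) (disc_seg 0 z t disc_0 Hz Ht)) as [q [[Sq Cq] Q0]].
    destruct (Cq e He) as [d [Hd H1]]. exists (mkposreal d Hd). intros h Nh Hh. simpl in Hh.
    assert (Ph : 0 < Rabs h) by (now apply Rabs_pos_lt). unfold disc in Hz.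
    assert (Ew : (seg 0 z (t + h) - seg 0 z t)%C = (h * z)%C) by (unfold seg; rewrite RtoC_plus; ring).
    specialize (H1 (seg 0 z (t + h))). rewrite Ew, Cmod_mult, Cmod_R, Q0 in H1. specialize (H1 ltac:(nra)).
    replace (q (seg 0 z (t + h)) - 0)%C with (q (seg 0 z (t + h))) in H1 by ring.
    change zero with 0. rewrite Rminus_0_r. unfold Rdiv. rewrite Rabs_mult, Rabs_inv.
    apply Rmult_lt_reg_r with (Rabs h); auto. rewrite Rmult_assoc, Rinv_l, Rmult_1_r by lra.
    eapply Rle_lt_trans; [apply Hpr|]. rewrite (Sq (seg 0 z (t + h))), Ew.
    replace (f (seg 0 z t) + h * z * q (seg 0 z (t + h)) - f (seg 0 z t))%C with (h * (z * q (seg 0 z (t + h))))%C by ring.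
    rewrite !Cmod_mult, Cmod_R, (Rmult_comm e). apply Rmult_lt_compat_l; auto.
    assert (Qq := Cmod_ge_0 (q (seg 0 z (t + h)))). nra. }
  symmetry. apply injective_projections; apply X; intros x y.
  - apply (re_le_Cmod (x - y)).
  - eapply Rle_trans; [|apply Rmax_Cmod]. apply (Rmax_r (Rabs (fst (x - y)%C)) (Rabs (snd (x - y)%C))).
Qed.

Lemma isd_inv (f : C -> C) (z l : C) : f z <> 0%C -> isd f z l -> isd (fun w => / f w)%C z (- l / (f z * f z))%C.
Proof.
  intros N H. assert (D := Dn_inv 1 f z N (isd_Dn1 f z l H)). destruct (Dn1_isd _ _ D) as [m Hm].
  replace (- l / (f z * f z))%C with m; auto.
  assert (Y := isd_mult _ _ z _ _ H Hm).
  destruct (ccont_neq_0 f z (Dn_le 0 1 f z ltac:(lia) (isd_Dn1 f z l H)) N) as [d [Hd Hd1]].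
  assert (Y' : isd (fun _ => 1%C) z (l * / f z + f z * m)%C).
  { refine (isd_local _ _ z _ d Hd _ Y). intros w Hw. field. auto. }
  assert (E := isd_unique _ _ _ _ Y' (isd_const 1 z)).
  replace m with ((l * / f z + f z * m - l * / f z) / f z)%C by (field; auto). rewrite E. field. auto.
Qed.

Lemma holo_primitive f : holo 1 f -> exists F : C -> C, F 0%C = 0%C /\ forall z, disc z -> isd F z (f z).
Proof.
  intros Hf. destruct (hol_primitive f Hf) as [F HF].
  exists (fun z : C => F z - F 0)%C. split; [ring|]. intros z Hz.
  replace (f z) with (f z + 0)%C by ring. apply (isd_plus F (fun _ => - F 0)%C); [|apply isd_const].
  destruct (HF z Hz) as [q [Hq [Dq Eq]]]. destruct (disc_open z Hz) as [d [Hd Hd1]].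
  refine (isd_local (fun w => (F z + (w - z) * q w)%C) F z (f z) d Hd _ _).
  - intros w Hw. symmetry. auto.
  - exists q. split; auto. split; [intros; ring|]. apply (Dn_le 0 1); auto.
Qed.

(** [L] is the primitive of [m' / m] vanishing at 0; then [cexp L / m] has zero derivative. *)
Lemma holo_log (m : C -> C) : holo 1 m -> (forall z, disc z -> m z <> 0%C) ->
  exists L : C -> C, holo 1 L /\ L 0%C = 0%C /\ forall z, disc z -> m z = (m 0 * cexp (L z))%C.
Proof.
  intros Hm Nm. destruct (holo_deriv m Hm) as [m' [Hm' Cm']].
  destruct (holo_primitive (fun z => m' z / m z)%C) as [L [L0 HL]].
  { intros z Hz. apply Dn_div; auto. }
  assert (HLh : holo 1 L) by (intros z Hz; apply (isd_Dn1 L z (m' z / m z)%C), HL; auto).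
  exists L. split; [auto|]. split; auto.
  assert (X : forall z, disc z -> (cexp (L z) * / m z)%C = (cexp (L 0%C) * / m 0)%C).
  { apply isd_zero_const. intros z Hz.
    replace (RtoC 0) with (m' z / m z * cexp (L z) * / m z + cexp (L z) * (- m' z / (m z * m z)))%C by (field; auto).
    apply (isd_mult (fun z => cexp (L z)) (fun z => / m z)%C).
    - apply (isd_comp cexp L); [now apply HL|apply isd_cexp].
    - apply isd_inv; auto. }
  intros z Hz. specialize (X z Hz). rewrite L0, cexp_0 in X.
  assert (N0 := Nm 0%C disc_0).
  replace (cexp (L z)) with (cexp (L z) * / m z * m z)%C by (field; auto). rewrite X. field. auto.
Qed.

(** For [n >= 2] it refutes the injectivity of [c * z ^ n]. *)
Lemma root_of_unity n : (2 <= n)%nat -> exists w, (w ^ n)%C = 1%C /\ w <> 1%C /\ Cmod w = 1.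
Proof.
  intros Hn. assert (P : 2 <= INR n) by (apply (le_INR 2); auto). assert (Pi := PI_RGT_0).
  set (t := 2 * PI / INR n). exists (cexp (0, t)). split; [|split].
  - rewrite cexp_pow. replace (INR n * ((0, t) : C))%C with ((0, 2 * PI) : C).
    + unfold cexp. simpl. rewrite exp_0, cos_2PI, sin_2PI. apply injective_projections; simpl; ring.
    + apply injective_projections; simpl; unfold t; field; lra.
  - unfold cexp. simpl. rewrite exp_0. intros E. apply (f_equal fst) in E. simpl in E.
    rewrite Rmult_1_l in E. replace t with (2 * (t / 2)) in E by field. rewrite cos_2a_sin in E.
    assert (H : 0 < sin (t / 2)).
    { apply sin_gt_0; unfold t.
      - replace (2 * PI / INR n / 2) with (PI / INR n) by (field; lra). apply Rdiv_lt_0_compat; lra.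
      - replace (2 * PI / INR n / 2) with (PI * / INR n) by (field; lra).
        assert (/ INR n < 1) by (rewrite <- Rinv_1; apply Rinv_lt_contravar; lra). nra. }
    nra.
  - unfold cexp. simpl. rewrite exp_0. unfold Cmod; simpl.
    replace (1 * cos t * (1 * cos t * 1) + 1 * sin t * (1 * sin t * 1)) with 1; [apply sqrt_1|].
    assert (S := sin2_cos2 t). unfold Rsqr in S. lra.
Qed.

Lemma csqrt_exists (w : C) : exists s, (s * s)%C = w.
Proof.
  destruct w as [x y]. set (m := Cmod (x, y)).
  assert (Q : Rabs x <= m) by apply (re_le_Cmod (x, y)). apply Rabs_le_between in Q.
  assert (E : m ^ 2 = x ^ 2 + y ^ 2) by apply (Cmod2_alt (x, y)).
  set (a := sqrt ((m + x) / 2)). set (b := sqrt ((m - x) / 2)).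
  assert (Ha : a * a = (m + x) / 2) by (apply sqrt_sqrt; lra).
  assert (Hb : b * b = (m - x) / 2) by (apply sqrt_sqrt; lra).
  assert (Pa : 0 <= a) by apply sqrt_pos. assert (Pb : 0 <= b) by apply sqrt_pos.
  assert (AB : a * b = Rabs y / 2).
  { apply Rsqr_inj; [nra|assert (T := Rabs_pos y); lra|]. unfold Rsqr.
    replace (a * b * (a * b)) with ((a * a) * (b * b)) by ring. rewrite Ha, Hb.
    replace (Rabs y / 2 * (Rabs y / 2)) with (Rabs y * Rabs y / 4) by field.
    rewrite <- Rabs_mult, Rabs_right by nra. nra. }
  destruct (Rle_dec 0 y) as [Hy|Hy].
  - exists (a, b). apply injective_projections; simpl; [lra|]. rewrite Rabs_right in AB; lra.
  - exists (a, - b). apply injective_projections; simpl; [lra|]. rewrite Rabs_left in AB; lra.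
Qed.

(** * Automorphisms of the disc *)

Lemma circle_closed (z : C) (r : R) : (forall eps, 0 < eps -> exists y, Cmod y = r /\ Cmod (y - z) < eps) -> Cmod z = r.
Proof.
  intros H. apply Rle_antisym.
  - apply Cmod_le_closed. intros e He. destruct (H e He) as [y [Hy1 Hy2]]. exists y. split; auto; lra.
  - apply le_epsilon. intros e He. destruct (H e He) as [y [Hy1 Hy2]].
    assert (T := Cmod_rev_triangle y z). lra.
Qed.

(* Minimum principle for [phi - w] on the disc of radius 1/2: if [w] is close to [phi 0]
   and is not a value there, [1 / (phi - w)] violates the maximum principle. *)
Lemma open_at_0 (phi : C -> C) : holo 1 phi ->
  (forall z w, disc z -> disc w -> phi z = phi w -> z = w) ->
  exists d, 0 < d /\ forall w, Cmod (w - phi 0%C) < d -> exists z, Cmod z <= / 2 /\ phi z = w.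
Proof.
  intros Hp Inj.
  assert (Cp : forall z, disc z -> ccont phi z) by (intros; apply (Dn_le 0 1); auto).
  set (f := fun z => (phi z - phi 0)%C).
  destruct (max_attained_on (fun z => Cmod z = / 2) (fun z => - Cmod (f z)) (/ 2)) as [v [Hv Mv]]; [lra|intros; lra| | | |].
  - intros z. apply circle_closed.
  - exists (RtoC (/ 2)). rewrite Cmod_R, Rabs_right; lra.
  - intros z Hz e He.
    assert (Cf : ccont f z) by (apply (Dn_minus 0); [apply Cp; unfold disc; lra|apply Dn_const]).
    destruct (ccont_Cmod f z Cf e He) as [d [Hd H1]]. exists d. split; auto. intros w Hw.
    replace (- Cmod (f w) - - Cmod (f z)) with (- (Cmod (f w) - Cmod (f z))) by ring. rewrite Rabs_Ropp. auto.
  - assert (Nv : f v <> 0%C).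
    { unfold f. apply Csub_neq_0. intros E. apply Inj in E; [|unfold disc; lra|apply disc_0].
      rewrite E, Cmod_0 in Hv. lra. }
    set (m := Cmod (f v)). assert (Pm : 0 < m) by (now apply Cmod_gt_0).
    exists (m / 2). split; [lra|]. intros w Hw. apply NNPP. intros N.
    assert (Nw : forall z, Cmod z <= / 2 -> (phi z - w)%C <> 0%C).
    { intros z Hz. apply Csub_neq_0. intros E. apply N. now exists z. }
    assert (B : Cmod (/ (phi 0 - w)) <= 2 / m).
    { apply (max_principle nil (fun z => / (phi z - w))%C (/ 2)).
      - lra.
      - intros z Hz. apply (Dn_inv 0); auto. apply (Dn_minus 0); [apply Cp; unfold disc; lra|apply Dn_const].
      - intros z Hz _. apply (Dn_inv 2); [apply Nw; lra|].
        apply (Dn_minus 2); [apply holo1_holo2; auto; unfold disc; lra|apply Dn_const].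
      - intros z Hz. rewrite Cmod_inv by (apply Nw; lra).
        replace (2 / m) with (/ (m / 2)) by (field; lra). apply Rinv_le_contravar; [lra|].
        specialize (Mv z Hz). fold m in Mv. unfold f in Mv at 1.
        assert (T := Cmod_sub_triangle (phi z) w (phi 0%C)). lra.
      - rewrite Cmod_0. lra. }
    rewrite Cmod_inv in B by (apply Nw; rewrite Cmod_0; lra).
    rewrite Cmod_sub_sym in Hw.
    assert (P : 0 < Cmod (phi 0 - w)) by (apply Cmod_gt_0, Nw; rewrite Cmod_0; lra).
    assert (/ (m / 2) < / Cmod (phi 0 - w)) by (apply Rinv_lt_contravar; [apply Rmult_lt_0_compat; lra|auto]).
    replace (/ (m / 2)) with (2 / m) in H by (field; lra). lra.
Qed.

Section Bijective.
Variable phi : C -> C.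
Hypothesis Hs : hol_selfmap phi.
Hypothesis Hb : bijective_on_D phi.

Lemma selfmap_holo : holo 1 phi.
Proof. intros z Hz. apply cdiff_Dn1. now apply Hs. Qed.

(** [open_at_0] for [phi] composed with [tau z0]. The maximum of [|tau z0|] on the disc of radius
    1/2 serves as [rho]: the preimages found stay away from the circle. *)
Lemma open_at z0 : disc z0 -> exists d rho, 0 < d /\ rho < 1 /\
  forall w, Cmod (w - phi z0) < d -> exists z, Cmod z <= rho /\ phi z = w.
Proof.
  intros D0. destruct (open_at_0 (fun z => phi (tau z0 z))) as [d [Hd H]].
  - apply holo_tau; auto. apply selfmap_holo.
  - intros z w Hz Hw E. apply Hb in E; auto using tau_disc.
    rewrite <- (tau_invol z0 z), E by auto. now apply tau_invol.
  - destruct (Cmod_max_attained (tau z0) (/ 2)) as [v [Hv Mv]]; [lra| |].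
    { intros z Hz. apply (Dn_le 0 1); auto. apply tau_Dn; auto. unfold disc; lra. }
    exists d, (Cmod (tau z0 v)). split; auto. split.
    { apply tau_disc; auto. unfold disc; lra. }
    intros w Hw. rewrite tau_0 in H. destruct (H w Hw) as [z [Hz E]]. exists (tau z0 z). split; auto.
Qed.

(** Otherwise values taken near the circle would accumulate at some [phi z0]. By [open_at], all
    values near [phi z0] are also taken in a smaller disc, against injectivity. *)
Lemma bijective_proper rho : 0 <= rho < 1 -> exists r, r < 1 /\ forall z, disc z -> Cmod (phi z) <= rho -> Cmod z <= r.
Proof.
  intros Hrho. apply NNPP. intros N.
  (* The concentrating property: values in [A] are taken arbitrarily close to the circle. *)
  destruct (concentration (fun A => forall r, r < 1 -> exists z, disc z /\ r < Cmod z /\ A (phi z))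
     (fun w => Cmod w <= rho) rho) as [w Hw]; try tauto.
  - intros A B AB H r Hr. destruct (H r Hr) as [z [Hz1 [Hz2 Hz3]]]. exists z. auto.
  - intros A B H. apply NNPP. intros NN. apply not_or_and in NN. destruct NN as [NA NB].
    apply not_all_ex_not in NA, NB. destruct NA as [a NA], NB as [b NB].
    apply imply_to_and in NA, NB. destruct NA as [Ha NA], NB as [Hb' NB].
    destruct (H (Rmax a b) ltac:(now apply Rmax_lub_lt)) as [z [Hz1 [Hz2 [Hz3|Hz3]]]].
    + apply NA. exists z. split; auto. split; auto. eapply Rle_lt_trans; [apply Rmax_l|exact Hz2].
    + apply NB. exists z. split; auto. split; auto. eapply Rle_lt_trans; [apply Rmax_r|exact Hz2].
  - intros r Hr. apply NNPP. intros NN. apply N. exists r. split; auto. intros z Hz Hz'.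
    apply Rnot_lt_le. intros L. apply NN. now exists z.
  - assert (Dw : disc w).
    { unfold disc. apply Rle_lt_trans with rho; [|lra]. apply Cmod_le_closed. intros e He.
      destruct (Hw e He 0) as [z [_ [_ [A B]]]]; [lra|]. now exists (phi z). }
    destruct (proj2 Hb w Dw) as [z0 [D0 E0]]. subst w.
    destruct (open_at z0 D0) as [d [r [Hd [Hr H]]]].
    destruct (Hw d Hd r Hr) as [z [Hz1 [Hz2 [_ Hz3]]]].
    destruct (H _ Hz3) as [v [Hv Ev]]. apply (proj1 Hb) in Ev; auto; [|unfold disc; lra]. subst v. lra.
Qed.

(** Write [phi z = z ^ (n+1) * g z] with [g] zero-free. Schwarz gives [|g| <= 1], and properness
    gives the same for [1 / g], so [g] is a unimodular constant; injectivity then forces [n = 0]. *)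
Lemma bijective_fix_0 : phi 0%C = 0%C -> exists c, Cmod c = 1 /\ forall z, disc z -> phi z = (c * z)%C.
Proof.
  intros P0.
  assert (Hh := selfmap_holo).
  assert (D2 : disc (/ 2)%R) by (unfold disc; rewrite Cmod_R, Rabs_right; lra).
  assert (Nz : forall z, disc z -> z <> 0%C -> phi z <> 0%C).
  { intros z Hz N E. apply N. apply (proj1 Hb); auto using disc_0. congruence. }
  destruct (holo_order phi Hh) as [n [g [Hg [G0 E]]]].
  { exists (RtoC (/ 2)). split; auto. apply Nz; auto. intros X. apply RtoC_inj in X. lra. }
  destruct n as [|n].
  { exfalso. apply G0. specialize (E 0%C). rewrite P0 in E. simpl in E. rewrite Cmult_1_l in E. auto. }
  assert (Gn : forall z, disc z -> g z <> 0%C).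
  { intros z Hz. destruct (classic (z = 0%C)) as [->|N]; auto. intros X. apply (Nz z Hz N). rewrite E, X. ring. }
  assert (G1 : forall z, disc z -> Cmod (g z) <= 1).
  { apply (schwarz_order (S n) phi g 1); auto. intros z Hz. left. now apply Hs. }
  assert (G2 : forall z, disc z -> 1 <= Cmod (g z)).
  { intros z Hz. apply le_epsilon. intros e He.
    set (rho := Rmax (1 - e) (/ 2)).
    destruct (Rle_dec 1 e) as [L|L]; [assert (Q := Cmod_ge_0 (g z)); lra|].
    assert (R1 := Rmax_l (1 - e) (/ 2)). assert (R2 := Rmax_r (1 - e) (/ 2)).
    assert (R3 : rho < 1) by (apply Rmax_lub_lt; lra). fold rho in R1, R2.
    destruct (bijective_proper rho) as [r [Hr Hr1]]; [lra|].
    (* A circle enclosing [z] and outside radius [r], so that [|phi| > rho] on it. *)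
    set (s := (1 + Rmax r (Cmod z)) / 2).
    assert (S1 := Rmax_l r (Cmod z)). assert (S2 := Rmax_r r (Cmod z)).
    assert (S3 : Rmax r (Cmod z) < 1) by (apply Rmax_lub_lt; auto).
    assert (Qz := Cmod_ge_0 z).
    assert (B : Cmod (/ g z) <= / rho).
    { apply (max_principle_holo (fun z => / g z)%C s); [|unfold s; lra| |unfold s; lra].
      - intros v Hv. apply Dn_inv; auto.
      - intros v Hv. assert (Dv : disc v) by (unfold disc; unfold s in Hv; lra).
        rewrite Cmod_inv by auto. apply Rinv_le_contravar; [lra|].
        assert (F : rho < Cmod (phi v)).
        { apply Rnot_le_lt. intros F. specialize (Hr1 v Dv F). unfold s in Hv. lra. }
        rewrite E, Cmod_mult, Cmod_pow in F.
        assert (Cmod v ^ S n <= 1) by (rewrite <- (pow1 (S n)); apply pow_incr; split; [apply Cmod_ge_0|unfold disc in Dv; lra]).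
        assert (Q := Cmod_ge_0 (g v)). nra. }
    rewrite Cmod_inv in B by auto. assert (P : 0 < Cmod (g z)) by (apply Cmod_gt_0; auto).
    apply Rinv_le_contravar in B; [|now apply Rinv_0_lt_compat]. rewrite !Rinv_inv in B. lra. }
  assert (Gc := strong_max_0 g Hg G1 (Rle_antisym _ _ (G1 _ disc_0) (G2 _ disc_0))).
  exists (g 0%C). split; [apply Rle_antisym; auto using disc_0|].
  destruct n as [|n].
  - intros z Hz. rewrite E, (Gc z Hz). simpl. ring.
  (* Here [phi] takes the same value at [1/2] and at [w/2]. *)
  - exfalso. destruct (root_of_unity (S (S n)) ltac:(lia)) as [w [W1 [W2 W3]]].
    assert (Dw : disc ((/ 2)%R * w)%C) by (unfold disc; rewrite Cmod_mult, W3, Cmod_R, Rabs_right; lra).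
    apply W2. assert (X : ((/ 2)%R * w)%C = RtoC (/ 2)).
    { apply (proj1 Hb); auto. rewrite !E, (Gc _ Dw), (Gc _ D2), Cpow_mult_l, W1. ring. }
    rewrite RtoC_inv in X by lra. transitivity (2 * (/ 2 * w))%C; [field|rewrite X; field].
Qed.
End Bijective.

Lemma conj_tau_bijective phi a b : hol_selfmap phi -> bijective_on_D phi -> disc a -> disc b ->
  hol_selfmap (fun z => tau b (phi (tau a z))) /\ bijective_on_D (fun z => tau b (phi (tau a z))).
Proof.
  intros Hs Hb Da Db. split; [|split].
  - intros z Hz. assert (Dt := tau_disc a z Da Hz). destruct (Hs _ Dt) as [Hd1 Hd2]. split.
    + apply cdiff_Dn1. apply (Dn_comp 1 (tau b)); [|now apply tau_Dn].
      apply (Dn_comp 1 phi); [now apply tau_Dn|]. now apply cdiff_Dn1.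
    + now apply tau_disc.
  - intros z w Hz Hw E. assert (Dz := tau_disc a z Da Hz). assert (Dw := tau_disc a w Da Hw).
    apply (f_equal (tau b)) in E. rewrite !tau_invol in E by (auto; now apply Hs).
    apply Hb in E; auto. apply (f_equal (tau a)) in E. now rewrite !tau_invol in E by auto.
  - intros w Hw. destruct (proj2 Hb (tau b w) (tau_disc b w Db Hw)) as [v [Dv Ev]].
    exists (tau a v). split; [now apply tau_disc|]. rewrite tau_invol, Ev by auto. now apply tau_invol.
Qed.

Lemma bijective_fixed_point phi p : hol_selfmap phi -> bijective_on_D phi -> disc p -> phi p = p ->
  exists c, Cmod c = 1 /\ forall z, disc z -> tau p (phi (tau p z)) = (c * z)%C.
Proof.
  intros Hs Hb Dp E. destruct (conj_tau_bijective phi p p Hs Hb Dp Dp) as [Hs' Hb'].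
  apply (bijective_fix_0 _ Hs' Hb'). now rewrite tau_0, E, tau_self.
Qed.

Lemma bijective_moebius phi : hol_selfmap phi -> bijective_on_D phi ->
  exists c a, Cmod c = 1 /\ disc a /\ forall z, disc z -> phi z = (c * tau a z)%C.
Proof.
  intros Hs Hb. destruct (proj2 Hb 0%C disc_0) as [a [Da Ea]].
  destruct (conj_tau_bijective phi a 0 Hs Hb Da disc_0) as [Hs' Hb'].
  destruct (bijective_fix_0 _ Hs' Hb') as [c [Hc E]].
  { now rewrite tau_0, Ea, tau_0. }
  (* The conjugation used [tau 0], which is not the identity; hence the sign of the constant
     below. *)
  assert (T0 : forall z, tau 0 z = (- z)%C).
  { intros z. unfold tau. replace (Cconj 0) with (RtoC 0) by (apply injective_projections; simpl; ring).
    replace (1 - 0 * z)%C with (RtoC 1) by ring. field. }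
  exists (- c)%C, a. split; [now rewrite Cmod_opp|]. split; auto. intros z Hz.
  assert (Dt := tau_disc a z Da Hz). specialize (E (tau a z) Dt). rewrite tau_invol, T0 in E by auto.
  replace (phi z) with (- - phi z)%C by ring. rewrite E. ring.
Qed.

(** The product of the two roots has modulus [|c| / |a| = 1], so they cannot both lie outside the
    closed disc. *)
Lemma quadratic_small_root (a b c : C) : a <> 0%C -> Cmod a = Cmod c ->
  exists z, Cmod z <= 1 /\ (a * (z * z) + b * z + c)%C = 0%C.
Proof.
  intros Na E. destruct (csqrt_exists (b * b - 4 * a * c)) as [s Hs].
  set (z1 := ((- b + s) / (2 * a))%C). set (z2 := ((- b - s) / (2 * a))%C).
  assert (R1 : (a * (z1 * z1) + b * z1 + c)%C = 0%C).
  { transitivity ((s * s - (b * b - 4 * a * c)) / (4 * a))%C; [unfold z1; field; auto|rewrite Hs; field; auto]. }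
  assert (R2 : (a * (z2 * z2) + b * z2 + c)%C = 0%C).
  { transitivity ((s * s - (b * b - 4 * a * c)) / (4 * a))%C; [unfold z2; field; auto|rewrite Hs; field; auto]. }
  assert (P : (a * (z1 * z2))%C = c).
  { transitivity ((b * b - s * s) / (4 * a))%C; [unfold z1, z2; field; auto|rewrite Hs; field; auto]. }
  apply (f_equal Cmod) in P. rewrite !Cmod_mult, <- E in P.
  assert (Pa : 0 < Cmod a) by (now apply Cmod_gt_0).
  destruct (Rle_dec (Cmod z1) 1) as [L|L]; [now exists z1|].
  exists z2. split; auto.
  assert (Cmod z1 * Cmod z2 = 1) by (apply Rmult_eq_reg_l with (Cmod a); lra). nra.
Qed.

Lemma affine_iter (A B u : C) (x : nat -> C) : A <> 1%C -> (forall n, x (S n) = (A * x n + B)%C) ->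
  u = (B / (1 - A))%C -> forall n, (x n - u)%C = (A ^ n * (x O - u))%C.
Proof.
  intros NA H Hu n. assert (N : (1 - A)%C <> 0%C) by (apply Csub_neq_0; auto).
  assert (F : (A * u + B)%C = u) by (rewrite Hu; field; auto).
  induction n; [simpl; ring|].
  rewrite H. replace (A * x n + B - u)%C with (A * (x n - u) + ((A * u + B) - u))%C by ring.
  rewrite IHn, F, Cpow_S. ring.
Qed.

(* In the coordinate [1 / (z - zeta)], where [zeta] is a boundary fixed point, the map is
   affine with positive real multiplier, and an affine orbit stays bounded only if it
   is stationary or converges to a fixed point. *)
Lemma bounded_orbit_fixed (phi : C -> C) (c a : C) (r : R) :
  Cmod c = 1 -> disc a -> (forall z, disc z -> phi z = (c * tau a z)%C) -> r < 1 ->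
  (forall n, Cmod (Nat.iter n phi 0%C) <= r) -> exists z, disc z /\ phi z = z.
Proof.
  intros Hc Da Hphi HR Hit.
  destruct (classic (a = 0%C)) as [->|Na].
  { exists 0%C. split; [apply disc_0|]. rewrite Hphi, tau_0 by apply disc_0. ring. }
  assert (Nca : Cconj a <> 0%C) by (intros X; apply Na; rewrite <- (Cconj_conj a), X; apply injective_projections; simpl; ring).
  (* The fixed-point equation [c (a - z) = z (1 - Cconj a * z)], cleared of denominators. *)
  destruct (quadratic_small_root (Cconj a) (- (1 + c)) (c * a)) as [zeta [Hz Ez]]; auto.
  { rewrite Cmod_mult, Cmod_conj, Hc. ring. }
  assert (Nd := tau_den_closed a zeta Da Hz).
  assert (Fz : (c * (a - zeta))%C = (zeta * (1 - Cconj a * zeta))%C).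
  { transitivity (zeta * (1 - Cconj a * zeta) + (Cconj a * (zeta * zeta) + - (1 + c) * zeta + c * a))%C; [ring|rewrite Ez; ring]. }
  destruct (Rle_lt_or_eq_dec _ _ Hz) as [L|E1].
  { exists zeta. split; auto. rewrite Hphi by auto. unfold tau.
    replace (c * ((a - zeta) / (1 - Cconj a * zeta)))%C with (c * (a - zeta) / (1 - Cconj a * zeta))%C by (field; auto).
    rewrite Fz. field. auto. }
  assert (Nz : zeta <> 0%C) by (intros X; rewrite X, Cmod_0 in E1; lra).
  assert (Naz : (a - zeta)%C <> 0%C) by (apply Csub_neq_0; intros X; unfold disc in Da; rewrite X in Da; lra).
  assert (Ns := Cmod2_disc_neq a Da).
  (* Coefficients of the affine form [1 / (phi z - zeta) = A / (z - zeta) + B]. *)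
  set (A := ((1 - Cconj a * zeta) * (1 - a / zeta) / (1 - Cconj a * a))%C).
  set (B := (- Cconj a * (1 - a / zeta) / (1 - Cconj a * a))%C).
  assert (Ec : c = (zeta * (1 - Cconj a * zeta) / (a - zeta))%C) by (rewrite <- Fz; field; auto).
  assert (Rec : forall z, disc z -> (phi z - zeta)%C <> 0%C /\ (/ (phi z - zeta))%C = (A * / (z - zeta) + B)%C).
  { intros z Dz. assert (Nt := tau_den a z Da Dz).
    assert (Nzz : (z - zeta)%C <> 0%C) by (apply Csub_neq_0; intros X; unfold disc in Dz; rewrite X in Dz; lra).
    assert (E : (phi z - zeta)%C = (zeta * (zeta - z) * (1 - Cconj a * a) / ((a - zeta) * (1 - Cconj a * z)))%C).
    { rewrite Hphi by auto. unfold tau. rewrite Ec. field. auto. }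
    assert (Nzz' : (zeta - z)%C <> 0%C) by (intros X; apply Nzz; replace (z - zeta)%C with (- (zeta - z))%C by ring; rewrite X; ring).
    split.
    - rewrite E. repeat apply Cmult_neq_0; auto.
      intros X. assert (Y : ((a - zeta) * (1 - Cconj a * z) * / ((a - zeta) * (1 - Cconj a * z)))%C = 1%C)
        by (apply Cinv_r; now apply Cmult_neq_0).
      rewrite X in Y. rewrite Cmult_0_r in Y. apply RtoC_inj in Y. lra.
    - rewrite E. unfold A, B. field. repeat split; auto. }
  (* On the unit circle inversion is conjugation, which turns the numerator of [A] into a squared
     modulus. *)
  assert (Conj : (/ zeta)%C = Cconj zeta).
  { assert (X := Cmod2_conj zeta). rewrite E1 in X. replace (1 ^ 2) with 1 in X by ring.
    transitivity (/ zeta * (zeta * Cconj zeta))%C; [rewrite <- X; ring|field; auto]. }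
  set (A0 := Cmod (1 - Cconj a * zeta) ^ 2 / (1 - Cmod a ^ 2)).
  assert (Ha2 : Cmod a ^ 2 < 1) by (assert (Q := Cmod_ge_0 a); unfold disc in Da; nra).
  assert (EA : A = RtoC A0).
  { unfold A, A0. rewrite RtoC_div, RtoC_minus, !Cmod2_conj by lra.
    replace (a / zeta)%C with (a * Cconj zeta)%C by (unfold Cdiv; now rewrite Conj).
    rewrite Cminus_conj, Cmult_conj, Cconj_conj.
    replace (Cconj 1) with (RtoC 1) by (apply injective_projections; simpl; ring).
    f_equal. f_equal. ring. }
  assert (PA : 0 < A0).
  { unfold A0. apply Rdiv_lt_0_compat; [|lra]. apply pow_lt. now apply Cmod_gt_0. }
  assert (NB : B <> 0%C).
  { unfold B. intros X. assert (Y : (Cconj a * (zeta - a))%C = 0%C).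
    { transitivity (- Cconj a * (1 - a / zeta) / (1 - Cconj a * a) * (- zeta * (1 - Cconj a * a)))%C; [field; auto|rewrite X; ring]. }
    apply (Cmult_neq_0 (Cconj a) (zeta - a)); auto. intros Z. apply Naz.
    replace (a - zeta)%C with (- (zeta - a))%C by ring. rewrite Z. ring. }
  set (zn := fun n => Nat.iter n phi 0%C).
  change (forall n, Cmod (zn n) <= r) in Hit.
  assert (Dn : forall n, disc (zn n)) by (intros n; unfold disc; eapply Rle_lt_trans; [apply Hit|lra]).
  set (u := fun n => (/ (zn n - zeta))%C).
  assert (Nu : forall n, (zn n - zeta)%C <> 0%C).
  { intros n. apply Csub_neq_0. intros X. specialize (Dn n). unfold disc in Dn. rewrite X in Dn. lra. }
  assert (Hu : forall n, u (S n) = (A * u n + B)%C) by (intros n; apply (Rec (zn n)); auto).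
  set (K := / (1 - r)).
  assert (Bu : forall n, Cmod (u n) <= K).
  { intros n. unfold u. rewrite Cmod_inv by auto. unfold K. apply Rinv_le_contravar; [lra|].
    rewrite Cmod_sub_sym. assert (T := Cmod_rev_triangle zeta (zn n)). specialize (Hit n). lra. }
  assert (Back : forall v : C, v <> 0%C -> (A * v + B)%C = v -> disc (zeta + / v) -> phi (zeta + / v)%C = (zeta + / v)%C).
  { intros v Nv Ev Dv. destruct (Rec _ Dv) as [N1 X].
    replace (zeta + / v - zeta)%C with (/ v)%C in X by ring.
    replace (/ / v)%C with v in X by (field; auto). rewrite Ev in X.
    transitivity (zeta + / / (phi (zeta + / v) - zeta))%C; [field; auto|now rewrite X]. }
  destruct (Req_dec A0 1) as [A1|NA1].
  (* Parabolic case: an arithmetic progression with step [B <> 0] is unbounded. *)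
  - exfalso. assert (X : forall n, u n = (u O + INR n * B)%C).
    { induction n; [simpl; ring|]. rewrite Hu, IHn, EA, A1, S_INR, RtoC_plus. ring. }
    assert (PB : 0 < Cmod B) by (now apply Cmod_gt_0).
    assert (PK : 0 < K) by (apply Rinv_0_lt_compat; lra).
    destruct (nfloor_ex (2 * K / Cmod B)) as [n [_ Hn]].
    { apply Rmult_le_pos; [lra|left; now apply Rinv_0_lt_compat]. }
    assert (Y : Cmod (INR (S n) * B) <= 2 * K).
    { replace (INR (S n) * B)%C with (u (S n) - u O)%C by (rewrite (X (S n)); ring).
      eapply Rle_trans; [apply Cmod_minus_le|]. assert (Y1 := Bu (S n)). assert (Y2 := Bu O). lra. }
    rewrite Cmod_mult, Cmod_R, Rabs_right, S_INR in Y by (apply Rle_ge, pos_INR).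
    apply (Rmult_lt_compat_r (Cmod B)) in Hn; auto. unfold Rdiv in Hn. rewrite Rmult_assoc, Rinv_l in Hn; lra.
  - assert (NA : A <> 1%C) by (rewrite EA; intros X; apply RtoC_inj in X; auto).
    assert (N1A : (1 - A)%C <> 0%C) by (apply Csub_neq_0; auto).
    set (v := (B / (1 - A))%C).
    assert (Fv : (A * v + B)%C = v) by (unfold v; field; auto).
    assert (Nv : v <> 0%C).
    { intros X. apply NB. rewrite X in Fv. rewrite <- Fv. ring. }
    assert (It := affine_iter A B v u NA Hu eq_refl).
    assert (It' : forall n, Cmod (u n - v) = A0 ^ n * Cmod (u O - v)).
    { intros n. rewrite It, Cmod_mult, Cmod_pow, EA, Cmod_R, Rabs_right by lra. reflexivity. }
    destruct (Rlt_dec A0 1) as [L|L].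
    (* For [A0 < 1] the orbit converges to [zeta + / v], and it never leaves [|z| <= r]. *)
    + assert (Dv : disc (zeta + / v)).
      { unfold disc. apply Rle_lt_trans with r; auto. apply Cmod_le_closed. intros e He.
        destruct (Dn_inv 0 (fun w => w) v Nv (Dn_id 0 v) e He) as [d [Hd H1]].
        assert (Q := Cmod_ge_0 (u O - v)).
        destruct (pow_lt_1_zero A0 ltac:(rewrite Rabs_right; lra) (d / (Cmod (u O - v) + 1))) as [n Hn];
          [apply Rdiv_lt_0_compat; lra|].
        specialize (Hn n ltac:(lia)). assert (Pn : 0 < A0 ^ n) by (now apply pow_lt).
        rewrite Rabs_right in Hn by lra.
        assert (X : Cmod (u n - v) < d).
        { rewrite It'. apply (Rmult_lt_compat_r (Cmod (u O - v) + 1)) in Hn; [|lra].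
          unfold Rdiv in Hn. rewrite Rmult_assoc, Rinv_l, Rmult_1_r in Hn by lra. lra. }
        exists (zn n). split; [apply Hit|].
        specialize (H1 _ X). simpl in H1.
        replace (zn n - (zeta + / v))%C with (/ u n - / v)%C; auto.
        unfold u. field. split; auto. }
      exists (zeta + / v)%C. split; auto.
    (* For [A0 > 1] the distance to [v] grows geometrically unless it is 0: so 0 itself is the fixed
       point. *)
    + assert (X : Cmod (u O - v) = 0).
      { assert (Q := Cmod_ge_0 (u O - v)). apply NNPP. intros P. enough (A0 <= 1) by lra.
        assert (PK : 0 <= K) by (eapply Rle_trans; [apply Cmod_ge_0|apply (Bu O)]).
        assert (Qv := Cmod_ge_0 v).
        apply (pow_dominated (Cmod (u O - v)) (K + Cmod v)); try lra.
        intros n. rewrite pow1, Rmult_comm, <- It'.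
        eapply Rle_trans; [apply Cmod_minus_le|]. specialize (Bu n). lra. }
      apply Cmod_eq_0 in X. assert (X' : u O = v) by (replace v with (v + (u O - v))%C by (rewrite X; ring); ring).
      assert (Z : (zeta + / v)%C = zn O) by (rewrite <- X'; unfold u; field; auto).
      exists (zeta + / v)%C. assert (Dv : disc (zeta + / v)) by (rewrite Z; apply Dn). split; auto.
Qed.

(** * The seminorms and the metric *)

(** The radius of [seminorm (S n)], whose indices start at 1. Two of them matter individually:
    [rad 0 = 0], evaluation at the origin, and [rad 1 = 1/2]. *)
Definition rad (n : nat) : R := 1 - / INR (S n).

Lemma rad_range n : 0 <= rad n < 1.
Proof.
  unfold rad. assert (P : 1 <= INR (S n)) by (apply (le_INR 1); lia).
  assert (0 < / INR (S n)) by (apply Rinv_0_lt_compat; lra).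
  assert (/ INR (S n) <= 1) by (rewrite <- Rinv_1; apply Rinv_le_contravar; lra). lra.
Qed.

Lemma rad_mono m n : (m <= n)%nat -> rad m <= rad n.
Proof.
  intros H. unfold rad. assert (P : 0 < INR (S m)) by (apply lt_0_INR; lia).
  assert (INR (S m) <= INR (S n)) by (apply le_INR; lia).
  assert (/ INR (S n) <= / INR (S m)) by (apply Rinv_le_contravar; lra). lra.
Qed.

Lemma rad_cofinal r : r < 1 -> exists n, r <= rad n.
Proof.
  intros Hr. destruct (nfloor_ex (/ (1 - r))) as [n [_ Hn]].
  { left. apply Rinv_0_lt_compat. lra. }
  exists n. unfold rad. rewrite S_INR.
  assert (P : 0 < / (1 - r)) by (apply Rinv_0_lt_compat; lra).
  assert (/ (INR n + 1) < / / (1 - r)) by (apply Rinv_lt_contravar; [apply Rmult_lt_0_compat; lra|lra]).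
  rewrite Rinv_inv in H. lra.
Qed.

Lemma rad_disc n z : Cmod z <= rad n -> disc z.
Proof. unfold disc. assert (R := rad_range n). lra. Qed.

(** By compactness the supremum is a maximum, so [real] is applied to a finite value. *)
Lemma seminorm_spec n f : holo 0 f -> exists z, Cmod z <= rad n /\ seminorm (S n) f = Cmod (f z) /\
  forall w, Cmod w <= rad n -> Cmod (f w) <= seminorm (S n) f.
Proof.
  intros Hf. assert (R := rad_range n).
  destruct (Cmod_max_attained f (rad n)) as [z [Hz Mz]]; [lra|intros; apply Hf, (rad_disc n); auto|].
  exists z. assert (E : seminorm (S n) f = Cmod (f z)).
  { unfold seminorm. rewrite (is_lub_Rbar_unique _ (Finite (Cmod (f z)))); auto. split.
    - intros x [w [Hw ->]]. now apply Mz.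
    - intros b Hb. apply Hb. now exists z. }
  rewrite E. auto.
Qed.

Lemma seminorm_ub n f z : holo 0 f -> Cmod z <= rad n -> Cmod (f z) <= seminorm (S n) f.
Proof. intros Hf Hz. destruct (seminorm_spec n f Hf) as [w [_ [_ H]]]. auto. Qed.

Lemma seminorm_lub n f M : holo 0 f -> (forall z, Cmod z <= rad n -> Cmod (f z) <= M) -> seminorm (S n) f <= M.
Proof. intros Hf HM. destruct (seminorm_spec n f Hf) as [w [Hw [-> _]]]. auto. Qed.

Lemma seminorm_ge_0 n f : holo 0 f -> 0 <= seminorm (S n) f.
Proof. intros Hf. destruct (seminorm_spec n f Hf) as [w [Hw [-> _]]]. apply Cmod_ge_0. Qed.

Lemma seminorm_mono m n f : (m <= n)%nat -> holo 0 f -> seminorm (S m) f <= seminorm (S n) f.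
Proof.
  intros L Hf. apply seminorm_lub; auto. intros z Hz. apply seminorm_ub; auto.
  assert (R := rad_mono m n L). lra.
Qed.

Lemma seminorm_scal n c f : holo 0 f -> seminorm (S n) (fun z => c * f z)%C = Cmod c * seminorm (S n) f.
Proof.
  intros Hf. assert (Hcf : holo 0 (fun z => c * f z)%C) by (apply holo_mult; auto; apply holo_const).
  apply Rle_antisym.
  - apply seminorm_lub; auto. intros z Hz. rewrite Cmod_mult. apply Rmult_le_compat_l; [apply Cmod_ge_0|].
    now apply seminorm_ub.
  - destruct (seminorm_spec n f Hf) as [w [Hw [-> _]]]. rewrite <- Cmod_mult.
    now apply (seminorm_ub n (fun z => c * f z)%C).
Qed.

Lemma seminorm_ext n f g : (forall z, f z = g z) -> seminorm (S n) f = seminorm (S n) g.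
Proof. intros H. replace g with f; auto. now apply functional_extensionality. Qed.

Lemma Hol_holo (f : Hol) : holo 1 f.
Proof. intros z Hz. apply cdiff_Dn1. now apply hf_hol. Qed.

Lemma Hol_holo0 (f : Hol) : holo 0 f.
Proof. apply (holo_le 0 1); auto using Hol_holo. Qed.

Lemma Hol_sub_holo0 (f g : Hol) : holo 0 (fun z => f z - g z)%C.
Proof. intros z Hz. apply (Dn_minus 0); now apply Hol_holo0. Qed.

(** * Building elements of [Hol]; linear maps on [Hol] *)

Definition cut (f : C -> C) (z : C) : C := if Rlt_dec (Cmod z) 1 then f z else 0%C.

Lemma cut_in f z : disc z -> cut f z = f z.
Proof. intros Hz. unfold cut. destruct (Rlt_dec (Cmod z) 1); auto. now destruct n. Qed.

Lemma cut_hol f : holo 1 f -> forall z, disc z -> cdiff (cut f) z.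
Proof.
  intros Hf z Hz. apply cdiff_Dn1. destruct (disc_open z Hz) as [d [Hd H]].
  apply (Dn_local 1 f _ _ d Hd); auto. intros w Hw. symmetry. apply cut_in. auto.
Qed.

Lemma cut_out f z : ~ disc z -> cut f z = 0%C.
Proof. intros Hz. unfold cut. destruct (Rlt_dec (Cmod z) 1); auto. now destruct Hz. Qed.

Definition toHol (f : C -> C) (H : holo 1 f) : Hol := mkHol (cut f) (cut_hol f H) (cut_out f).

Lemma toHol_in f H z : disc z -> toHol f H z = f z.
Proof. apply cut_in. Qed.

Lemma Hol_eq (f g : Hol) : (forall z, disc z -> f z = g z) -> forall z, f z = g z.
Proof.
  intros H z. destruct (classic (disc z)); auto. now rewrite !hf_out.
Qed.

Definition Hscal (c : C) (f : Hol) : Hol := toHol (fun z => c * f z)%C (holo_mult 1 _ _ (holo_const 1 c) (Hol_holo f)).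

Lemma Hscal_eq c f z : Hscal c f z = (c * f z)%C.
Proof.
  destruct (classic (disc z)) as [D|N].
  - unfold Hscal. now rewrite toHol_in.
  - rewrite !hf_out by auto. ring.
Qed.

Definition Hconst (c : C) : Hol := toHol (fun _ => c) (holo_const 1 c).

Lemma Hconst_0 z : Hconst 0 z = 0%C.
Proof.
  destruct (classic (disc z)); [unfold Hconst; now rewrite toHol_in|now apply hf_out].
Qed.

Lemma holo_sub n f g : holo n f -> holo n g -> holo n (fun z => f z - g z)%C.
Proof. intros Hf Hg z Hz. apply Dn_minus; auto. Qed.

Definition Hsub (f g : Hol) : Hol := toHol (fun z => f z - g z)%C (holo_sub 1 _ _ (Hol_holo f) (Hol_holo g)).

Lemma Hsub_eq f g z : Hsub f g z = (f z - g z)%C.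
Proof.
  destruct (classic (disc z)) as [D|N].
  - unfold Hsub. now rewrite toHol_in.
  - rewrite !hf_out by auto. ring.
Qed.

Section Linear.
Variable T : Hol -> Hol.
Hypothesis HT : is_linear T.

Lemma lin_scal c (f h : Hol) : (forall z, h z = c * f z)%C -> forall z, T h z = (c * T f z)%C.
Proof. apply (proj2 HT). Qed.

(** Elements of [Hol] with the same values may carry different proofs. Homogeneity with scalar 1
    shows that a linear map does not see the difference. *)
Lemma lin_ext (f g : Hol) : (forall z, f z = g z) -> forall z, T f z = T g z.
Proof.
  intros H z. rewrite (lin_scal 1%C g f); [ring|]. intros w. rewrite H. ring.
Qed.

Lemma lin_add (f g h : Hol) : (forall z, h z = f z + g z)%C -> forall z, T h z = (T f z + T g z)%C.
Proof. apply (proj1 HT). Qed.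

Lemma lin_sub (f g h : Hol) : (forall z, h z = f z - g z)%C -> forall z, T h z = (T f z - T g z)%C.
Proof.
  intros H z. rewrite (lin_add f (Hscal (-1)%C g) h).
  - rewrite (lin_scal (-1)%C g (Hscal (-1)%C g)); [ring|]. intros; apply Hscal_eq.
  - intros w. rewrite H, Hscal_eq. ring.
Qed.

Lemma lin_zero (h : Hol) : (forall z, h z = 0%C) -> forall z, T h z = 0%C.
Proof. intros H z. rewrite (lin_scal 0%C h h); [ring|]. intros w. rewrite H. ring. Qed.
End Linear.

(** * The metric compared with the seminorms *)

Lemma half_pow_pos n : 0 < (/ 2) ^ n.
Proof. apply pow_lt. lra. Qed.

Lemma ex_series_half : ex_series (fun n => (/ 2) ^ (S n)).
Proof.
  apply (ex_series_incr_1 (fun n => (/ 2) ^ n)). apply ex_series_geom. rewrite Rabs_right; lra.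
Qed.

Lemma Series_half_from m : Series (fun n => (/ 2) ^ (S (m + n))) = (/ 2) ^ m.
Proof.
  transitivity (Series (fun n => (/ 2) ^ (S m) * (/ 2) ^ n)).
  - apply Series_ext. intros n. rewrite <- pow_add. f_equal.
  - rewrite Series_scal_l, Series_geom by (rewrite Rabs_right; lra). simpl. field.
Qed.

Lemma dterm_bounds n x : 0 <= x -> 0 <= (/ 2) ^ (S n) * Rmin 1 x <= (/ 2) ^ (S n).
Proof.
  intros Hx. assert (P := half_pow_pos (S n)). assert (A := Rmin_l 1 x).
  assert (B : 0 <= Rmin 1 x) by (apply Rmin_glb; lra). nra.
Qed.

Lemma ex_series_dterm (a : nat -> R) : (forall n, 0 <= a n) -> ex_series (fun n => (/ 2) ^ (S n) * Rmin 1 (a n)).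
Proof.
  intros Ha. apply (ex_series_le (V := R_CompleteNormedModule) _ (fun n => (/ 2) ^ (S n))); [|apply ex_series_half].
  intros n. destruct (dterm_bounds n (a n) (Ha n)) as [A B].
  change (Rabs ((/ 2) ^ S n * Rmin 1 (a n)) <= (/ 2) ^ S n). rewrite Rabs_right; lra.
Qed.

Lemma Series_term_le (a : nat -> R) p : (forall n, 0 <= a n) -> ex_series a -> a p <= Series a.
Proof.
  intros Ha Ea. revert a Ha Ea. induction p; intros a Ha Ea; rewrite Series_incr_1 by auto.
  - assert (0 <= Series (fun k => a (S k))).
    { rewrite <- (Rmult_0_l (Series a)), <- Series_scal_l. apply Series_le.
      - intros n. rewrite Rmult_0_l. split; [lra|apply Ha].
      - now apply ex_series_incr_1 in Ea. }
    lra.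
  - assert (A := IHp (fun k => a (S k)) (fun k => Ha (S k)) (proj1 (ex_series_incr_1 a) Ea)). simpl in A.
    specialize (Ha O). lra.
Qed.

Lemma dist_term_le p (f g : Hol) : (/ 2) ^ (S p) * Rmin 1 (seminorm (S p) (fun z => f z - g z)%C) <= dist f g.
Proof.
  unfold dist. apply (Series_term_le (fun n => (/ 2) ^ S n * Rmin 1 (seminorm (S n) (fun z => (f z - g z)%C)))).
  - intros n. apply dterm_bounds, seminorm_ge_0, Hol_sub_holo0.
  - apply ex_series_dterm. intros n. apply seminorm_ge_0, Hol_sub_holo0.
Qed.

(** By monotonicity the terms of index below [p] are controlled by the seminorm of index [S p]; the
    remaining weights sum to [(/ 2) ^ p], the sum of [b]. *)
Lemma dist_le_seminorm p (f g : Hol) : dist f g <= seminorm (S p) (fun z => f z - g z)%C + (/ 2) ^ p.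
Proof.
  set (s := fun n => seminorm (S n) (fun z => f z - g z)%C).
  assert (S0 : forall n, 0 <= s n) by (intros; apply seminorm_ge_0, Hol_sub_holo0).
  set (b := fun n => if Nat.ltb n p then 0 else (/ 2) ^ S n).
  assert (Eb : ex_series b).
  { apply (ex_series_le (V := R_CompleteNormedModule) _ (fun n => (/ 2) ^ (S n))); [|apply ex_series_half].
    intros n. change (Rabs (b n) <= (/ 2) ^ S n). unfold b. assert (P := half_pow_pos (S n)).
    destruct (Nat.ltb n p); [rewrite Rabs_R0; lra|rewrite Rabs_right; lra]. }
  assert (Sb : Series b = (/ 2) ^ p).
  { rewrite (Series_incr_n_aux b p).
    - rewrite <- Series_half_from. apply Series_ext. intros n. unfold b.
      destruct (Nat.ltb_spec (p + n) p); [lia|auto].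
    - intros k Hk. unfold b. now destruct (Nat.ltb_spec k p); [|lia]. }
  assert (Es : ex_series (fun n => s p * (/ 2) ^ S n)) by (apply (ex_series_scal (K := R_AbsRing) (V := R_NormedModule)), ex_series_half).
  change (dist f g <= s p + (/ 2) ^ p). unfold dist.
  replace (s p + (/ 2) ^ p) with (Series (fun n => s p * (/ 2) ^ S n + b n)).
  - apply Series_le.
    + intros n. fold (s n). split; [apply dterm_bounds; auto|]. unfold b.
      assert (P := half_pow_pos (S n)). assert (A := Rmin_l 1 (s n)). assert (B := Rmin_r 1 (s n)).
      specialize (S0 p). destruct (Nat.ltb_spec n p) as [L|L]; [|nra].
      assert (M : s n <= s p) by (apply seminorm_mono; [lia|apply Hol_sub_holo0]). nra.
    + apply (ex_series_plus (K := R_AbsRing) (V := R_NormedModule)); auto.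
  - rewrite Series_plus by auto. rewrite Series_scal_l, Sb.
    assert (H1 : Series (fun n => (/ 2) ^ S n) = 1) by exact (Series_half_from 0).
    rewrite H1. ring.
Qed.

Lemma bounded_continuous (T : Hol -> Hol) : is_linear T ->
  (forall p, exists q K, forall f : Hol, seminorm (S p) (T f) <= K * seminorm (S q) f) -> is_continuous T.
Proof.
  intros HT HB f e He.
  destruct (half_pow_small 1 (e / 2)) as [p Hp]; [lra|]. specialize (Hp p ltac:(lia)).
  destruct (HB p) as [q [K HK]].
  set (x := Rmin 1 (e / 2 / (Rabs K + 1))).
  assert (QK := Rabs_pos K).
  assert (X0 : 0 < x) by (apply Rmin_glb_lt; [lra|repeat apply Rdiv_lt_0_compat; lra]).
  exists ((/ 2) ^ S q * x). assert (Pq := half_pow_pos (S q)). split; [nra|].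
  intros g Hg. eapply Rle_lt_trans; [apply (dist_le_seminorm p)|].
  assert (D := dist_term_le q f g). set (s := seminorm (S q) (fun z => (f z - g z)%C)) in *.
  assert (M : Rmin 1 s < x) by (apply Rmult_lt_reg_l with ((/ 2) ^ S q); lra).
  assert (Sx : s < x).
  { unfold Rmin in M at 1. destruct (Rle_dec 1 s); auto. assert (T1 := Rmin_l 1 (e / 2 / (Rabs K + 1))). fold x in T1. lra. }
  assert (B : seminorm (S p) (fun z => T f z - T g z)%C <= K * s).
  { rewrite (seminorm_ext p _ (T (Hsub f g))).
    - unfold s. rewrite (seminorm_ext q _ (Hsub f g)); auto. intros; symmetry; apply Hsub_eq.
    - intros z. symmetry. apply lin_sub; auto. intros; apply Hsub_eq. }
  assert (S0 : 0 <= s) by (apply seminorm_ge_0, Hol_sub_holo0).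
  assert (X2 : x <= e / 2 / (Rabs K + 1)) by apply Rmin_r.
  assert (K * s <= Rabs K * s) by (apply Rmult_le_compat_r; auto; apply Rle_abs).
  assert ((Rabs K + 1) * x <= e / 2).
  { apply Rle_trans with ((Rabs K + 1) * (e / 2 / (Rabs K + 1))); [apply Rmult_le_compat_l; lra|right; field; lra]. }
  nra.
Qed.

Lemma continuous_bounded (T : Hol -> Hol) : is_CLO T ->
  forall p, exists q K, 0 <= K /\ forall f : Hol, seminorm (S p) (T f) <= K * seminorm (S q) f.
Proof.
  intros [HT HC] p. set (o := Hconst 0%C).
  assert (Ho : forall z, o z = 0%C) by apply Hconst_0.
  (* The tolerance is the weight of the seminorm of index [S p]: a smaller distance forces its
     truncation [Rmin 1 _] below 1, hence the seminorm itself. *)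
  destruct (HC o ((/ 2) ^ S p) (half_pow_pos _)) as [d [Hd H]].
  destruct (half_pow_small 1 (d / 2)) as [q Hq]; [lra|]. specialize (Hq q ltac:(lia)).
  exists q, (2 / d). assert (P2 : 0 < 2 / d) by (apply Rdiv_lt_0_compat; lra). split; [lra|].
  assert (Small : forall f : Hol, seminorm (S q) f < d / 2 -> seminorm (S p) (T f) <= 1).
  { intros f Hf. assert (D : dist o f < d).
    { eapply Rle_lt_trans; [apply (dist_le_seminorm q)|].
      rewrite (seminorm_ext q _ (fun z => (-1) * f z)%C) by (intros; rewrite Ho; ring).
      rewrite seminorm_scal by apply Hol_holo0. rewrite Cmod_R, Rabs_left by lra. lra. }
    specialize (H f D). assert (L := dist_term_le p (T o) (T f)).
    rewrite (seminorm_ext p _ (fun z => (-1) * T f z)%C) in L by (intros; rewrite (lin_zero T HT o Ho); ring).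
    rewrite seminorm_scal in L by apply Hol_holo0. rewrite Cmod_R, Rabs_left in L by lra.
    replace (- -1 * seminorm (S p) (T f)) with (seminorm (S p) (T f)) in L by ring.
    assert (P := half_pow_pos (S p)).
    assert (M : Rmin 1 (seminorm (S p) (T f)) < 1).
    { apply Rmult_lt_reg_l with ((/ 2) ^ S p); lra. }
    unfold Rmin in M. destruct (Rle_dec 1 (seminorm (S p) (T f))); lra. }
  intros f. set (s := seminorm (S q) f). assert (S0 : 0 <= s) by (apply seminorm_ge_0, Hol_holo0).
  assert (Sc : forall t, 0 < t -> t * s < d / 2 -> t * seminorm (S p) (T f) <= 1).
  { intros t Ht Hts. assert (E : Cmod t = t) by (rewrite Cmod_R, Rabs_right; lra).
    rewrite <- E at 1. rewrite <- seminorm_scal by apply Hol_holo0.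
    rewrite (seminorm_ext p _ (T (Hscal t f))).
    - apply Small. rewrite (seminorm_ext q _ (fun z => t * f z)%C) by (intros; apply Hscal_eq).
      rewrite seminorm_scal, E by apply Hol_holo0. exact Hts.
    - intros z. symmetry. apply (lin_scal T HT). intros; apply Hscal_eq. }
  apply le_epsilon. intros e He.
  (* This scales [f] into the range of [Small]; [e] keeps the denominator positive when [s = 0]. *)
  set (t := / (2 / d * s + e)). assert (Pt : 0 < 2 / d * s + e) by nra.
  specialize (Sc t ltac:(now apply Rinv_0_lt_compat)).
  assert (X : t * s < d / 2).
  { unfold t. apply Rmult_lt_reg_l with (2 / d * s + e); auto. rewrite <- Rmult_assoc, Rinv_r, Rmult_1_l by lra.
    replace ((2 / d * s + e) * (d / 2)) with (s + e * (d / 2)) by (field; lra). nra. }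
  specialize (Sc X). unfold t in Sc. apply (Rmult_le_compat_l (2 / d * s + e)) in Sc; [|lra].
  rewrite <- Rmult_assoc, Rinv_r in Sc by lra. lra.
Qed.

(* At [t = 1 / b n], all the terms of index at least [n] are saturated on the side of [b]. *)
Lemma dterms_determine (a b : nat -> R) :
  (forall n, 0 <= a n <= a (S n)) -> (forall n, 0 <= b n <= b (S n)) ->
  (forall t, 0 < t -> Series (fun n => (/ 2) ^ S n * Rmin 1 (t * a n)) = Series (fun n => (/ 2) ^ S n * Rmin 1 (t * b n))) ->
  forall n, (forall k, (k < n)%nat -> a k = b k) -> b n <= a n.
Proof.
  intros Ha Hb H n Hk. apply Rnot_lt_le. intros L.
  assert (Mb : forall m k, (m <= k)%nat -> b m <= b k).
  { induction 1; [lra|]. specialize (Hb m0). lra. }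
  assert (P : 0 < b n) by (specialize (Ha n); lra).
  set (t := / b n). assert (Pt : 0 < t) by (now apply Rinv_0_lt_compat).
  assert (Ea : ex_series (fun n => (/ 2) ^ S n * Rmin 1 (t * a n))) by (apply ex_series_dterm; intros m; apply Rmult_le_pos; [lra|apply Ha]).
  assert (Eb : ex_series (fun n => (/ 2) ^ S n * Rmin 1 (t * b n))) by (apply ex_series_dterm; intros m; apply Rmult_le_pos; [lra|apply Hb]).
  assert (D := Series_minus _ _ Eb Ea). rewrite (H t Pt), Rminus_diag in D.
  assert (Tb : forall m, (n <= m)%nat -> Rmin 1 (t * b m) = 1).
  { intros m Hm. apply Rmin_left. unfold t. rewrite <- (Rinv_l (b n)) by lra. apply Rmult_le_compat_l; [left; exact Pt|now apply Mb]. }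
  (* The differences sum to 0 and are nonnegative: they vanish below [n], and from [n] on the
     minuend is saturated. Yet the one at [n] is positive. *)
  assert (X := Series_term_le (fun m => (/ 2) ^ S m * Rmin 1 (t * b m) - (/ 2) ^ S m * Rmin 1 (t * a m)) n).
  cbv beta in X. rewrite D in X.
  assert (Y : Rmin 1 (t * a n) < 1).
  { eapply Rle_lt_trans; [apply Rmin_r|]. unfold t. rewrite <- (Rinv_l (b n)) by lra. apply Rmult_lt_compat_l; auto. }
  rewrite Tb in X by lia. assert (Q := half_pow_pos (S n)). simpl in Q.
  assert (Z : / 2 * (/ 2) ^ n * 1 - / 2 * (/ 2) ^ n * Rmin 1 (t * a n) <= 0); [|nra].
  apply X.
  - intros m. destruct (Nat.lt_ge_cases m n) as [Lm|Lm].
    + rewrite (Hk m Lm). lra.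
    + rewrite Tb by auto. assert (A := Rmin_l 1 (t * a m)). assert (Q' := half_pow_pos (S m)). nra.
  - apply (ex_series_minus (K := R_AbsRing) (V := R_NormedModule)); auto.
Qed.

(** Applied to all positive multiples of [f], the isometry equates two functions of [t], from which
    the seminorms are read off by strong induction on the index. *)
Lemma isometry_seminorm (V : Hol -> Hol) : is_lin_isometry V ->
  forall n (f : Hol), seminorm (S n) (V f) = seminorm (S n) f.
Proof.
  intros [HV HI] n f.
  assert (E : forall t, 0 < t -> Series (fun n => (/ 2) ^ S n * Rmin 1 (t * seminorm (S n) (V f))) =
     Series (fun n => (/ 2) ^ S n * Rmin 1 (t * seminorm (S n) f))).
  { intros t Ht. assert (Et : Cmod t = t) by (rewrite Cmod_R, Rabs_right; lra).
    set (o := Hconst 0%C).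
    assert (Ho : forall z, o z = 0%C) by apply Hconst_0.
    assert (I := HI (Hscal t f) o). unfold dist in I.
    transitivity (Series (fun n => (/ 2) ^ S n * Rmin 1 (seminorm (S n) (fun z => V (Hscal t f) z - V o z)%C)));
      [|rewrite I]; apply Series_ext; intros k; do 2 f_equal.
    - rewrite <- Et at 1. rewrite <- seminorm_scal by apply Hol_holo0. apply seminorm_ext. intros z.
      rewrite (lin_zero V HV o Ho), (lin_scal V HV t f (Hscal t f)) by (intros; apply Hscal_eq). ring.
    - symmetry. rewrite <- Et at 1. rewrite <- seminorm_scal by apply Hol_holo0. apply seminorm_ext. intros z.
      rewrite Ho, Hscal_eq. ring. }
  assert (M : forall g : Hol, forall n, 0 <= seminorm (S n) g <= seminorm (S (S n)) g).
  { intros g m. split; [apply seminorm_ge_0|apply seminorm_mono; [lia|]]; apply Hol_holo0. }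
  induction n as [n IH] using Wf_nat.lt_wf_ind. apply Rle_antisym.
  - apply (dterms_determine (fun n => seminorm (S n) f) (fun n => seminorm (S n) (V f))); auto.
    + intros t Ht. symmetry. now apply E.
    + intros k Hk. symmetry. now apply IH.
  - now apply (dterms_determine (fun n => seminorm (S n) (V f)) (fun n => seminorm (S n) f)).
Qed.

(** * Isometries *)

Definition Hid : Hol := toHol (fun z => z) (holo_id 1).

Lemma Hid_in z : disc z -> Hid z = z.
Proof. intros Hz. unfold Hid. now rewrite toHol_in. Qed.

Lemma Hconst_in c z : disc z -> Hconst c z = c.
Proof. intros Hz. unfold Hconst. now rewrite toHol_in. Qed.

Lemma seminorm_1 f : holo 0 f -> seminorm 1 f = Cmod (f 0%C).
Proof.
  intros Hf. destruct (seminorm_spec 0 f Hf) as [z [Hz [-> _]]]. unfold rad in Hz. simpl in Hz.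
  assert (Q := Cmod_ge_0 z). assert (Z : Cmod z = 0) by lra. apply Cmod_eq_0 in Z. now rewrite Z.
Qed.

Lemma holo_affine_comb a b c f : holo 1 f -> holo 1 (fun w => a + b * w + c * f w)%C.
Proof.
  intros Hf z Hz. apply Dn_plus; [apply Dn_plus; [apply Dn_const|apply Dn_mult; [apply Dn_const|apply Dn_id]]|].
  apply Dn_mult; [apply Dn_const|auto].
Qed.

Lemma Cmod_sub_sqr (x y : C) : Cmod (x - y) ^ 2 = Cmod x ^ 2 + Cmod y ^ 2 - 2 * (fst x * fst y + snd x * snd y).
Proof. rewrite !Cmod2_alt. unfold Re, Im. destruct x, y; simpl. ring. Qed.

(** [Re (1 - w / v)] vanishes at [v] and grows at least quadratically away from it, so a multiple of
    it dominates a bounded function outside any neighbourhood of [v]. *)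
Lemma on_circle_real_part (w v : C) : Cmod v = / 2 -> Cmod w <= / 2 ->
  2 * Cmod (w - v) ^ 2 <= fst (1 - w / v)%C.
Proof.
  intros Hv Hw.
  assert (E : fst v ^ 2 + snd v ^ 2 = / 4) by (change (Re v ^ 2 + Im v ^ 2 = / 4); rewrite <- (Cmod2_alt v), Hv; field).
  assert (F : fst (1 - w / v)%C = 1 - 4 * (fst w * fst v + snd w * snd v)).
  { destruct v as [x y], w as [a b]. simpl in *. rewrite !Rmult_1_r in *. rewrite E. field. }
  rewrite F, Cmod_sub_sqr, Hv. assert (Q := Cmod_ge_0 w). nra.
Qed.

Section Isometry.
Variable V : Hol -> Hol.
Hypothesis HV : is_lin_isometry V.

Lemma iso_ub n (f : Hol) M : (forall z, Cmod z <= rad n -> Cmod (f z) <= M) ->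
  forall z, Cmod z <= rad n -> Cmod (V f z) <= M.
Proof.
  intros HM z Hz. eapply Rle_trans; [apply (seminorm_ub n); [apply Hol_holo0|exact Hz]|].
  rewrite (isometry_seminorm V HV). apply seminorm_lub; auto. apply Hol_holo0.
Qed.

Lemma iso_ub_disc (f : Hol) M : (forall z, disc z -> Cmod (f z) <= M) -> forall z, disc z -> Cmod (V f z) <= M.
Proof.
  intros HM z Hz. destruct (rad_cofinal (Cmod z) Hz) as [n Hn]. apply (iso_ub n f); auto.
  intros w Hw. apply HM. now apply (rad_disc n).
Qed.

Lemma iso_at_0 (f : Hol) : Cmod (V f 0%C) = Cmod (f 0%C).
Proof.
  rewrite <- !seminorm_1 by apply Hol_holo0. apply (isometry_seminorm V HV).
Qed.

Lemma iso_one : exists al, Cmod al = 1 /\ forall z, disc z -> V (Hconst 1) z = al.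
Proof.
  assert (H0 := iso_at_0 (Hconst 1)). rewrite Hconst_in, Cmod_1 in H0 by apply disc_0.
  exists (V (Hconst 1) 0%C). split; auto. apply strong_max_0; auto; [apply Hol_holo|].
  apply iso_ub_disc. intros z Hz. rewrite Hconst_in, Cmod_1 by auto. lra.
Qed.

(** The seminorm of radius 0 gives [V z] a zero at 0. The quotient by [z] is at most 1 in modulus,
    and the seminorm of radius 1/2 makes it reach 1 inside the disc. *)
Lemma iso_id : exists ga, Cmod ga = 1 /\ forall z, disc z -> V Hid z = (ga * z)%C.
Proof.
  assert (H0 := iso_at_0 Hid). rewrite Hid_in, Cmod_0 in H0 by apply disc_0. apply Cmod_eq_0 in H0.
  destruct (holo_div_0 _ (Hol_holo (V Hid)) H0) as [q [Hq E]].
  assert (Q1 : forall z, disc z -> Cmod (q z) <= 1).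
  { apply (schwarz_order 1 (V Hid) q 1); auto.
    - intros z _. rewrite E. simpl. ring.
    - apply iso_ub_disc. intros z Hz. rewrite Hid_in by auto. left. exact Hz. }
  destruct (seminorm_spec 1 (V Hid) (Hol_holo0 _)) as [z0 [Hz0 [S0 _]]].
  rewrite (isometry_seminorm V HV) in S0.
  assert (R1 : rad 1 = / 2) by (unfold rad; simpl; lra). rewrite R1 in Hz0.
  assert (S2 : / 2 <= seminorm 2 Hid).
  { assert (D : disc (RtoC (/ 2))) by (unfold disc; rewrite Cmod_R, Rabs_right; lra).
    replace (/ 2) with (Cmod (Hid (RtoC (/ 2)))) at 1 by (rewrite Hid_in, Cmod_R, Rabs_right; auto; lra).
    apply (seminorm_ub 1); [apply Hol_holo0|]. rewrite R1, Cmod_R, Rabs_right; lra. }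
  rewrite S0, E, Cmod_mult in S2.
  assert (Dz : disc z0) by (unfold disc; lra).
  assert (Qq := Cmod_ge_0 (q z0)).
  assert (L : 1 <= Cmod (q z0)) by nra.
  exists (q z0). split; [apply Rle_antisym; auto|]. intros z Hz.
  rewrite E, (strong_max q z0 Hq Q1 Dz L z Hz). ring.
Qed.

Lemma iso_comb al ga (f : Hol) a b c : (forall z, disc z -> V (Hconst 1) z = al) ->
  (forall z, disc z -> V Hid z = (ga * z)%C) ->
  forall z, disc z -> V (toHol _ (holo_affine_comb a b c f (Hol_holo f))) z = (a * al + b * (ga * z) + c * V f z)%C.
Proof.
  intros Hal Hga z Hz. destruct HV as [HL _].
  assert (HA : forall z, Hsub (toHol _ (holo_affine_comb a b c f (Hol_holo f))) (Hscal c f) z =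
     (Hscal a (Hconst 1) z + Hscal b Hid z)%C).
  { intros w. destruct (classic (disc w)) as [D|N].
    - rewrite Hsub_eq, !Hscal_eq, toHol_in, Hconst_in, Hid_in by auto. ring.
    - rewrite Hsub_eq, !Hscal_eq, !(hf_out _ w N). ring. }
  assert (X := lin_add V HL _ _ _ HA z).
  rewrite (lin_sub V HL _ _ _ (Hsub_eq _ _)) in X.
  rewrite (lin_scal V HL c f _ (Hscal_eq c f)), (lin_scal V HL a _ _ (Hscal_eq a (Hconst 1))),
    (lin_scal V HL b _ _ (Hscal_eq b Hid)), Hal, Hga in X by auto.
  transitivity (V (toHol _ (holo_affine_comb a b c f (Hol_holo f))) z - c * V f z + c * V f z)%C; [ring|].
  rewrite X. ring.
Qed.

(* At [z1] on the circle of radius 1/2, [f |-> V f z1 / al] is a unital contraction, hence positive,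
   and it maps [z] to the point [w1] of the same circle: so it is the evaluation at [w1].  The test
   function below is [M - g] with [g] of nonnegative real part, [M] large. *)
Lemma iso_on_circle al ga : Cmod al = 1 -> Cmod ga = 1 -> (forall z, disc z -> V (Hconst 1) z = al) ->
  (forall z, disc z -> V Hid z = (ga * z)%C) ->
  forall (f : Hol) z1, Cmod z1 = / 2 -> V f z1 = (al * f (ga / al * z1))%C.
Proof.
  intros Aal Aga Hal Hga f z1 Hz1.
  assert (Nal : al <> 0%C) by (intros ->; rewrite Cmod_0 in Aal; lra).
  set (w1 := (ga / al * z1)%C).
  assert (Hw1 : Cmod w1 = / 2) by (unfold w1; rewrite Cmod_mult, Cmod_div, Aal, Aga, Hz1 by auto; field).
  assert (Nw1 : w1 <> 0%C) by (intros E; rewrite E, Cmod_0 in Hw1; lra).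
  assert (Dw1 : disc w1) by (unfold disc; lra). assert (Dz1 : disc z1) by (unfold disc; lra).
  set (D := (V f z1 / al - f w1)%C).
  destruct (classic (D = 0%C)) as [D0|ND].
  { transitivity (al * (D + f w1))%C; [unfold D; field; auto|rewrite D0; ring]. }
  exfalso. assert (PD : 0 < Cmod D) by (now apply Cmod_gt_0). set (e := Cmod D / 2).
  destruct (Hol_holo0 f w1 Dw1 e) as [d [Hd Hd1]]; [unfold e; lra|].
  destruct (ccont_bounded (fun w => f w - f w1)%C (/ 2)) as [B [HB HB1]]; [lra| |].
  { intros z Hz. apply (Dn_minus 0); [apply Hol_holo0; unfold disc; lra|apply Dn_const]. }
  (* At distance at least [d] from [w1], [K * Re (1 - w / w1)] is then at least [B], the bound for
     [f - f w1]. *)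
  set (K := B / (2 * d ^ 2)). assert (Pd2 : 0 < 2 * d ^ 2) by (assert (0 < d ^ 2) by (now apply pow_lt); lra).
  assert (HK : 0 <= K) by (apply Rmult_le_pos; auto; left; now apply Rinv_0_lt_compat).
  assert (Dom : forall w, Cmod w <= / 2 -> Cmod (f w - f w1) <= e + K * fst (1 - w / w1)%C).
  { intros w Hw. assert (P := on_circle_real_part w w1 Hw1 Hw).
    assert (Q := pow2_ge_0 (Cmod (w - w1))).
    destruct (Rlt_dec (Cmod (w - w1)) d) as [L|L].
    - specialize (Hd1 w L). assert (0 <= K * fst (1 - w / w1)%C) by (apply Rmult_le_pos; lra). lra.
    - assert (d ^ 2 <= Cmod (w - w1) ^ 2) by (apply pow_incr; lra).
      assert (K * (2 * d ^ 2) <= K * fst (1 - w / w1)%C) by (apply Rmult_le_compat_l; lra).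
      assert (K * (2 * d ^ 2) = B) by (unfold K; field; lra). specialize (HB1 w Hw). unfold e in *. lra. }
  (* Rotates the defect [D] to the positive axis. *)
  set (c := (Cconj D / Cmod D)%C).
  assert (NcD : RtoC (Cmod D) <> 0%C) by (intros X; apply RtoC_inj in X; lra).
  assert (Ac : Cmod c = 1).
  { unfold c. rewrite Cmod_div, Cmod_conj, Cmod_R, Rabs_right by (auto; lra). field. lra. }
  assert (cD : (c * D)%C = Cmod D).
  { unfold c. transitivity (D * Cconj D / Cmod D)%C; [field; auto|].
    rewrite <- Cmod2_conj. replace (Cmod D ^ 2) with (Cmod D * Cmod D) by ring. rewrite RtoC_mult. field. auto. }
  (* The functional sends 1 to 1, [z] to [w1] and [f] to [f w1 + D]. Hence it would send [g], whose
     real part is nonnegative, to [e - |D| = - e]. *)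
  set (g := fun w => (e + K * (1 - w / w1) - c * (f w - f w1))%C).
  assert (Hg : holo 0 g).
  { intros w Hw. apply (Dn_minus 0); [apply (Dn_plus 0); [apply Dn_const|apply (Dn_mult 0); [apply Dn_const|]]|].
    - apply (Dn_minus 0); [apply Dn_const|]. apply (Dn_mult 0); [apply Dn_id|apply Dn_const].
    - apply (Dn_mult 0); [apply Dn_const|]. apply (Dn_minus 0); [now apply Hol_holo0|apply Dn_const]. }
  assert (Pg : forall w, Cmod w <= / 2 -> 0 <= fst (g w)).
  { intros w Hw. specialize (Dom w Hw).
    assert (X := re_le_Cmod (c * (f w - f w1))). rewrite Cmod_mult, Ac, Rmult_1_l in X.
    assert (Y := Rle_abs (Re (c * (f w - f w1)))).
    assert (Z : fst (g w) = e + K * fst (1 - w / w1)%C - Re (c * (f w - f w1))) by (unfold g, Re; simpl; ring).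
    rewrite Z. lra. }
  destruct (ccont_bounded g (/ 2)) as [G [HG HG1]]; [lra|intros; apply Hg; unfold disc; lra|].
  (* Since [Re g >= 0], [|M - g| ^ 2 <= M ^ 2 + G ^ 2], while the image of [M - g] is [M + e]. As
     [2 M e = G ^ 2 + 1], the square of the latter is larger. *)
  set (M := (G ^ 2 + 1) / Cmod D).
  assert (PM : 0 < M) by (apply Rdiv_lt_0_compat; auto; assert (Q := pow2_ge_0 G); lra).
  set (a := (M - e - K - c * f w1)%C). set (b := (K / w1)%C).
  assert (R1 : rad 1 = / 2) by (unfold rad; simpl; lra).
  assert (Bd : forall w, Cmod w <= rad 1 ->
    Cmod (toHol _ (holo_affine_comb a b c f (Hol_holo f)) w) <= sqrt (M ^ 2 + G ^ 2)).
  { intros w Hw. rewrite R1 in Hw. assert (Dw : disc w) by (unfold disc; lra). rewrite toHol_in by auto.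
    replace (a + b * w + c * f w)%C with (M - g w)%C by (unfold g, a, b; field; auto).
    rewrite <- (sqrt_pow2 (Cmod (M - g w))) by apply Cmod_ge_0. apply sqrt_le_1_alt.
    rewrite Cmod_sub_sqr. change (fst (RtoC M)) with M. change (snd (RtoC M)) with 0. rewrite Cmod_R, Rabs_right by lra.
    specialize (Pg w Hw). specialize (HG1 w Hw).
    assert (Cmod (g w) ^ 2 <= G ^ 2) by (apply pow_incr; split; auto using Cmod_ge_0).
    assert (0 <= M * fst (g w)) by (apply Rmult_le_pos; lra). lra. }
  assert (X := iso_ub 1 _ _ Bd z1). rewrite R1, (iso_comb al ga f a b c Hal Hga z1 Dz1) in X.
  specialize (X ltac:(lra)).
  replace (a * al + b * (ga * z1) + c * V f z1)%C with (al * (M + e)%R)%C in X.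
  - rewrite Cmod_mult, Aal, Rmult_1_l, Cmod_R, Rabs_right in X by (unfold e; lra).
    assert (Y : (M + e) ^ 2 <= sqrt (M ^ 2 + G ^ 2) ^ 2) by (apply pow_incr; split; [unfold e; lra|exact X]).
    rewrite pow2_sqrt in Y by (assert (Q := pow2_ge_0 G); assert (Q' := pow2_ge_0 M); lra).
    assert (E : M * Cmod D = G ^ 2 + 1) by (unfold M; field; lra). unfold e in Y. nra.
  - assert (F : (b * (ga * z1))%C = (K * al)%C) by (unfold b, w1; field; repeat split; auto;
      try (intros Z; apply Nw1; unfold w1; rewrite Z; ring); intros Z; rewrite Z, Cmod_0 in Aga; lra).
    rewrite F. assert (Fv : V f z1 = (al * (D + f w1))%C) by (unfold D; field; auto).
    rewrite Fv. unfold a.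
    transitivity (al * (M - e + c * D))%C; [|ring]. rewrite cD. unfold e. rewrite RtoC_plus, RtoC_div by lra. field.
Qed.

(** The formula passes from the circle of radius 1/2 to its interior by the maximum principle, and
    to the whole disc by the identity theorem. *)
Lemma isometry_form : exists al be, Cmod al = 1 /\ Cmod be = 1 /\
  forall (f : Hol) z, disc z -> V f z = (al * f (be * z))%C.
Proof.
  destruct iso_one as [al [Aal Hal]]. destruct iso_id as [ga [Aga Hga]].
  assert (Nal : al <> 0%C) by (intros ->; rewrite Cmod_0 in Aal; lra).
  assert (Abe : Cmod (ga / al) = 1) by (rewrite Cmod_div, Aal, Aga by auto; field).
  exists al, (ga / al)%C. split; [auto|]. split; auto. intros f z Hz.
  assert (Hr : holo 1 (fun z => al * f (ga / al * z))%C).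
  { apply holo_mult; [apply holo_const|]. apply (holo_comp 1 f (fun z => ga / al * z)%C); [apply Hol_holo|].
    intros w Hw. split; [apply Dn_mult; [apply Dn_const|apply Dn_id]|].
    unfold disc. rewrite Cmod_mult, Abe, Rmult_1_l. exact Hw. }
  apply (holo_eq_nbhd (V f) (fun z => al * f (ga / al * z))%C (/ 2)); auto; [lra|apply Hol_holo|].
  intros w Hw.
  assert (X : Cmod (V f w - al * f (ga / al * w))%C <= 0).
  { apply (max_principle_holo (fun w => V f w - al * f (ga / al * w))%C (/ 2)); [|lra| |lra].
    - apply holo_sub; auto. apply Hol_holo.
    - intros v Hv. rewrite (iso_on_circle al ga Aal Aga Hal Hga f v Hv), Cmod_sub_self. lra. }
  assert (Q := Cmod_ge_0 (V f w - al * f (ga / al * w))%C).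
  assert (Z : (V f w - al * f (ga / al * w))%C = 0%C) by (apply Cmod_eq_0; lra).
  transitivity (V f w - al * f (ga / al * w) + al * f (ga / al * w))%C; [ring|rewrite Z; ring].
Qed.
End Isometry.

(** * Weighted composition operators *)

(** [a] vanishes near a point where [b] does not. This permits cancelling an eigenvector in spite of
    its zeros. *)
Lemma holo_zero_product (a b : C -> C) : holo 1 a -> holo 1 b -> (forall z, disc z -> (a z * b z)%C = 0%C) ->
  (exists z, disc z /\ b z <> 0%C) -> forall z, disc z -> a z = 0%C.
Proof.
  intros Ha Hb Hab [v [Dv Nv]].
  destruct (ccont_neq_0 b v (Dn_le 0 1 b v ltac:(lia) (Hb v Dv)) Nv) as [d [Hd H]].
  destruct (disc_open v Dv) as [d' [Hd' H']].
  apply (holo_zero_nbhd a v (Rmin d d')); auto; [now apply Rmin_glb_lt|]. intros z Hz. apply NNPP. intros N.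
  apply (Cmult_neq_0 (a z) (b z)); auto.
  - apply H. exact (Rlt_le_trans _ _ _ Hz (Rmin_l _ _)).
  - apply Hab, H'. exact (Rlt_le_trans _ _ _ Hz (Rmin_r _ _)).
Qed.

(** * The eigenvector equation over a rotation *)

Fixpoint csum (a : nat -> C) (n : nat) : C :=
  match n with O => 0%C | S n => (csum a n + a n)%C end.

Fixpoint cprod (a : nat -> C) (n : nat) : C :=
  match n with O => 1%C | S n => (cprod a n * a n)%C end.

Lemma holo_csum k (a : nat -> C -> C) n : (forall j, holo k (a j)) -> holo k (fun z => csum (fun j => a j z) n).
Proof.
  intros H z Hz. induction n; simpl; [apply Dn_const|]. apply Dn_plus; auto. now apply H.
Qed.

Lemma holo_cprod k (a : nat -> C -> C) n : (forall j, holo k (a j)) -> holo k (fun z => cprod (fun j => a j z) n).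
Proof.
  intros H z Hz. induction n; simpl; [apply Dn_const|]. apply Dn_mult; auto. now apply H.
Qed.

Section Rotation.
Variable be : C.
Hypothesis Hbe : Cmod be = 1.

Lemma rot_neq_0 : be <> 0%C.
Proof. intros ->. rewrite Cmod_0 in Hbe. lra. Qed.

Lemma disc_rot c z : Cmod c = 1 -> disc z -> disc (c * z).
Proof. intros Hc Hz. unfold disc. now rewrite Cmod_mult, Hc, Rmult_1_l. Qed.

Lemma Cmod_pow_1 c n : Cmod c = 1 -> Cmod (c ^ n) = 1.
Proof. intros H. now rewrite Cmod_pow, H, pow1. Qed.

Lemma holo_rot n c f : Cmod c = 1 -> holo n f -> holo n (fun z => f (c * z)%C).
Proof.
  intros Hc Hf. apply (holo_comp n f (fun z => c * z)%C); auto. intros z Hz. split.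
  - apply Dn_mult; [apply Dn_const|apply Dn_id].
  - now apply disc_rot.
Qed.

(* If [be ^ n = 1] and the sum of the [L (be^j z)] vanishes, this says that the function
   [k z = - 1/n * sum_(j < n) j L (be^j z)] satisfies [k z - k (be z) = L z]. *)
Lemma weighted_sum_rot (L : C -> C) n z :
  csum (fun j => INR j * L (be ^ j * (be * z)))%C n =
  (csum (fun j => INR j * L (be ^ j * z)) (S n) - csum (fun j => L (be ^ j * z)) (S n) + L z)%C.
Proof.
  induction n.
  - simpl. rewrite !Cmult_1_l. ring.
  - set (A := csum (fun j => INR j * L (be ^ j * z))%C) in *. set (B := csum (fun j => L (be ^ j * z))%C) in *.
    change (csum (fun j => INR j * L (be ^ j * (be * z)))%C (S n)) with
      (csum (fun j => INR j * L (be ^ j * (be * z)))%C n + INR n * L (be ^ n * (be * z))%C)%C.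
    change (A (S (S n))) with (A (S n) + INR (S n) * L (be ^ S n * z)%C)%C.
    change (B (S (S n))) with (B (S n) + L (be ^ S n * z)%C)%C.
    rewrite IHn. replace (be ^ n * (be * z))%C with (be ^ S n * z)%C by (rewrite Cpow_S; ring).
    rewrite S_INR, RtoC_plus. ring.
Qed.

Section Eigenfunction.
Variables m f : C -> C.
Variable lam : C.
Hypothesis Hm : holo 1 m.
Hypothesis Hf : holo 1 f.
Hypothesis Nf : exists z, disc z /\ f z <> 0%C.
Hypothesis Hlam : Cmod lam = 1.
Hypothesis Heq : forall z, disc z -> (m z * f (be * z))%C = (lam * f z)%C.

Lemma lam_neq_0 : lam <> 0%C.
Proof. intros E. rewrite E, Cmod_0 in Hlam. lra. Qed.

Lemma eigen_iter n z : disc z -> (cprod (fun j => m (be ^ j * z)) n * f (be ^ n * z))%C = (lam ^ n * f z)%C.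
Proof.
  intros Hz. induction n.
  - simpl. now rewrite !Cmult_1_l.
  - assert (D := disc_rot (be ^ n) z (Cmod_pow_1 be n Hbe) Hz).
    replace (be ^ S n * z)%C with (be * (be ^ n * z))%C by (rewrite Cpow_S; ring).
    simpl cprod. rewrite <- Cmult_assoc, (Heq _ D), Cpow_S.
    transitivity (lam * (cprod (fun j => m (be ^ j * z)) n * f (be ^ n * z)))%C; [ring|rewrite IHn; ring].
Qed.

(** As [m z = m 0 * cexp (L z)], the function [g = cexp k] has eigenvalue [m 0] once
    [k z - k (be z) = L z]. Solvability requires [L] to sum to 0 along each orbit, which the
    eigenvector ensures; [|m 0| = 1] because [m 0 ^ N = lam ^ N]. *)
Lemma coboundary_finite_order N : (0 < N)%nat -> (be ^ N)%C = 1%C ->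
  exists g al, holo 1 g /\ (forall z, disc z -> g z <> 0%C) /\ Cmod al = 1 /\
    forall z, disc z -> (m z * g (be * z))%C = (al * g z)%C.
Proof.
  intros HN HbN.
  assert (Hmr : forall j, holo 1 (fun z => m (be ^ j * z)%C)) by (intros; apply holo_rot; auto using Cmod_pow_1).
  (* After [N] steps the rotation is back at [z], and the eigenvector cancels. *)
  assert (P : forall z, disc z -> cprod (fun j => m (be ^ j * z)%C) N = (lam ^ N)%C).
  { intros z Hz. assert (X : (cprod (fun j => m (be ^ j * z)%C) N - lam ^ N)%C = 0%C).
    { apply (holo_zero_product (fun z => cprod (fun j => m (be ^ j * z)%C) N - lam ^ N)%C f); auto.
      - apply (holo_sub 1 _ (fun _ => lam ^ N)%C); [|apply holo_const]. now apply (holo_cprod 1 (fun j z => m (be ^ j * z)%C)).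
      - intros w Hw. assert (E := eigen_iter N w Hw). rewrite HbN, Cmult_1_l in E.
        transitivity (cprod (fun j => m (be ^ j * w)%C) N * f w - lam ^ N * f w)%C; [ring|rewrite E; ring]. }
    transitivity (cprod (fun j => m (be ^ j * z)%C) N - lam ^ N + lam ^ N)%C; [ring|rewrite X; ring]. }
  assert (Nm : forall z, disc z -> m z <> 0%C).
  { intros z Hz E. apply (Cpow_nz lam N lam_neq_0). rewrite <- (P z Hz). clear P HbN.
    induction N as [|N IH]; [lia|]. simpl. destruct N as [|N].
    - simpl. rewrite !Cmult_1_l, E. ring.
    - rewrite IH by lia. ring. }
  destruct (holo_log m Hm Nm) as [L [HL [L0 EL]]].
  assert (PL : forall n z, disc z -> cprod (fun j => m (be ^ j * z)%C) n =
     (m 0 ^ n * cexp (csum (fun j => L (be ^ j * z)%C) n))%C).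
  { intros n z Hz. induction n; [simpl; rewrite cexp_0; ring|].
    simpl cprod. simpl csum. rewrite IHn, cexp_plus, (EL (be ^ n * z)%C), Cpow_S by (apply disc_rot; auto using Cmod_pow_1). ring. }
  assert (S00 : forall n, csum (fun j => L (be ^ j * 0)%C) n = 0%C).
  { intros n. induction n; simpl; auto. rewrite IHn, Cmult_0_r, L0. ring. }
  assert (M0 : (m 0 ^ N)%C = (lam ^ N)%C).
  { rewrite <- (P 0%C disc_0), (PL N 0%C disc_0), S00, cexp_0. ring. }
  assert (Am : Cmod (m 0%C) = 1).
  { apply (f_equal Cmod) in M0. rewrite !Cmod_pow, Hlam, pow1 in M0.
    destruct (pow_R1 _ _ M0) as [E|E]; [|lia]. rewrite Rabs_right in E; auto. apply Rle_ge, Cmod_ge_0. }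
  set (S := fun z => csum (fun j => L (be ^ j * z)%C) N).
  assert (HS : holo 1 S).
  { apply (holo_csum 1 (fun j z => L (be ^ j * z)%C)). intros j. apply holo_rot; auto using Cmod_pow_1. }
  assert (ES : forall z, disc z -> cexp (S z) = 1%C).
  { intros z Hz. assert (X := P z Hz). rewrite (PL N z Hz), M0 in X. fold (S z) in X.
    assert (Nl := Cpow_nz lam N lam_neq_0).
    transitivity (lam ^ N * cexp (S z) / lam ^ N)%C; [field; auto|rewrite X; field; auto]. }
  (* [cexp (S z) = 1] only confines [S z] to multiples of [2 pi i]. Differentiating it gives
     [S' = 0], and [S 0 = 0] by the normalization [L 0 = 0]. *)
  assert (S0 : forall z, disc z -> S z = 0%C).
  { intros z Hz. rewrite <- (S00 N). change (csum (fun j => L (be ^ j * 0)%C) N) with (S 0%C).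
    apply (isd_zero_const S); auto. intros w Hw.
    destruct (Dn1_isd S w (HS w Hw)) as [l Hl]. replace (RtoC 0) with l; auto.
    assert (Y := isd_comp cexp S w l _ Hl (isd_cexp (S w))). rewrite (ES w Hw) in Y.
    destruct (disc_open w Hw) as [d [Hd Hd1]].
    assert (Z : isd (fun _ => 1%C) w (l * 1)%C).
    { refine (isd_local _ _ w _ d Hd _ Y). intros v Hv. apply ES. auto. }
    assert (X := isd_unique _ _ _ _ Z (isd_const 1 w)). rewrite <- X. ring. }
  assert (PN : 0 < INR N) by (now apply lt_0_INR).
  assert (NN : RtoC (INR N) <> 0%C) by (intros X; apply RtoC_inj in X; lra).
  set (k := fun z => (- / INR N * csum (fun j => INR j * L (be ^ j * z)) N)%C).
  assert (Hk : holo 1 k).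
  { apply holo_mult; [apply (holo_const 1 (- / INR N)%C)|].
    apply (holo_csum 1 (fun j z => INR j * L (be ^ j * z))%C). intros j.
    apply holo_mult; [apply holo_const|]. apply holo_rot; auto using Cmod_pow_1. }
  exists (fun z => cexp (k z)), (m 0%C). split; [|split; [|split]]; auto.
  - intros z Hz. apply (Dn_comp 1 cexp k); [now apply Hk|apply Dn_cexp].
  - intros z _. apply cexp_neq_0.
  - intros z Hz.
    assert (W := weighted_sum_rot L N z). simpl csum in W. rewrite HbN, Cmult_1_l in W.
    assert (X := S0 z Hz). unfold S in X. rewrite X in W.
    assert (Ek : (L z + k (be * z))%C = k z).
    { unfold k. rewrite W. field. auto. }
    rewrite (EL z Hz). rewrite <- Cmult_assoc, <- cexp_plus, Ek. reflexivity.
Qed.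

(** Zeros are followed backwards, where only [lam] has to be cancelled; forwards, [m] could
    vanish. *)
Lemma eigen_zero_orbit z n : disc z -> f z = 0%C -> f ((/ be) ^ n * z)%C = 0%C.
Proof.
  intros Hz E. assert (Nb := rot_neq_0).
  assert (Ab : Cmod (/ be) = 1) by (rewrite Cmod_inv, Hbe by auto; apply Rinv_1).
  induction n; [simpl; now rewrite Cmult_1_l|].
  assert (D := disc_rot ((/ be) ^ S n) z (Cmod_pow_1 _ (S n) Ab) Hz).
  assert (X := Heq _ D). replace (be * ((/ be) ^ S n * z))%C with ((/ be) ^ n * z)%C in X by (rewrite Cpow_S; field; auto).
  rewrite IHn, Cmult_0_r in X. apply NNPP. intros N. apply (Cmult_neq_0 _ _ lam_neq_0 N). auto.
Qed.

(* A zero of [f] off the origin has an infinite orbit on its circle, hence the zeros accumulate. *)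
Lemma eigen_zero_free : (forall n, (0 < n)%nat -> (be ^ n)%C <> 1%C) ->
  forall z, disc z -> z <> 0%C -> f z <> 0%C.
Proof.
  intros Hinf z Hz Nz E. assert (Nb := rot_neq_0).
  assert (Ab : Cmod (/ be) = 1) by (rewrite Cmod_inv, Hbe by auto; apply Rinv_1).
  assert (An : forall n, Cmod ((/ be) ^ n * z) = Cmod z) by (intros; now rewrite Cmod_mult, Cmod_pow_1, Rmult_1_l).
  (* The concentrating property: [A] contains orbit points of arbitrarily large index. *)
  destruct (concentration (fun A => forall n, exists k, (n <= k)%nat /\ A ((/ be) ^ k * z)%C)
     (fun w => Cmod w <= Cmod z) (Cmod z)) as [w Hw]; auto.
  - intros A B AB H n. destruct (H n) as [k [Hk1 Hk2]]. exists k. auto.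
  - intros A B H. apply NNPP. intros NN. apply not_or_and in NN. destruct NN as [NA NB].
    apply not_all_ex_not in NA, NB. destruct NA as [a NA], NB as [b NB].
    destruct (H (a + b)%nat) as [k [Hk [X|X]]].
    + apply NA. exists k. split; auto. lia.
    + apply NB. exists k. split; auto. lia.
  - apply Cmod_ge_0.
  - intros n. exists n. split; auto. rewrite An. lra.
  - assert (Dw : disc w).
    { unfold disc. apply Rle_lt_trans with (Cmod z); auto. apply Cmod_le_closed. intros e He.
      destruct (Hw e He O) as [k [_ [X Y]]]. now exists ((/ be) ^ k * z)%C. }
    destruct Nf as [v [Dv Nv]]. apply Nv. apply (identity_theorem f w); auto. intros e He.
    (* Two distinct orbit points near [w], so that at least one differs from [w]. *)
    destruct (Hw e He O) as [k1 [_ [X1 Y1]]]. destruct (Hw e He (S k1)) as [k2 [L2 [X2 Y2]]].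
    assert (Nd : ((/ be) ^ k1 * z)%C <> ((/ be) ^ k2 * z)%C).
    { intros X. apply (Hinf (k2 - k1)%nat); [lia|].
      assert (Y : ((/ be) ^ k1)%C = ((/ be) ^ k2)%C).
      { transitivity ((/ be) ^ k1 * z / z)%C; [field; auto|rewrite X; field; auto]. }
      rewrite !Cpow_inv in Y by auto. replace k2 with (k1 + (k2 - k1))%nat in Y by lia.
      rewrite Cpow_add_r in Y. assert (P1 := Cpow_nz be k1 Nb). assert (P2 := Cpow_nz be (k2 - k1) Nb).
      transitivity (/ be ^ k1 / (/ (be ^ k1 * be ^ (k2 - k1))) / be ^ k1 * be ^ k1)%C; [field; auto|].
      rewrite <- Y. field. auto. }
    destruct (classic (((/ be) ^ k1 * z)%C = w)) as [Ew|Nw].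
    + exists ((/ be) ^ k2 * z)%C. repeat split; auto.
      * apply disc_rot; auto. now apply Cmod_pow_1.
      * congruence.
      * now apply eigen_zero_orbit.
    + exists ((/ be) ^ k1 * z)%C. repeat split; auto.
      * apply disc_rot; auto. now apply Cmod_pow_1.
      * now apply eigen_zero_orbit.
Qed.

(** Dividing by [z ^ n] changes the eigenvalue to [lam / be ^ n]; at the origin, the equation is
    recovered by continuity. *)
Lemma coboundary_infinite_order : (forall n, (0 < n)%nat -> (be ^ n)%C <> 1%C) ->
  exists g al, holo 1 g /\ (forall z, disc z -> g z <> 0%C) /\ Cmod al = 1 /\
    forall z, disc z -> (m z * g (be * z))%C = (al * g z)%C.
Proof.
  intros Hinf. assert (Nb := rot_neq_0).
  destruct (holo_order f Hf Nf) as [n [g [Hg [G0 E]]]].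
  exists g, (lam / be ^ n)%C. split; [auto|split; [|split]].
  - intros z Hz X. destruct (classic (z = 0%C)) as [->|Nz]; auto.
    apply (eigen_zero_free Hinf z Hz Nz). rewrite E, X. ring.
  - rewrite Cmod_div, Hlam, Cmod_pow_1 by (auto; now apply Cpow_nz). field.
  - assert (Nz : forall z, disc z -> z <> 0%C -> (m z * g (be * z))%C = (lam / be ^ n * g z)%C).
    { intros z Hz Nz. assert (X := Heq z Hz). rewrite !E, Cpow_mult_l in X.
      assert (P1 := Cpow_nz be n Nb). assert (P2 := Cpow_nz z n Nz).
      transitivity (m z * (be ^ n * z ^ n * g (be * z)) / (be ^ n * z ^ n))%C; [field; auto|rewrite X; field; auto]. }
    intros z Hz. destruct (classic (z = 0%C)) as [->|N]; [|auto].
    apply (ccont_eq_at (fun z => m z * g (be * z))%C (fun z => lam / be ^ n * g z)%C 0 1); [lra| | |].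
    + refine (holo_le 0 1 (fun z => m z * g (be * z))%C ltac:(lia) _ 0%C disc_0). apply holo_mult; auto. now apply holo_rot.
    + refine (holo_le 0 1 (fun z => lam / be ^ n * g z)%C ltac:(lia) _ 0%C disc_0). apply holo_mult; auto. apply holo_const.
    + intros w Nw Hw. apply Nz; auto. replace (w - 0)%C with w in Hw by ring. exact Hw.
Qed.

Lemma coboundary : exists g al, holo 1 g /\ (forall z, disc z -> g z <> 0%C) /\ Cmod al = 1 /\
    forall z, disc z -> (m z * g (be * z))%C = (al * g z)%C.
Proof.
  destruct (classic (exists n, (0 < n)%nat /\ (be ^ n)%C = 1%C)) as [[n [Hn E]]|N].
  - now apply (coboundary_finite_order n).
  - apply coboundary_infinite_order. intros n Hn E. apply N. now exists n.
Qed.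
End Eigenfunction.
End Rotation.

(** * Weighted composition operators as continuous operators on [Hol] *)

Lemma wop_holo (a : C -> C) (psi : C -> C) (Ha : holo 1 a) (Hp : forall z, disc z -> Dn 1 psi z /\ disc (psi z))
  (f : Hol) : holo 1 (fun z => a z * f (psi z))%C.
Proof. apply holo_mult; auto. apply (holo_comp 1 f psi); auto. apply Hol_holo. Qed.

Definition wop a psi Ha Hp (f : Hol) : Hol := toHol _ (wop_holo a psi Ha Hp f).

Section WeightedComposition.
Variables a psi : C -> C.
Hypothesis Ha : holo 1 a.
Hypothesis Hp : forall z, disc z -> Dn 1 psi z /\ disc (psi z).

Lemma wop_in f z : disc z -> wop a psi Ha Hp f z = (a z * f (psi z))%C.
Proof. intros Hz. unfold wop. now rewrite toHol_in. Qed.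

Lemma wop_linear : is_linear (wop a psi Ha Hp).
Proof.
  split.
  - intros f g h H z. destruct (classic (disc z)) as [D|N].
    + rewrite !wop_in, H by auto. ring.
    + rewrite !(hf_out _ z N). ring.
  - intros c f h H z. destruct (classic (disc z)) as [D|N].
    + rewrite !wop_in, H by auto. ring.
    + rewrite !(hf_out _ z N). ring.
Qed.

Lemma wop_CLO : is_CLO (wop a psi Ha Hp).
Proof.
  split; [apply wop_linear|]. apply bounded_continuous; [apply wop_linear|]. intros p.
  assert (R := rad_range p).
  destruct (holo_bounded a Ha (rad p)) as [K [HK HK1]]; [lra|].
  destruct (Cmod_max_attained psi (rad p)) as [v [Hv Mv]]; [lra| |].
  { intros z Hz. apply (Dn_le 0 1); [lia|]. apply Hp. now apply (rad_disc p). }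
  destruct (rad_cofinal (Cmod (psi v))) as [q Hq]; [apply Hp; now apply (rad_disc p)|].
  exists q, K. intros f. apply seminorm_lub; [apply Hol_holo0|]. intros z Hz.
  rewrite wop_in, Cmod_mult by (now apply (rad_disc p)).
  apply Rmult_le_compat; auto using Cmod_ge_0. apply seminorm_ub; [apply Hol_holo0|].
  specialize (Mv z Hz). lra.
Qed.
End WeightedComposition.

Lemma rot_selfmap be : Cmod be = 1 -> forall z, disc z -> Dn 1 (fun z => be * z)%C z /\ disc (be * z).
Proof.
  intros Hbe z Hz. split; [apply Dn_mult; [apply Dn_const|apply Dn_id]|]. now apply disc_rot.
Qed.

Lemma rot_isometry al be (Hal : Cmod al = 1) (Hbe : Cmod be = 1) :
  is_lin_isometry (wop (fun _ => al) (fun z => be * z)%C (holo_const 1 al) (rot_selfmap be Hbe)).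
Proof.
  split; [apply wop_linear|]. intros f g. unfold dist. apply Series_ext. intros n. do 2 f_equal.
  assert (Nb : be <> 0%C) by (intros E; rewrite E, Cmod_0 in Hbe; lra).
  set (V := wop _ _ _ _).
  assert (E : forall z, disc z -> Cmod (V f z - V g z) = Cmod (f (be * z)%C - g (be * z)%C)).
  { intros z Hz. unfold V. rewrite !wop_in by auto.
    replace (al * f (be * z) - al * g (be * z))%C with (al * (f (be * z) - g (be * z)))%C by ring.
    rewrite Cmod_mult, Hal. ring. }
  apply Rle_antisym; (apply seminorm_lub; [apply Hol_sub_holo0|]); intros z Hz.
  - rewrite E by (now apply (rad_disc n)). apply (seminorm_ub n (fun z => f z - g z)%C); [apply Hol_sub_holo0|].
    now rewrite Cmod_mult, Hbe, Rmult_1_l.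
  - assert (Az : Cmod (z / be) <= rad n) by (rewrite Cmod_div, Hbe by auto; lra).
    assert (X := seminorm_ub n (fun z => V f z - V g z)%C (z / be)%C (Hol_sub_holo0 _ _) Az). cbv beta in X.
    rewrite E in X by (now apply (rad_disc n)). replace (be * (z / be))%C with z in X by (field; auto). exact X.
Qed.

(** * Similarity to an isometry, in both directions *)

Section Converse.
Variable T : Hol -> Hol.
Hypothesis HT : is_CLO T.
Variable m : Hol.
Variable phi : C -> C.
Hypothesis Hs : hol_selfmap phi.
Hypothesis HW : is_wcomp_op T m phi.

Lemma elliptic_eigenvalue_similar : bijective_on_D phi -> elliptic phi ->
  (exists lam, Cmod lam = 1 /\ in_point_spectrum T lam) -> similar_to_isometry T.
Proof.
  intros Hb [p [Dp Fp]] [lam [Hlam [f [[z0 Nz0] Ef]]]].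
  destruct (bijective_fixed_point phi p Hs Hb Dp Fp) as [be [Hbe Ebe]].
  assert (Phi : forall z, disc z -> phi (tau p z) = tau p (be * z)%C).
  { intros z Hz. rewrite <- Ebe by auto. symmetry. apply tau_invol; auto. apply Hs. now apply tau_disc. }
  assert (D0 : disc z0) by (apply NNPP; intros N; apply Nz0; now apply hf_out).
  destruct (coboundary be Hbe (fun z => m (tau p z)) (fun z => f (tau p z)) lam) as [g [al [Hg [Ng [Hal Eg]]]]]; auto.
  - apply holo_tau; auto. apply Hol_holo.
  - apply holo_tau; auto. apply Hol_holo.
  - exists (tau p z0). split; [now apply tau_disc|]. now rewrite tau_invol.
  - intros z Hz. rewrite <- Phi by auto. rewrite <- (HW f) by (now apply tau_disc). apply Ef.
  - assert (Ht : forall z, disc z -> Dn 1 (tau p) z /\ disc (tau p z)) by (intros; split; [now apply tau_Dn|now apply tau_disc]).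
    assert (Hgt : holo 1 (fun z => g (tau p z))) by (now apply holo_tau).
    assert (Hgi : holo 1 (fun z => / g z)%C) by (intros z Hz; apply Dn_inv; auto).
    (* [U] multiplies by [g] and then composes with [tau p]; [Ui] composes with the involution
       [tau p] first and then divides by [g]. *)
    set (U := wop _ _ Hgt Ht). set (Ui := wop _ _ Hgi Ht).
    set (V := wop (fun _ => al) (fun z => be * z)%C (holo_const 1 al) (rot_selfmap be Hbe)).
    exists V. split; [apply wop_CLO|]. split; [now apply rot_isometry|].
    exists U, Ui. split; [apply wop_CLO|]. split; [apply wop_CLO|]. split; [|split].
    + intros h. apply functional_extensionality. apply Hol_eq. intros z Hz.
      assert (Dt := tau_disc p z Dp Hz). unfold U, Ui. rewrite !wop_in, tau_invol by auto. field. auto.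
    + intros h. apply functional_extensionality. apply Hol_eq. intros z Hz.
      assert (Dt := tau_disc p z Dp Hz). unfold U, Ui. rewrite !wop_in, tau_invol by auto. field. auto.
    + intros h. apply functional_extensionality. apply Hol_eq. intros z Hz.
      assert (Dt := tau_disc p z Dp Hz). assert (Db := disc_rot be z Hbe Hz).
      unfold Ui. rewrite wop_in, (HW (U h)), Phi by auto.
      unfold U, V. rewrite !wop_in, tau_invol by (auto; now apply tau_disc).
      transitivity (/ g z * (m (tau p z) * g (be * z)) * h (be * z))%C; [ring|].
      rewrite Eg by auto. field. auto.
Qed.

Section Similar.
Hypothesis Hsim : similar_to_isometry T.

Lemma similar_data : exists (U Ui V : Hol -> Hol) al be, is_CLO U /\ is_CLO Ui /\ is_lin_isometry V /\
  Cmod al = 1 /\ Cmod be = 1 /\ (forall (f : Hol) z, disc z -> V f z = (al * f (be * z))%C) /\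
  (forall f z, U (Ui f) z = f z) /\ (forall f z, Ui (U f) z = f z) /\ (forall f z, T (U f) z = U (V f) z).
Proof.
  destruct Hsim as [V [_ [HV [U [Ui [HU [HUi [E1 [E2 E3]]]]]]]]].
  destruct (isometry_form V HV) as [al [be [Hal [Hbe HVf]]]].
  exists U, Ui, V, al, be. do 6 (split; [assumption|]). split; [|split].
  - intros f z. now rewrite E1.
  - intros f z. now rewrite E2.
  - intros f z. rewrite <- E1. apply lin_ext; [apply HU|]. intros w. now rewrite E3.
Qed.

Lemma similar_eigenvalue : exists lam, Cmod lam = 1 /\ in_point_spectrum T lam.
Proof.
  destruct similar_data as [U [Ui [V [al [be [HU [HUi [HV [Hal [Hbe [HVf [E1 [E2 E3]]]]]]]]]]]]].
  exists al. split; auto. exists (U (Hconst 1)). split.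
  - apply NNPP. intros N.
    assert (Z : forall z, U (Hconst 1) z = 0%C) by (intros z; apply NNPP; intros X; apply N; now exists z).
    assert (Y := lin_zero Ui (proj1 HUi) _ Z 0%C). rewrite E2, Hconst_in in Y by apply disc_0.
    apply RtoC_inj in Y. lra.
  - intros z. rewrite E3. apply lin_scal; [apply HU|]. intros w.
    destruct (classic (disc w)) as [D|N].
    + rewrite HVf, !Hconst_in by (auto; now apply disc_rot). reflexivity.
    + rewrite !(hf_out _ w N). ring.
Qed.

Lemma similar_surjective (g : Hol) : exists h, forall z, T h z = g z.
Proof.
  destruct similar_data as [U [Ui [V [al [be [HU [HUi [HV [Hal [Hbe [HVf [E1 [E2 E3]]]]]]]]]]]]].
  assert (Na : al <> 0%C) by (intros ->; rewrite Cmod_0 in Hal; lra).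
  assert (Nb : be <> 0%C) by (intros ->; rewrite Cmod_0 in Hbe; lra).
  assert (Hb' : Cmod (/ be) = 1) by (rewrite Cmod_inv, Hbe by auto; apply Rinv_1).
  set (k := wop (fun _ => / al)%C (fun z => / be * z)%C (holo_const 1 (/ al)%C) (rot_selfmap (/ be) Hb') (Ui g)).
  exists (U k). intros z. rewrite E3, <- (E1 g z). apply lin_ext; [apply HU|]. apply Hol_eq. intros w Hw.
  rewrite HVf by auto. unfold k. rewrite wop_in by (now apply disc_rot).
  replace (/ be * (be * w))%C with w by (field; auto). field. auto.
Qed.

Lemma similar_injective (h : Hol) : (forall z, T h z = 0%C) -> forall z, h z = 0%C.
Proof.
  destruct similar_data as [U [Ui [V [al [be [HU [HUi [HV [Hal [Hbe [HVf [E1 [E2 E3]]]]]]]]]]]]].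
  assert (Na : al <> 0%C) by (intros ->; rewrite Cmod_0 in Hal; lra).
  assert (Nb : be <> 0%C) by (intros ->; rewrite Cmod_0 in Hbe; lra).
  assert (Hb' : Cmod (/ be) = 1) by (rewrite Cmod_inv, Hbe by auto; apply Rinv_1).
  intros H z. rewrite <- E1. apply lin_zero; [apply HU|]. clear z.
  assert (HV0 : forall z, V (Ui h) z = 0%C).
  { intros z. rewrite <- E2. apply lin_zero; [apply HUi|]. intros w. rewrite <- E3.
    rewrite (lin_ext T (proj1 HT) _ h); auto. }
  intros z. destruct (classic (disc z)) as [D|N]; [|now apply hf_out].
  assert (X := HV0 (/ be * z)%C). rewrite HVf in X by (now apply disc_rot).
  replace (be * (/ be * z))%C with z in X by (field; auto).
  apply NNPP. intros Y. now apply (Cmult_neq_0 _ _ Na Y).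
Qed.

Lemma weight_neq_0 z : disc z -> m z <> 0%C.
Proof.
  intros Hz E. destruct (similar_surjective (Hconst 1)) as [h Hh]. specialize (Hh z).
  rewrite HW, E, Hconst_in in Hh by auto. rewrite Cmult_0_l in Hh. apply RtoC_inj in Hh. lra.
Qed.

(** If [phi z = phi w], solving for 1 gives [m z = m w], and then solving for the identity gives
    [z = w]. If [phi] omits [w], let [T g = m / (phi - w)]: then [(v - w) * g v - 1] lies in the
    kernel of [T] but equals -1 at [w]. *)
Lemma similar_bijective : bijective_on_D phi.
Proof.
  split.
  - intros z w Hz Hw E.
    destruct (similar_surjective (Hconst 1)) as [h Hh]. destruct (similar_surjective Hid) as [k Hk].
    assert (A := Hh z). assert (B := Hh w). rewrite HW, Hconst_in in A, B by auto.
    assert (Nh : h (phi z) <> 0%C) by (intros X; rewrite X, Cmult_0_r in A; apply RtoC_inj in A; lra).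
    rewrite <- E in B.
    assert (M : m z = m w).
    { transitivity (m z * h (phi z) / h (phi z))%C; [field; auto|]. rewrite A, <- B. field. auto. }
    assert (A' := Hk z). assert (B' := Hk w). rewrite HW, Hid_in in A', B' by auto.
    rewrite <- A', <- B', E, M. reflexivity.
  - intros w Hw. apply NNPP. intros N.
    assert (Nz : forall z, disc z -> (phi z - w)%C <> 0%C).
    { intros z Hz. apply Csub_neq_0. intros E. apply N. now exists z. }
    assert (Hq : holo 1 (fun z => m z / (phi z - w))%C).
    { intros z Hz. apply Dn_div; [now apply Nz|now apply Hol_holo|].
      apply Dn_minus; [apply cdiff_Dn1; now apply Hs|apply Dn_const]. }
    destruct (similar_surjective (toHol _ Hq)) as [g Hg].
    assert (Hh : holo 1 (fun v => (v - w) * g v - 1)%C).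
    { apply (holo_sub 1 (fun v => (v - w) * g v)%C (fun _ => 1%C)); [|apply holo_const].
      apply (holo_mult 1 (fun v => v - w)%C); [|apply Hol_holo].
      apply (holo_sub 1 (fun v => v) (fun _ => w)); [apply holo_id|apply holo_const]. }
    assert (X := similar_injective (toHol _ Hh)). specialize (X) with (z := w).
    rewrite toHol_in in X by auto. assert (Y : ((w - w) * g w - 1)%C = 0%C).
    { apply X. intros z. destruct (classic (disc z)) as [D|Nd]; [|now apply hf_out].
      rewrite HW, toHol_in by (auto; now apply Hs).
      assert (Z := Hg z). rewrite HW, toHol_in in Z by auto. specialize (Nz z D).
      transitivity ((phi z - w) * (m z * g (phi z)) - m z)%C; [ring|]. rewrite Z. field. auto. }
    assert (Q : RtoC 1 = RtoC 0 -> False) by (intros Q; apply RtoC_inj in Q; lra).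
    apply Q. transitivity (- ((w - w) * g w - 1))%C; [ring|rewrite Y; ring].
Qed.

(** Only [mu <> 0] is recorded about the accumulated weight, because [n] stays fixed while the test
    exponent grows. *)
Lemma iter_wcomp n : forall z, disc z -> disc (Nat.iter n phi z) /\ exists mu : C, mu <> 0%C /\
  forall f : Hol, Nat.iter n T f z = (mu * f (Nat.iter n phi z))%C.
Proof.
  induction n; intros z Hz.
  - split; auto. exists (RtoC 1). split; [intros Q; apply RtoC_inj in Q; lra|]. intros f. simpl. ring.
  - destruct (IHn (phi z) (proj2 (Hs z Hz))) as [D [mu [Nmu E]]]. rewrite Nat.iter_succ_r. split; auto.
    exists (m z * mu)%C. split; [apply Cmult_neq_0; auto; now apply weight_neq_0|].
    intros f. simpl. rewrite HW, E by auto. ring.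
Qed.

(* Evaluating the equicontinuous family [T^n] on [z^k] at 0 and letting [k] tend to infinity. *)
Lemma similar_bounded_orbit : exists R, R < 1 /\ forall n, Cmod (Nat.iter n phi 0%C) <= R.
Proof.
  destruct similar_data as [U [Ui [V [al [be [HU [HUi [HV [Hal [Hbe [HVf [E1 [E2 E3]]]]]]]]]]]]].
  destruct (continuous_bounded U HU 0) as [q [K1 [HK1 B1]]].
  destruct (continuous_bounded Ui HUi q) as [r [K2 [HK2 B2]]].
  assert (R := rad_range r). exists (rad r). split; [lra|]. intros n.
  assert (It : forall f z, Nat.iter n T f z = U (Nat.iter n V (Ui f)) z).
  { intros f. induction n; intros z; [simpl; now rewrite E1|]. simpl. rewrite <- E3.
    apply lin_ext; [apply HT|auto]. }
  assert (Iv : forall f : Hol, seminorm (S q) (Nat.iter n V f) = seminorm (S q) f).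
  { intros f. clear It. induction n; simpl; auto. now rewrite (isometry_seminorm V HV). }
  destruct (iter_wcomp n 0%C disc_0) as [D [mu [Nmu E]]].
  set (x := Nat.iter n phi 0%C) in *.
  (* [mu] and [x] depend on [n], but [K1], [K2] and [r] do not, since the powers of [V] preserve the
     seminorms. *)
  assert (Hk : forall k, Cmod mu * Cmod x ^ k <= K1 * K2 * rad r ^ k).
  { intros k. assert (Hp : holo 1 (fun z => z ^ k)%C) by (intros z Hz; apply (Dn_pow 1 (fun z => z)), Dn_id).
    set (f := toHol _ Hp).
    assert (X : Cmod (Nat.iter n T f 0%C) = Cmod mu * Cmod x ^ k).
    { rewrite E. unfold f. rewrite toHol_in, Cmod_mult, Cmod_pow by auto. reflexivity. }
    rewrite <- X, It, <- (seminorm_1 _ (Hol_holo0 _)).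
    eapply Rle_trans; [apply B1|]. rewrite Iv, Rmult_assoc. apply Rmult_le_compat_l; auto.
    eapply Rle_trans; [apply B2|]. apply Rmult_le_compat_l; auto.
    apply seminorm_lub; [apply Hol_holo0|]. intros z Hz. unfold f.
    rewrite toHol_in, Cmod_pow by (now apply (rad_disc r)). apply pow_incr. split; auto using Cmod_ge_0. }
  apply (pow_dominated (Cmod mu) (K1 * K2)); auto; [now apply Cmod_gt_0|nra|lra].
Qed.

Lemma similar_elliptic : elliptic phi.
Proof.
  destruct (bijective_moebius phi Hs similar_bijective) as [c [a [Hc [Da E]]]].
  destruct similar_bounded_orbit as [R [HR Hit]].
  now apply (bounded_orbit_fixed phi c a R).
Qed.
End Similar.

Lemma wcomp_similar_iff : similar_to_isometry T <->
  bijective_on_D phi /\ elliptic phi /\ exists lam : C, Cmod lam = 1 /\ in_point_spectrum T lam.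
Proof.
  split.
  - intros H. split; [now apply similar_bijective|]. split; [now apply similar_elliptic|now apply similar_eigenvalue].
  - intros [H1 [H2 H3]]. now apply elliptic_eigenvalue_similar.
Qed.
End Converse.

Theorem theorem3p2 (T : Hol -> Hol) (HT : is_CLO T) :
  (forall phi : C -> C, hol_selfmap phi -> is_comp_op T phi ->
     (similar_to_isometry T <-> bijective_on_D phi /\ elliptic phi)) /\
  (forall m : Hol, is_mult_op T m ->
     (similar_to_isometry T <-> const_unimodular m)) /\
  (forall (m : Hol) (phi : C -> C), hol_selfmap phi -> is_wcomp_op T m phi ->
     (similar_to_isometry T <->
        bijective_on_D phi /\ elliptic phi /\
        exists lam : C, Cmod lam = 1 /\ in_point_spectrum T lam)).
Proof.
  split; [|split].
  - intros phi Hs HC.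
    assert (HW : is_wcomp_op T (Hconst 1) phi).
    { intros f z Hz. rewrite HC, Hconst_in by auto. ring. }
    rewrite (wcomp_similar_iff T HT (Hconst 1) phi Hs HW). split; [tauto|].
    (* For a composition operator the spectral condition is automatic: constants are fixed. *)
    intros [H1 H2]. split; auto. split; auto. exists 1%C. split; [apply Cmod_1|].
    exists (Hconst 1). split.
    + exists 0%C. rewrite Hconst_in by apply disc_0. intros Q; apply RtoC_inj in Q; lra.
    + intros z. destruct (classic (disc z)) as [D|N].
      * rewrite HC, !Hconst_in by (auto; now apply Hs). ring.
      * rewrite !(hf_out _ z N). ring.
  - intros m HM.
    assert (Hs : hol_selfmap (fun z => z)).
    { intros z Hz. split; auto. apply cdiff_Dn1, Dn_id. }
    assert (HW : is_wcomp_op T m (fun z => z)) by (intros f z Hz; now apply HM).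
    rewrite (wcomp_similar_iff T HT m (fun z => z) Hs HW). split.
    + intros [_ [_ [lam [Hlam [f [[z0 Nz0] Ef]]]]]]. exists lam. split; auto. intros z Hz.
      (* [f] may vanish at this very [z], so it is cancelled as a function rather than pointwise. *)
      assert (X : (m z - lam)%C = 0%C).
      { apply (holo_zero_product (fun z => m z - lam)%C f); auto using Hol_holo.
        - apply (holo_sub 1 m (fun _ => lam)); [apply Hol_holo|apply holo_const].
        - intros w Hw. assert (Y := Ef w). rewrite HM in Y by auto.
          transitivity (m w * f w - lam * f w)%C; [ring|rewrite Y; ring].
        - exists z0. split; auto. apply NNPP. intros N. apply Nz0. now apply hf_out. }
      transitivity (m z - lam + lam)%C; [ring|rewrite X; ring].
    + intros [c [Hc E]]. split; [split; [auto|intros w Hw; now exists w]|].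
      split; [exists 0%C; split; [apply disc_0|auto]|]. exists c. split; auto. exists (Hconst 1). split.
      * exists 0%C. rewrite Hconst_in by apply disc_0. intros Q; apply RtoC_inj in Q; lra.
      * intros z. destruct (classic (disc z)) as [D|N].
        -- rewrite HM, E by auto. reflexivity.
        -- rewrite !(hf_out _ z N). ring.
  - intros m phi Hs HW. now apply wcomp_similar_iff with (m := m).
Qed.
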